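(* Let $1<p<\infty$. Then the Banach spaces $\mathcal{F}(\ell_p)$ and $\left(\bigoplus_{n=1}^\infty \mathcal{F}(\ell_p^n)\right)_{\ell_1}$ are not isomorphic.
   Context: $\ell_p$ is the space of $p$-summable real sequences with its usual norm, and $\ell_p^n$ is $\mathbb{R}^n$ with the $p$-norm; each is regarded as a metric space with the metric induced by its norm. For a sequence $(X_n)_{n\ge1}$ of Banach spaces, $\left(\bigoplus_{n=1}^\infty X_n\right)_{\ell_1}$ is the Banach space of sequences $(x_n)_{n\geq 1}$ with $x_n\in X_n$ and $\sum_{n}\|x_n\|<\infty$, with norm $\sum_n\|x_n\|$. Two Banach spaces are isomorphic if there is a bounded linear bijection between them with bounded inverse. Lipschitz-free space: given a metric space $M$ with a basepoint $0_M\in M$, $\mathrm{Lip}_0(M)$ denotes the Banach space of Lipschitz functions $f:M\to\mathbb{R}$ with $f(0_M)=0$, normed by the Lipschitz norm (the best Lipschitz constant). For $x\in M$, let $\delta_M(x)\in \mathrm{Lip}_0(M)^*$ be the evaluation $\delta_M(x)(f)=f(x)$. The Lipschitz-free space over $M$ is $\mathcal{F}(M)=\overline{\mathrm{span}}^{\|\cdot\|}\{\delta_M(x):x\in M\}\subset \mathrm{Lip}_0(M)^*$. Up to isometric isomorphism it does not depend on the choice of basepoint. *)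

(* Defs.v *)
From HB Require Import structures.
From mathcomp Require Import all_boot all_order all_algebra.
From mathcomp Require Import all_classical all_reals all_analysis.

Set Implicit Arguments.
Unset Strict Implicit.
Unset Printing Implicit Defensive.

Import Order.TTheory GRing.Theory Num.Theory.
Import numFieldNormedType.Exports.

Local Open Scope classical_set_scope.
Local Open Scope ring_scope.

Section Bounded.
Context {R : realType}.

Definition bounded_op (V W : normedModType R) (f : V -> W) :=
  exists C : R, forall x, `|f x| <= C * `|x|.

Definition isomorphic (V W : normedModType R) :=
  exists (f : {linear V -> W}) (g : {linear W -> V}),
    [/\ cancel f g, cancel g f, bounded_op f & bounded_op g].

End Bounded.

Section NormMetric.
Context {R : realType} (V : normedModType R).

Definition norm_dist (x y : V) : R := `|x - y|.

Lemma norm_dist_ge0 x y : 0 <= norm_dist x y.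
Proof. exact: normr_ge0. Qed.

Lemma norm_dist_eq0 x y : norm_dist x y = 0 -> x = y.
Proof. by move/normr0_eq0/subr0_eq. Qed.

Lemma ball_norm_dist x d : ball x d = [set y | norm_dist x y < d].
Proof. by rewrite -ball_normE. Qed.

End NormMetric.

Section Dual.
Context {R : realType} (V : normedModType R).

(* [scalar phi] says that [phi] is linear. The bounded functionals are carried
   as a record of real-valued functions, normed by the operator norm. *)
Definition dual_pred : {pred V -> R} :=
  [pred phi | `[< scalar phi /\ bounded_op phi >]].

Record dual := Dual { dual_fun :> V -> R ; _ : dual_fun \in dual_pred }.

HB.instance Definition _ := [isSub for dual_fun].
HB.instance Definition _ := [Choice of dual by <:].

Lemma dual_submod_closed : submod_closed dual_pred.
Proof.
split=> [|a f g].
  apply/asboolP; split=> [b u v|]; first by rewrite /= mulr0 addr0.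
  by exists 0 => x; rewrite normr0 mul0r.
move=> /asboolP[fl [C fC]] /asboolP[gl [D gD]]; apply/asboolP; split.
  have E w : (a *: f + g) w = a * f w + g w by [].
  by move=> b u v; rewrite !E fl gl !mulrDr mulrCA addrACA.
exists (`|a| * C + D) => x; apply: le_trans (ler_normD _ _) _.
by rewrite mulrDl lerD// normrM -mulrA ler_wpM2l.
Qed.

HB.instance Definition _ :=
  GRing.isSubmodClosed.Build R (V -> R) dual_pred dual_submod_closed.
HB.instance Definition _ := [SubChoice_isSubLmodule of dual by <:].

Definition dual_norm (phi : dual) : R :=
  sup [set `|phi v| | v in [set v : V | `|v| <= 1]].

Lemma dual_scalar (phi : dual) : scalar phi.
Proof. by case: phi => f /= /asboolP[]. Qed.

HB.instance Definition _ (phi : dual) :=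
  GRing.isLinear.Build R V R *%R phi (dual_scalar phi).

Lemma dual_has_sup (phi : dual) :
  has_sup [set `|phi v| | v in [set v : V | `|v| <= 1]].
Proof.
split; first by exists `|phi 0|; exists 0 => //=; rewrite normr0.
case: phi => f /= /asboolP[_ [C fC]]; exists `|C| => _ [v /= v1 <-].
rewrite (le_trans (fC v))// (le_trans (ler_wpM2r _ (ler_norm C)))//.
by rewrite ler_piMr.
Qed.

Lemma dual_norm_ub (phi : dual) v : `|v| <= 1 -> `|phi v| <= dual_norm phi.
Proof. by move=> v1; apply: ub_le_sup; [exact: (dual_has_sup phi).2|exists v]. Qed.

Lemma dual_norm_le (phi : dual) (C : R) :
  (forall v, `|v| <= 1 -> `|phi v| <= C) -> dual_norm phi <= C.
Proof.
move=> H; apply: ge_sup; first exact: (dual_has_sup phi).1.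
by move=> _ [v /= v1 <-]; exact: H.
Qed.

Lemma dual_norm_ge0 (phi : dual) : 0 <= dual_norm phi.
Proof. by rewrite (le_trans _ (@dual_norm_ub phi 0 _)) ?normr0. Qed.

Lemma dual_normD (phi psi : dual) :
  dual_norm (phi + psi) <= dual_norm phi + dual_norm psi.
Proof.
apply: dual_norm_le => v v1; apply: le_trans (ler_normD _ _) _.
by rewrite lerD ?dual_norm_ub.
Qed.

Lemma dual_normZ (a : R) (phi : dual) : dual_norm (a *: phi) = `|a| * dual_norm phi.
Proof.
have H b psi : dual_norm (b *: psi) <= `|b| * dual_norm psi.
  by apply: dual_norm_le => v v1; rewrite normrM ler_wpM2l// dual_norm_ub.
apply/eqP; rewrite eq_le H/=; have [->|a0] := eqVneq a 0.
  by rewrite normr0 mul0r dual_norm_ge0.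
rewrite -ler_pdivlMl ?normr_gt0// -normfV.
by rewrite -{1}(scalerK a0 phi) H.
Qed.

Lemma dual_norm_eq0 (phi : dual) : dual_norm phi = 0 -> phi = 0.
Proof.
move=> p0; apply/val_inj/funext => v /=.
have [->|v0] := eqVneq v 0; first by rewrite linear0.
have := @dual_norm_ub phi (`|v|^-1 *: v).
rewrite normrZ normfV normr_id mulVf ?normr_eq0// => /(_ (lexx _)).
rewrite p0 normr_le0 linearZ/= mulf_eq0 invr_eq0 normr_eq0 (negPf v0)/=.
by move/eqP.
Qed.

HB.instance Definition _ :=
  Lmodule_isNormed.Build R dual dual_normD dual_normZ dual_norm_eq0.

End Dual.
Arguments dual_pred {R} V.

Section Lip0.
Context {R : realType} (M : metricType R) (o : M).

Definition lipschitz_const (f : M -> R) (k : R) :=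
  0 <= k /\ forall x y, `|f x - f y| <= k * mdist x y.

Definition lip0_pred : {pred M -> R} :=
  [pred f | `[< f o = 0 /\ exists k, lipschitz_const f k >]].

Record Lip0 := MkLip0 { lip0_fun :> M -> R ; _ : lip0_fun \in lip0_pred }.

HB.instance Definition _ := [isSub for lip0_fun].
HB.instance Definition _ := [Choice of Lip0 by <:].

Lemma lipschitz_constD f g k l : lipschitz_const f k -> lipschitz_const g l ->
  lipschitz_const (f + g) (k + l).
Proof.
move=> [k0 fk] [l0 gl]; split=> [|x y]; first exact: addr_ge0.
rewrite [(f + g) x - _](_ : _ = (f x - f y) + (g x - g y)); last first.
  by rewrite [LHS]/GRing.add/= opprD addrACA.
by rewrite (le_trans (ler_normD _ _))// mulrDl lerD.
Qed.

Lemma lipschitz_constZ a f k : lipschitz_const f k ->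
  lipschitz_const (a *: f) (`|a| * k).
Proof.
move=> [k0 fk]; split=> [|x y]; first exact: mulr_ge0.
rewrite [(a *: f) x - _](_ : _ = a * (f x - f y)); last by rewrite mulrBr.
by rewrite normrM -mulrA ler_wpM2l.
Qed.

Lemma lip0_submod_closed : submod_closed lip0_pred.
Proof.
split=> [|a f g].
  apply/asboolP; split=> //; exists 0; split=> // x y.
  by rewrite subrr normr0 mul0r.
move=> /asboolP[f0 [k fk]] /asboolP[g0 [l gl]]; apply/asboolP; split.
  by rewrite [LHS]/GRing.add/= /GRing.scale/= f0 g0 scaler0 addr0.
by exists (`|a| * k + l); apply: lipschitz_constD => //; apply: lipschitz_constZ.
Qed.

HB.instance Definition _ :=
  GRing.isSubmodClosed.Build R (M -> R) lip0_pred lip0_submod_closed.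
HB.instance Definition _ := [SubChoice_isSubLmodule of Lip0 by <:].

(* The infimum is attained (lip_normP), so this is the best Lipschitz constant. *)
Definition lip_norm (f : Lip0) : R := inf [set k | lipschitz_const f k].

Lemma lip0_base (f : Lip0) : f o = 0.
Proof. by case: f => f /= /asboolP[]. Qed.

Lemma lip_norm_le (f : Lip0) k : lipschitz_const f k -> lip_norm f <= k.
Proof. by move=> fk; apply: ge_inf => //; exists 0 => l []. Qed.

Lemma lip_normP (f : Lip0) : lipschitz_const f (lip_norm f).
Proof.
have ne : [set k | lipschitz_const f k] !=set0.
  by case: f => f /= /asboolP[_ [k fk]]; exists k.
split; first by apply: lb_le_inf => // k [].
move=> x y; have [->|xy] := eqVneq x y.
  by rewrite subrr normr0 mdistxx mulr0.
have d0 : 0 < mdist x y by rewrite mdist_gt0.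
rewrite -ler_pdivrMr//; apply: lb_le_inf => // k [k0 fk].
by rewrite ler_pdivrMr.
Qed.

Lemma lip_normD (f g : Lip0) : lip_norm (f + g) <= lip_norm f + lip_norm g.
Proof. by apply: lip_norm_le; apply: lipschitz_constD; exact: lip_normP. Qed.

Lemma lip_normZ a (f : Lip0) : lip_norm (a *: f) = `|a| * lip_norm f.
Proof.
have H b g : lip_norm (b *: g) <= `|b| * lip_norm g.
  by apply: lip_norm_le; apply: lipschitz_constZ; exact: lip_normP.
apply/eqP; rewrite eq_le H/=; have [->|a0] := eqVneq a 0.
  by rewrite normr0 mul0r (lip_normP _).1.
rewrite -ler_pdivlMl ?normr_gt0// -normfV.
by rewrite -{1}(scalerK a0 f) H.
Qed.

Lemma lip_norm_eq0 (f : Lip0) : lip_norm f = 0 -> f = 0.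
Proof.
move=> f0; apply/val_inj/funext => x /=; apply/eqP; rewrite -normr_le0.
by have := (lip_normP f).2 x o; rewrite f0 mul0r lip0_base subr0.
Qed.

HB.instance Definition _ :=
  Lmodule_isNormed.Build R Lip0 lip_normD lip_normZ lip_norm_eq0.

End Lip0.

Section LipschitzFree.
Context {R : realType} (M : metricType R) (o : M).

Lemma delta_subproof (x : M) : (fun f : Lip0 o => f x) \in dual_pred (Lip0 o).
Proof.
apply/asboolP; split=> //; exists (mdist x o) => f.
by have := (lip_normP f).2 x o; rewrite lip0_base subr0 mulrC.
Qed.

Definition delta (x : M) : dual (Lip0 o) := Dual (delta_subproof x).

Definition delta_span : set (dual (Lip0 o)) :=
  [set phi | exists n (a : 'I_n -> R) (x : 'I_n -> M),
    phi = \sum_(i < n) a i *: delta (x i)].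

(* [closure] is taken for the norm topology of the dual, and lipschitz_free
   carries the restriction of the dual norm. *)
Definition free_pred : {pred dual (Lip0 o)} := mem (closure delta_span).

Record lipschitz_free :=
  LipschitzFree { free_val :> dual (Lip0 o) ; _ : free_val \in free_pred }.

HB.instance Definition _ := [isSub for free_val].
HB.instance Definition _ := [Choice of lipschitz_free by <:].

Lemma delta_span0 : delta_span 0.
Proof.
by exists 0, (fun=> 0), (fun=> o); rewrite big_ord0.
Qed.

Lemma delta_spanP a phi psi :
  delta_span phi -> delta_span psi -> delta_span (a *: phi + psi).
Proof.
move=> [m [b [x ->]]] [n [c [y ->]]]; exists (m + n)%N.
exists (fun i => match fintype.split i with inl j => a * b j | inr k => c k end).
exists (fun i => match fintype.split i with inl j => x j | inr k => y k end).
rewrite big_split_ord/= scaler_sumr; congr (_ + _); apply: eq_bigr => i _.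
  by rewrite (unsplitK (inl i)) scalerA.
by rewrite (unsplitK (inr i)).
Qed.

Lemma free_submod_closed : submod_closed free_pred.
Proof.
split=> [|a f g]; first by apply/mem_set/subset_closure/delta_span0.
move=> /set_mem cf /set_mem cg; apply/mem_set => B.
have : continuous (fun z : dual (Lip0 o) * dual (Lip0 o) => a *: z.1 + z.2).
  move=> z; apply: cvgD; last exact: cvg_snd.
  by apply: cvgZr; exact: cvg_fst.
move=> /(_ (f, g)) /[apply] -[[/= U V] [fU gV] UVB].
have [p [sp Up]] := cf _ fU; have [q [sq Vq]] := cg _ gV.
exists (a *: p + q); split; first exact: delta_spanP.
exact: (UVB (p, q)).
Qed.

HB.instance Definition _ :=
  GRing.isSubmodClosed.Build R (dual (Lip0 o)) free_pred free_submod_closed.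
HB.instance Definition _ := [SubChoice_isSubLmodule of lipschitz_free by <:].

Definition free_norm (m : lipschitz_free) : R := `|free_val m|.

Lemma free_normD m n : free_norm (m + n) <= free_norm m + free_norm n.
Proof. exact: ler_normD. Qed.

Lemma free_normZ (a : R) m : free_norm (a *: m) = `|a| * free_norm m.
Proof. exact: normrZ. Qed.

Lemma free_norm_eq0 m : free_norm m = 0 -> m = 0.
Proof. by move/normr0_eq0 => m0; exact/val_inj. Qed.

HB.instance Definition _ :=
  Lmodule_isNormed.Build R lipschitz_free free_normD free_normZ free_norm_eq0.

End LipschitzFree.

Section FiniteMinkowski.
Context {R : realType}.

Lemma powRKV (p x : R) : 1 <= p -> 0 <= x -> (x `^ p^-1) `^ p = x.
Proof.
move=> p1 x0; rewrite -powRrM mulVf ?powRr1//.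
by rewrite gt_eqF// (lt_le_trans ltr01).
Qed.

Lemma powRVK (p x : R) : 1 <= p -> 0 <= x -> (x `^ p) `^ p^-1 = x.
Proof.
move=> p1 x0; rewrite -powRrM mulfV ?powRr1//.
by rewrite gt_eqF// (lt_le_trans ltr01).
Qed.

Lemma le_powR (p x y : R) : 1 <= p -> 0 <= x -> x <= y -> x `^ p <= y `^ p.
Proof.
move=> p1 x0 xy; rewrite ge0_ler_powR ?nnegrE//.
- exact: le_trans p1.
- exact: le_trans xy.
Qed.

Lemma le_powRV (p x y : R) : 1 <= p -> 0 <= x -> x <= y ->
  x `^ p^-1 <= y `^ p^-1.
Proof.
move=> p1 x0 xy; rewrite ge0_ler_powR ?nnegrE//.
- by rewrite invr_ge0 (le_trans _ p1).
- exact: le_trans xy.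
Qed.

Lemma finite_minkowski (p : R) (p1 : 1 <= p) (u v : nat -> R) (N : nat) :
  (\sum_(k < N) `|u k + v k| `^ p) `^ p^-1 <=
  (\sum_(k < N) `|u k| `^ p) `^ p^-1 + (\sum_(k < N) `|v k| `^ p) `^ p^-1.
Proof.
have p0 : 0 < p by rewrite (lt_le_trans ltr01).
pose tr (w : nat -> R) k := if (k < N)%N then w k else 0.
have LE (w : nat -> R) : ('N[counting]_p%:E [EFin \o tr w])%E =
    ((\sum_(k < N) `|w k| `^ p) `^ p^-1)%:E.
  rewrite Lnorm_counting// -poweR_EFin; congr (_ `^ _)%E.
  rewrite (nneseries_split 0 N); last by move=> k _; rewrite poweR_ge0.
  rewrite eseries0 ?adde0 ?add0n.
    rewrite big_mkord -sumEFin; apply: eq_bigr => k _ /=.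
    by rewrite /tr ltn_ord.
  by move=> k Nk _ /=; rewrite /tr ltnNge Nk/= normr0 powR0// gt_eqF.
have := @minkowski_EFin _ _ R counting (tr u) (tr v) p.
rewrite (_ : (tr u \+ tr v)%R = tr (fun k => u k + v k)); last first.
  by apply/funext => k /=; rewrite /tr; case: ifP => // _; rewrite addr0.
by rewrite !LE -EFinD lee_fin; apply.
Qed.

End FiniteMinkowski.

Section ellp.
Context {R : realType}.

Definition psum_terms (p : R) (u : nat -> R) : nat -> R :=
  fun n => `|u n| `^ p.

Definition ellp_pred (p : R) : {pred nat -> R} :=
  [pred u | `[< cvgn (series (psum_terms p u)) >]].

(* The proof [p1] is only used to make the triangle inequality available to
   canonical inference. *)
Record ellp (p : R) (p1 : 1 <= p) :=
  Ellp { ellp_fun :> nat -> R ; _ : ellp_fun \in ellp_pred p }.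

Context (p : R) (p1 : 1 <= p).

HB.instance Definition _ := [isSub for @ellp_fun p p1].
HB.instance Definition _ := [Choice of ellp p1 by <:].

Definition pnorm (u : nat -> R) : R := limn (series (psum_terms p u)) `^ p^-1.

Lemma psum_nd (u : nat -> R) : nondecreasing_seq (series (psum_terms p u)).
Proof. by apply/nondecreasing_series => n _ _; exact: powR_ge0. Qed.

Lemma psum_le (u : nat -> R) (N : nat) : cvgn (series (psum_terms p u)) ->
  (\sum_(k < N) `|u k| `^ p) `^ p^-1 <= pnorm u.
Proof.
move=> cu; apply: le_powRV => //; first by rewrite sumr_ge0// => *; exact: powR_ge0.
by have := nondecreasing_cvgn_le (psum_nd u) cu N; rewrite /series/= big_mkord.
Qed.

Lemma psum_bounded (u : nat -> R) (C : R) : 0 <= C ->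
  (forall N, (\sum_(k < N) `|u k| `^ p) `^ p^-1 <= C) ->
  cvgn (series (psum_terms p u)) /\ pnorm u <= C.
Proof.
move=> C0 H.
have ub N : series (psum_terms p u) N <= C `^ p.
  rewrite /series/= big_mkord -[leLHS](powRKV p1); last first.
    by rewrite sumr_ge0// => *; exact: powR_ge0.
  by apply: le_powR => //; exact: powR_ge0.
have cu : cvgn (series (psum_terms p u)).
  by apply: nondecreasing_is_cvgn (psum_nd u) _; exists (C `^ p) => _ [N _ <-].
split=> //; rewrite -(powRVK p1 C0); apply: le_powRV => //.
- apply: limr_ge => //; apply: nearW => N.
  by rewrite /series/= sumr_ge0// => *; exact: powR_ge0.
- by apply: limr_le => //; exact: nearW.
Qed.

Lemma pnorm_ge0 u : 0 <= pnorm u. Proof. exact: powR_ge0. Qed.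

Lemma psumD (u v : nat -> R) :
  cvgn (series (psum_terms p u)) -> cvgn (series (psum_terms p v)) ->
  cvgn (series (psum_terms p (u + v))) /\ pnorm (u + v) <= pnorm u + pnorm v.
Proof.
move=> cu cv; apply: psum_bounded => [|N]; first by rewrite addr_ge0 ?pnorm_ge0.
apply: le_trans (finite_minkowski p1 u v N) _.
by rewrite lerD// psum_le.
Qed.

Lemma psumZ a (u : nat -> R) : cvgn (series (psum_terms p u)) ->
  cvgn (series (psum_terms p (a *: u))) /\ pnorm (a *: u) = `|a| * pnorm u.
Proof.
move=> cu.
have E : psum_terms p (a *: u) = (`|a| `^ p) *: psum_terms p u.
  by apply/funext => n; rewrite /psum_terms normrM powRM.
have SE : series (psum_terms p (a *: u)) = (`|a| `^ p) *: series (psum_terms p u).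
  by rewrite E; apply/funext => n; rewrite /series/= -scaler_sumr.
split; first by rewrite SE; exact: is_cvgZr.
rewrite /pnorm SE limZr// powRM ?powR_ge0//; first by rewrite powRVK.
apply: limr_ge => //; apply: nearW => N.
by rewrite /series/= sumr_ge0// => *; exact: powR_ge0.
Qed.

Lemma ellp_submod_closed : submod_closed (ellp_pred p).
Proof.
split=> [|a f g /asboolP cf /asboolP cg]; apply/asboolP.
  apply: (psum_bounded (lexx 0) _).1 => N.
  rewrite big1 ?powR0 ?invr_eq0 ?gt_eqF ?(lt_le_trans ltr01)// => k _.
  by rewrite normr0 powR0// gt_eqF// (lt_le_trans ltr01).
exact: (psumD (psumZ a cf).1 cg).1.
Qed.

HB.instance Definition _ :=
  GRing.isSubmodClosed.Build R (nat -> R) (ellp_pred p) ellp_submod_closed.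
HB.instance Definition _ := [SubChoice_isSubLmodule of ellp p1 by <:].

Definition ellp_norm (u : ellp p1) : R := pnorm u.

Lemma ellp_summable (u : ellp p1) : cvgn (series (psum_terms p u)).
Proof. by case: u => f /= /asboolP. Qed.

Lemma ellp_normD u v : ellp_norm (u + v) <= ellp_norm u + ellp_norm v.
Proof. exact: (psumD (@ellp_summable u) (@ellp_summable v)).2. Qed.

Lemma ellp_normZ (a : R) u : ellp_norm (a *: u) = `|a| * ellp_norm u.
Proof. exact: (psumZ a (@ellp_summable u)).2. Qed.

Lemma ellp_norm_eq0 u : ellp_norm u = 0 -> u = 0.
Proof.
move=> u0; apply/val_inj/funext => n /=; apply/eqP; rewrite -normr_le0.
rewrite -(powRVK p1 (normr_ge0 _)) -u0.
apply: le_trans (psum_le n.+1 (@ellp_summable u)).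
apply: le_powRV => //.
by rewrite big_ord_recr/= lerDr sumr_ge0// => *; exact: powR_ge0.
Qed.

HB.instance Definition _ :=
  Lmodule_isNormed.Build R (ellp p1) ellp_normD ellp_normZ ellp_norm_eq0.

HB.instance Definition _ := PseudoMetric_isMetric.Build R (ellp p1)
  (@norm_dist_ge0 R (ellp p1)) (@norm_dist_eq0 R (ellp p1))
  (@ball_norm_dist R (ellp p1)).

End ellp.

Section ellpn.
Context {R : realType}.

(* An alias of ['rV[R]_n]: the library's norm on ['rV[R]_n] itself is the sup
   norm, while [`|x|] on ellpn is the p-norm ellpn_norm. *)
Definition ellpn (p : R) (p1 : 1 <= p) (n : nat) := 'rV[R]_n.

Context (p : R) (p1 : 1 <= p) (n : nat).

HB.instance Definition _ := GRing.Lmodule.on (ellpn p1 n).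

Definition ellpn_norm (x : ellpn p1 n) : R :=
  (\sum_(i < n) `|x 0 i| `^ p) `^ p^-1.

Let ext (x : ellpn p1 n) (k : nat) : R := oapp (fun i : 'I_n => x 0 i) 0 (insub k).

Let extE x (i : 'I_n) : ext x i = x 0 i.
Proof. by rewrite /ext valK. Qed.

Lemma ellpnDE (x y : ellpn p1 n) i : (x + y) 0 i = x 0 i + y 0 i.
Proof. exact: mxE. Qed.

Lemma ellpnZE a (x : ellpn p1 n) i : (a *: x) 0 i = a * x 0 i.
Proof. exact: mxE. Qed.

Lemma ellpn_normD x y : ellpn_norm (x + y) <= ellpn_norm x + ellpn_norm y.
Proof.
have E z : ellpn_norm z = (\sum_(i < n) `|ext z i| `^ p) `^ p^-1.
  by congr (_ `^ _); apply: eq_bigr => i _; rewrite extE.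
rewrite !E; apply: le_trans (finite_minkowski p1 (ext x) (ext y) n).
rewrite le_eqVlt; apply/orP; left; apply/eqP; congr (_ `^ _).
by apply: eq_bigr => i _; rewrite !extE ellpnDE.
Qed.

Lemma ellpn_normZ (a : R) x : ellpn_norm (a *: x) = `|a| * ellpn_norm x.
Proof.
rewrite /ellpn_norm; under eq_bigr do rewrite ellpnZE normrM powRM//.
rewrite -mulr_sumr powRM ?powR_ge0//; first by rewrite powRVK.
by rewrite sumr_ge0// => *; exact: powR_ge0.
Qed.

Lemma ellpn_norm_eq0 x : ellpn_norm x = 0 -> x = 0.
Proof.
move=> x0; apply/rowP => i; rewrite [RHS]mxE; apply/eqP; rewrite -normr_le0.
rewrite -(powRVK p1 (normr_ge0 _)) -x0.
apply: le_powRV => //.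
by rewrite (bigD1 i)//= lerDl sumr_ge0// => *; exact: powR_ge0.
Qed.

HB.instance Definition _ :=
  Lmodule_isNormed.Build R (ellpn p1 n) ellpn_normD ellpn_normZ ellpn_norm_eq0.

HB.instance Definition _ := PseudoMetric_isMetric.Build R (ellpn p1 n)
  (@norm_dist_ge0 R (ellpn p1 n)) (@norm_dist_eq0 R (ellpn p1 n))
  (@ball_norm_dist R (ellpn p1 n)).

End ellpn.

Section L1Sum.
Context {R : realType} (X : nat -> normedModType R).

Definition norm_summable (x : forall n, X n) :=
  cvgn (series (fun n => `|x n|)).

Record l1sum := L1Sum {
  l1sum_fun :> forall n, X n ; l1sumP : norm_summable l1sum_fun }.

(* [forall n, X n] has no canonical module structure for dependent X, hence the
   pointwise operations below. *)
HB.instance Definition _ := gen_eqMixin l1sum.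
HB.instance Definition _ := gen_choiceMixin l1sum.

Lemma l1sum_eq (x y : l1sum) : (forall n, x n = y n) -> x = y.
Proof.
case: x y => [x xP] [y yP] /= xy.
have {}xy : x = y by exact: functional_extensionality_dep.
by move: yP; rewrite -xy => yP; congr L1Sum; exact: Prop_irrelevance.
Qed.

Definition l1norm (x : forall n, X n) : R := limn (series (fun n => `|x n|)).

Lemma l1_nd (x : forall n, X n) : nondecreasing_seq (series (fun n => `|x n|)).
Proof. by apply/nondecreasing_series. Qed.

Lemma l1_le (x : forall n, X n) N : norm_summable x ->
  \sum_(k < N) `|x k| <= l1norm x.
Proof.
by move=> cx; have := nondecreasing_cvgn_le (l1_nd x) cx N;
  rewrite /series/= big_mkord.
Qed.

Lemma l1_bounded (x : forall n, X n) (C : R) :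
  (forall N, \sum_(k < N) `|x k| <= C) -> norm_summable x /\ l1norm x <= C.
Proof.
move=> H.
have ub N : series (fun n => `|x n|) N <= C by rewrite /series/= big_mkord.
have cx : norm_summable x.
  by apply: nondecreasing_is_cvgn (l1_nd x) _; exists C => _ [N _ <-].
by split=> //; apply: limr_le => //; exact: nearW.
Qed.

Lemma l1_0 : norm_summable (fun n => 0 : X n).
Proof.
by apply: (@l1_bounded _ 0 _).1 => N; rewrite big1// => k _; rewrite normr0.
Qed.

Lemma l1_D (x y : forall n, X n) : norm_summable x -> norm_summable y ->
  norm_summable (fun n => x n + y n) /\
  l1norm (fun n => x n + y n) <= l1norm x + l1norm y.
Proof.
move=> cx cy; apply: l1_bounded => N.
apply: le_trans (lerD (l1_le N cx) (l1_le N cy)).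
by rewrite -big_split/= ler_sum// => k _; exact: ler_normD.
Qed.

Lemma l1_Z (a : R) (x : forall n, X n) : norm_summable x ->
  norm_summable (fun n => a *: x n) /\
  l1norm (fun n => a *: x n) = `|a| * l1norm x.
Proof.
move=> cx.
have SE : series (fun n => `|a *: x n|) = `|a| *: series (fun n => `|x n|).
  apply/funext => n; rewrite /series/=; under eq_bigr do rewrite normrZ.
  by rewrite -mulr_sumr.
by split; [rewrite /norm_summable SE; exact: is_cvgZr|rewrite /l1norm SE limZr].
Qed.

Lemma l1_N (x : forall n, X n) : norm_summable x ->
  norm_summable (fun n => - x n).
Proof.
move=> /(l1_Z (-1))[+ _]; rewrite /norm_summable.
by under eq_fun do rewrite scaleN1r.
Qed.

Definition l1sum0 := L1Sum l1_0.
Definition l1sum_opp (x : l1sum) := L1Sum (l1_N (@l1sumP x)).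
Definition l1sum_add (x y : l1sum) := L1Sum (l1_D (@l1sumP x) (@l1sumP y)).1.
Definition l1sum_scale (a : R) (x : l1sum) := L1Sum (l1_Z a (@l1sumP x)).1.

Lemma l1sum_addA : associative l1sum_add.
Proof. by move=> x y z; apply: l1sum_eq => n /=; rewrite addrA. Qed.
Lemma l1sum_addC : commutative l1sum_add.
Proof. by move=> x y; apply: l1sum_eq => n /=; rewrite addrC. Qed.
Lemma l1sum_add0 : left_id l1sum0 l1sum_add.
Proof. by move=> x; apply: l1sum_eq => n /=; rewrite add0r. Qed.
Lemma l1sum_addN : left_inverse l1sum0 l1sum_opp l1sum_add.
Proof. by move=> x; apply: l1sum_eq => n /=; rewrite addNr. Qed.

HB.instance Definition _ :=
  GRing.isZmodule.Build l1sum l1sum_addA l1sum_addC l1sum_add0 l1sum_addN.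

Lemma l1sum_scaleA a b x :
  l1sum_scale a (l1sum_scale b x) = l1sum_scale (a * b) x.
Proof. by apply: l1sum_eq => n /=; rewrite scalerA. Qed.
Lemma l1sum_scale1 : left_id 1 l1sum_scale.
Proof. by move=> x; apply: l1sum_eq => n /=; rewrite scale1r. Qed.
Lemma l1sum_scaleDr : right_distributive l1sum_scale +%R.
Proof. by move=> a x y; apply: l1sum_eq => n /=; rewrite scalerDr. Qed.
Lemma l1sum_scaleDl x : {morph l1sum_scale^~ x : a b / a + b}.
Proof. by move=> a b; apply: l1sum_eq => n /=; rewrite scalerDl. Qed.

HB.instance Definition _ := GRing.Zmodule_isLmodule.Build R l1sum
  l1sum_scaleA l1sum_scale1 l1sum_scaleDr l1sum_scaleDl.

Definition l1sum_norm (x : l1sum) : R := l1norm x.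

Lemma l1sum_normD x y : l1sum_norm (x + y) <= l1sum_norm x + l1sum_norm y.
Proof. exact: (l1_D (@l1sumP x) (@l1sumP y)).2. Qed.

Lemma l1sum_normZ (a : R) x : l1sum_norm (a *: x) = `|a| * l1sum_norm x.
Proof. exact: (l1_Z a (@l1sumP x)).2. Qed.

Lemma l1sum_norm_eq0 x : l1sum_norm x = 0 -> x = 0.
Proof.
move=> x0; apply: l1sum_eq => n; apply/eqP; rewrite -normr_le0 -x0.
apply: le_trans (l1_le n.+1 (@l1sumP x)).
by rewrite big_ord_recr/= lerDr sumr_ge0.
Qed.

HB.instance Definition _ :=
  Lmodule_isNormed.Build R l1sum l1sum_normD l1sum_normZ l1sum_norm_eq0.

End L1Sum.

(* Main.v *)
Require Import Defs.
From HB Require Import structures.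
From mathcomp Require Import all_boot all_order all_algebra.
From mathcomp Require Import all_classical all_reals all_analysis.
From mathcomp Require Import ring lra zify.
Import Order.TTheory GRing.Theory Num.Theory.
Import numFieldNormedType.Exports.
Set Implicit Arguments.
Unset Strict Implicit.
Unset Printing Implicit Defensive.
Local Open Scope classical_set_scope.
Local Open Scope ring_scope.

(** If the two spaces were isomorphic, one could transport to the [l1]-sum the
    vectors [mu k] of the Godefroy-Kalton lifting of [ellp] into its free space,
    where [mu k] is the average over a Hilbert cube of the derivative of
    [free_delta] in the direction [e k].  The norms of sums of [n] distinct
    [mu k] and of [n] distinct coordinate functionals grow sublinearly in [n]
    (like [n^(1/p)] and [n^(1-1/p)]), while the [k]-th coordinate functional
    takes the value 1 at [mu k].

    Such a sequence has uniformly small tails in the [l1]-sum, so it suffices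
    that in the free space of a finite-dimensional space, sequences [z k] of
    vectors and [g k] of Lipschitz functions with this sublinear growth satisfy
    [limsup z k (g k) <= 0].  Otherwise one glues perturbations [f i] of [n] of the
    functions [g k] into [sum_i +- f i (1 - chi i)], where [chi i] cuts off the region
    where the slopes of the previous [f j] add up to 1.  This sum has a Lipschitz
    constant independent of [n] and of the signs, but for suitable signs its
    pairing with the sum of the [+- z k] is at least proportional to [n], which
    contradicts the sublinear growth of the latter.  For the cut-offs to be
    harmless, the slopes of the [f i] have to be small for a finitely additive
    measure controlling all the [z k]; this is possible because the [f i] are
    obtained from the [g k] by interpolation on a grid, and for each fixed mesh
    the growth condition bounds the sum of the slopes of many such functions at
    every point. *)

(** * Sequences with sublinear sums *)

Section BanachSaks.
Context {R : realType}.

Lemma scalar_sum (V : lmodType R) (f : V -> R) : scalar f ->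
  forall (I : Type) (r : seq I) (F : I -> V),
    f (\sum_(i <- r) F i) = \sum_(i <- r) f (F i).
Proof.
move=> fl I r F; pose g : {scalar V} := HB.pack f (GRing.isLinear.Build _ _ _ _ f fl).
exact: (raddf_sum g).
Qed.

Lemma scalar_scale (V : lmodType R) (f : V -> R) : scalar f ->
  forall (a : R) u, f (a *: u) = a * f u.
Proof.
move=> fl a u; pose g : {scalar V} := HB.pack f (GRing.isLinear.Build _ _ _ _ f fl).
by rewrite -[a *: u]addr0 fl [f 0](raddf0 g) addr0.
Qed.

(** Norms of sums over [n] distinct indices are [o(n)], uniformly in the index set. The form
    [e * n + K] survives bounded maps and splittings of the index set. *)
Definition banach_saks (V : normedModType R) (z : nat -> V) :=
  forall e : R, 0 < e -> exists K : R, forall s : seq nat, uniq s ->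
    `|\sum_(k <- s) z k| <= e * (size s)%:R + K.

(** Split the indices by sign: the two sizes add up to [size s], so [e] is kept and only [K]
    doubles. *)
Lemma banach_saks_signed (V : normedModType R) (z : nat -> V) :
  banach_saks z -> forall e : R, 0 < e ->
  exists K : R, forall (s : seq nat) (sg : nat -> bool), uniq s ->
    `|\sum_(k <- s) (-1) ^+ sg k *: z k| <= e * (size s)%:R + K.
Proof.
move=> zs e e0; have [K HK] := zs _ e0; exists (K + K) => s sg us.
rewrite (bigID sg)/= [X in X + _](_ : _ = - \sum_(k <- s | sg k) z k); last first.
  by rewrite -sumrN; apply: eq_bigr => k ->; rewrite scaleN1r.
rewrite [X in _ + X](_ : _ = \sum_(k <- s | ~~ sg k) z k); last first.
  by apply: eq_bigr => k /negbTE ->; rewrite scale1r.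
rewrite -!(big_filter s) (le_trans (ler_normD _ _))// normrN.
have := lerD (HK _ (filter_uniq sg us)) (HK _ (filter_uniq (predC sg) us)).
move/le_trans; apply; rewrite addrACA -mulrDr -natrD.
by rewrite !size_filter count_predC.
Qed.

Lemma banach_saks_bounded (V : normedModType R) (z : nat -> V) :
  banach_saks z -> exists2 C : R, 0 < C & forall k, `|z k| <= C.
Proof.
move=> /(_ 1 ltr01)[K HK]; exists (1 + `|K|) => [|k].
  by rewrite ltr_wpDr.
have := HK [:: k] isT; rewrite big_seq1/= mulr1 => /le_trans; apply.
by rewrite lerD2l ler_norm.
Qed.

Lemma banach_saks_image (V W : normedModType R) (f : V -> W) (z : nat -> V) :
  linear f -> bounded_op f -> banach_saks z -> banach_saks (f \o z).
Proof.
move=> fl [C fC] zs e e0.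
have C0 : 0 < `|C| + 1 by rewrite ltr_wpDl.
have [K HK] := zs (e / (`|C| + 1)) (divr_gt0 e0 C0).
pose F : {linear V -> W} := HB.pack f (GRing.isLinear.Build _ _ _ _ f fl).
exists ((`|C| + 1) * K) => s us.
rewrite -[X in `|X|](raddf_sum F) (le_trans (fC _))//.
apply: (@le_trans _ _ ((`|C| + 1) * `|\sum_(i <- s) z i|)).
  by rewrite ler_wpM2r// (le_trans (ler_norm C))// lerDl.
apply: le_trans (ler_wpM2l (ltW C0) (HK _ us)) _.
by rewrite mulrDr mulrA mulrCA mulfV ?gt_eqF// mulr1.
Qed.

Lemma eq_big_keys (I T : Type) (idx : T) (op : T -> T -> T) (F G : nat * I -> T)
    (l : seq (nat * I)) (k : nat) : k \notin map fst l ->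
  (forall q, q.1 != k -> F q = G q) ->
  \big[op/idx]_(q <- l) F q = \big[op/idx]_(q <- l) G q.
Proof.
move=> + FG; elim: l => [|q l IH] /=; first by rewrite !big_nil.
by rewrite inE negb_or eq_sym => /andP[qk /IH E]; rewrite !big_cons FG// E.
Qed.

(* Averaging over all signs would kill the off-diagonal terms; choosing the
   signs one after the other gives the same bound. *)
Lemma exists_signs (I : Type) (a : nat * I -> nat * I -> R) (l : seq (nat * I)) :
  uniq (map fst l) -> exists sg : nat -> bool,
    \sum_(p <- l) a p p <=
    \sum_(p <- l) \sum_(q <- l) (-1) ^+ sg p.1 * ((-1) ^+ sg q.1 * a p q).
Proof.
elim: l => [|p l IH]/=; first by exists (fun=> false); rewrite !big_nil.
move=> /andP[pl /IH[sg Hsg]].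
(* [c] collects the cross terms of [p] with the entries whose signs are already fixed; the sign of
   [p] makes them contribute [|c|]. *)
pose c : R := \sum_(q <- l) (-1) ^+ sg q.1 * (a p q + a q p).
pose sg' k := if k == p.1 then c < 0 else sg k.
have E (q : nat * I) : q.1 != p.1 -> sg' q.1 = sg q.1 by rewrite /sg' => /negbTE ->.
have Ep : sg' p.1 = (c < 0) by rewrite /sg' eqxx.
exists sg'; rewrite !big_cons.
under [X in _ <= _ + X]eq_bigr do rewrite big_cons.
rewrite big_split/= addrA lerD//; last first.
  apply: le_trans Hsg _; rewrite le_eqVlt; apply/orP; left; apply/eqP.
  apply: (eq_big_keys _ _ pl) => q qp; apply: (eq_big_keys _ _ pl) => r rp.
  by rewrite !E.
rewrite !Ep mulrA -expr2 sqrr_sign mul1r -addrA lerDl.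
rewrite (_ : _ + _ = (-1) ^+ (c < 0)%R * c).
  by case: ltrP => [/ltW c0|c0] /=; rewrite ?mulN1r ?mul1r ?oppr_ge0.
rewrite /c mulr_sumr -big_split/=; apply: (eq_big_keys _ _ pl) => q qp.
by rewrite E//; ring.
Qed.

(** Test the signed sum of functionals on the signed sum of vectors. Good signs leave at least the
    diagonal, that is [c * n], while [B] and the sublinear growth allow only [o(n)]. *)
Lemma banach_saks_no_dual_system (V : normedModType R) (z : nat -> V) (B c : R) :
  banach_saks z -> 0 <= B -> 0 < c ->
  (forall n : nat, exists l : seq (nat * (V -> R)),
    [/\ size l = n, uniq (map fst l),
        forall p, List.In p l -> scalar p.2 /\ c <= p.2 (z p.1) &
        forall (sg : nat -> bool) v,
          `|\sum_(p <- l) (-1) ^+ sg p.1 * p.2 v| <= B * `|v|]) -> False.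
Proof.
move=> zs B0 c0 H.
have B1 : 0 < B + 1 by rewrite ltr_wpDl.
(* With this [e], the term [(B + 1) * e * n] is half of [c * n]; [B + 1] avoids a division by
   zero. *)
have [K HK] := banach_saks_signed zs (divr_gt0 c0 (mulr_gt0 (ltr0Sn R 1) B1)).
have [n nK] : exists n : nat, 2 * (B + 1) * K < c * n%:R.
  exists (Num.bound `|2 * (B + 1) * K / c|).
  rewrite [c * _]mulrC -ltr_pdivrMr//.
  by rewrite (le_lt_trans (ler_norm _))// archi_boundP.
have [l [ln ul lc lB]] := H n.
have [sg Hsg] := exists_signs (fun p q : nat * (V -> R) => q.2 (z p.1)) ul.
pose v := \sum_(p <- l) (-1) ^+ sg p.1 *: z p.1.
have lv : \sum_(p <- l) (-1) ^+ sg p.1 * p.2 v =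
    \sum_(p <- l) \sum_(q <- l) (-1) ^+ sg p.1 * ((-1) ^+ sg q.1 * q.2 (z p.1)).
  rewrite exchange_big/=.
  have {lc} : forall p, List.In p l -> scalar p.2 by move=> p pl; exact: (lc p pl).1.
  have gen (l1 l2 : seq (nat * (V -> R))) :
      (forall p, List.In p l1 -> scalar p.2) ->
      \sum_(p <- l1) (-1) ^+ sg p.1 * p.2 (\sum_(q <- l2) (-1) ^+ sg q.1 *: z q.1)
      = \sum_(p <- l1) \sum_(q <- l2)
          (-1) ^+ sg q.1 * ((-1) ^+ sg p.1 * p.2 (z q.1)).
    elim: l1 => [|p l1 IH] lc; first by rewrite !big_nil.
    rewrite !big_cons IH; last by move=> q ql; apply: lc; right.
    congr (_ + _).
    have pl := lc p (or_introl erefl).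
    rewrite (scalar_sum pl) mulr_sumr; apply: eq_bigr => q _.
    by rewrite (scalar_scale pl); ring.
  exact: gen.
have : \sum_(p <- l) p.2 (z p.1) <= B * `|v|.
  by rewrite (le_trans Hsg)// -lv (le_trans (ler_norm _)).
have : c * n%:R <= \sum_(p <- l) p.2 (z p.1).
  rewrite -ln; elim: l lc {ul lB Hsg ln v lv} => [|p l IH] lc.
    by rewrite big_nil mulr0.
  rewrite big_cons/= -addn1 addnC natrD mulrDr mulr1 lerD//.
    by have [] := lc p (or_introl erefl).
  by apply: IH => q ql; apply: lc; right.
move=> /le_trans /[apply].
have := HK _ sg ul; rewrite size_map ln big_map -/v => vK nv.
have : c * n%:R <= (B + 1) * (c / (2 * (B + 1)) * n%:R + K).
  apply: le_trans nv _; rewrite (le_trans (ler_wpM2l B0 vK))//.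
  rewrite ler_wpM2r ?lerDl// (le_trans _ vK)//.
rewrite mulrDr (_ : _ * (_ * _) = c * n%:R / 2); first by lra.
by field; rewrite gt_eqF.
Qed.

End BanachSaks.

(** * A finitely additive measure controlling a sequence of functionals *)

Section HahnBanach.
Context {R : realType} (V : lmodType R).

Definition sublinear (q : V -> R) :=
  (forall u v, q (u + v) <= q u + q v) /\
  (forall (a : R) u, 0 < a -> q (a *: u) <= a * q u).

Lemma sublinearZ (q : V -> R) (a : R) u : sublinear q -> 0 <= a ->
  q (a *: u) = a * q u.
Proof.
move=> [_ qZ]; have H b w : 0 < b -> q (b *: w) = b * q w.
  move=> b0; apply/eqP; rewrite eq_le qZ//= -ler_pdivlMl//.
  by rewrite -{1}(scalerK (lt0r_neq0 b0) w) qZ// invr_gt0.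
rewrite le_eqVlt => /predU1P[<-|]; last exact: H.
have := H 2 0 (ltr0Sn R 1); rewrite scaler0 scale0r mul0r; lra.
Qed.

Lemma sublinearN (q : V -> R) u : sublinear q -> - q (- u) <= q u.
Proof.
move=> qs; have := qs.1 u (- u); rewrite subrr.
by rewrite -(scale0r u) (sublinearZ _ qs (lexx 0)) mul0r; lra.
Qed.

(** The values at [u] are bounded below by [- Q (- u)], so the infimum is finite. For subadditivity,
    the smaller of two members of the chain serves for both vectors. *)
Lemma chain_inf_sublinear (Q : V -> R) (A : set (V -> R)) : A !=set0 ->
  (forall q, A q -> sublinear q /\ forall u, q u <= Q u) ->
  total_on A (fun q r => forall u, r u <= q u) ->
  exists t, [/\ sublinear t, forall u, t u <= Q u & forall q, A q -> forall u, t u <= q u].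
Proof.
move=> [q0 Aq0] AQ Atot; pose t u := inf [set q u | q in A].
have tne u : [set q u | q in A] !=set0 by exists (q0 u), q0.
have tle q u : A q -> t u <= q u.
  move=> Aq; apply: ge_inf; last by exists q.
  exists (- Q (- u)) => _ [r Ar <-].
  have [rs rQ] := AQ r Ar; rewrite (le_trans _ (sublinearN u rs))//.
  by rewrite lerN2.
exists t; split => [|u|q Aq u]; last exact: tle.
- split=> [u v|a u a0].
    rewrite -lerBlDl; apply: lb_le_inf => // _ [r Ar <-].
    rewrite lerBlDl -lerBlDr; apply: lb_le_inf => // _ [q Aq <-].
    rewrite lerBlDr; have [qr|rq] := Atot q r Aq Ar.
      by rewrite (le_trans (tle _ _ Ar))// (le_trans ((AQ r Ar).1.1 _ _))// lerD2r.
    by rewrite (le_trans (tle _ _ Aq))// (le_trans ((AQ q Aq).1.1 _ _))// lerD2l.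
  rewrite -ler_pdivrMl//; apply: lb_le_inf => // _ [q Aq <-].
  by rewrite ler_pdivrMl// (le_trans (tle _ _ Aq))// ((AQ q Aq).1.2 _ _ a0).
- by rewrite (le_trans (tle _ _ Aq0))// (AQ _ Aq0).2.
Qed.

(** Take the infimum of [q (u + t *: v) - t * q v] over [t >= 0]; [t = 0] and [t = 1] give the two
    bounds. *)
Lemma shift_inf_sublinear (q : V -> R) (v : V) : sublinear q ->
  exists r, [/\ sublinear r, forall u, r u <= q u & forall u, r u <= q (u + v) - q v].
Proof.
move=> qs; pose S u := [set q (u + t *: v) - t * q v | t in [set t | 0 <= t]].
have Sne u : S u !=set0 by exists (q (u + 0 *: v) - 0 * q v), 0 => /=.
have rle u t : 0 <= t -> inf (S u) <= q (u + t *: v) - t * q v.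
  move=> t0; apply: ge_inf; last by exists t.
  exists (- q (- u)) => _ [x /= x0 <-].
  rewrite -(sublinearZ _ qs x0).
  have := qs.1 (u + x *: v) (- u); rewrite addrAC subrr add0r; lra.
exists (fun u => inf (S u)); split => [|u|u].
- split=> [u w|a u a0].
    rewrite -lerBlDl; apply: lb_le_inf => // _ [x /= x0 <-].
    rewrite lerBlDl -lerBlDr; apply: lb_le_inf => // _ [y /= y0 <-].
    rewrite lerBlDr (le_trans (rle _ (y + x) _))// ?addr_ge0//.
    have := qs.1 (u + y *: v) (w + x *: v).
    by rewrite addrACA -scalerDl; lra.
  rewrite -ler_pdivrMl//; apply: lb_le_inf => // _ [x /= x0 <-].
  have ax : 0 <= a * x by rewrite mulr_ge0// ltW.
  rewrite ler_pdivrMl// (le_trans (rle _ _ ax))//.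
  by rewrite -scalerA -scalerDr (sublinearZ _ qs (ltW a0)) mulrBr mulrA.
- by rewrite (le_trans (rle _ 0 _))// scale0r addr0 mul0r subr0.
- by rewrite (le_trans (rle _ 1 _))// scale1r mul1r.
Qed.

(* A minimal sublinear functional is linear: shift_inf_sublinear forces it to
   be superadditive. *)
Lemma hahn_banach_sublinear (Q : V -> R) : sublinear Q ->
  exists2 f : V -> R, scalar f & forall u, f u <= Q u.
Proof.
move=> Qs.
pose T := {q : V -> R | sublinear q /\ forall u, q u <= Q u}.
(* The order is reversed, so that a maximal element is a minimal functional. *)
pose ord (q r : T) := `[< forall u, sval r u <= sval q u >].
have [||||[q [qs qQ]] qmin] := @Zorn T ord.
- by move=> q; apply/asboolP => u.
- move=> q r s /asboolP qr /asboolP rs; apply/asboolP => u.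
  by rewrite (le_trans (rs u)).
- move=> [q qP] [r rP] /asboolP/= qr /asboolP/= rq.
  have E : q = r by apply/funext => u; apply/eqP; rewrite eq_le (qr u) (rq u).
  by move: qP rP qr rq; rewrite E => qP rP _ _; congr exist; exact: Prop_irrelevance.
- move=> A Atot; have [->|/set0P[q0 Aq0]] := eqVneq A set0.
    by exists (exist _ Q (conj Qs (fun=> lexx _))).
  have [|||t [ts tQ tA]] := @chain_inf_sublinear Q [set sval q | q in A].
  + by exists (sval q0), q0.
  + by move=> _ [q _ <-]; exact: (svalP q).
  + by move=> _ _ [q Aq <-] [r Ar <-]; have [/asboolP|/asboolP] := Atot q r Aq Ar; [left|right].
  exists (exist _ t (conj ts tQ)) => q Aq; apply/asboolP => u /=.
  by apply: tA; exists q.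
have qD u v : q (u + v) = q u + q v.
  apply/eqP; rewrite eq_le qs.1/=.
  have [r [rs rq rv]] := shift_inf_sublinear v qs.
  have rQ w : r w <= Q w by rewrite (le_trans (rq w)).
  have [rE] := qmin (exist _ r (conj rs rQ)) (asboolT rq).
  by rewrite -lerBrDr -{1}rE.
have q0 : q 0 = 0 by have := qD 0 0; rewrite addr0; lra.
have qN u : q (- u) = - q u by have := qD u (- u); rewrite subrr q0; lra.
exists q => // a u v; rewrite qD; congr (_ + _).
have [a0|a0] := leP 0 a; first exact: sublinearZ.
rewrite -[a]opprK scaleNr qN (sublinearZ _ qs) ?mulNr//.
by rewrite oppr_ge0 ltW.
Qed.

End HahnBanach.

(** * Bounded functions and the mean attached to a sequence of functionals *)

Section BoundedFunctions.
Context {R : realType} (X : Type).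

Definition bfun_pred : {pred X -> R} :=
  [pred f | `[< exists C : R, forall x, `|f x| <= C >]].

Record bfun := Bfun { bfun_fun :> X -> R ; _ : bfun_fun \in bfun_pred }.

HB.instance Definition _ := [isSub for bfun_fun].
HB.instance Definition _ := [Choice of bfun by <:].

Lemma bfun_submod_closed : submod_closed bfun_pred.
Proof.
split=> [|a f g].
  by apply/asboolP; exists 0 => x; rewrite normr0.
move=> /asboolP[C fC] /asboolP[D gD]; apply/asboolP; exists (`|a| * C + D) => x.
rewrite [(a *: f + g) x](_ : _ = a * f x + g x)//.
by rewrite (le_trans (ler_normD _ _))// lerD// normrM ler_wpM2l.
Qed.

HB.instance Definition _ :=
  GRing.isSubmodClosed.Build R (X -> R) bfun_pred bfun_submod_closed.
HB.instance Definition _ := [SubChoice_isSubLmodule of bfun by <:].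

End BoundedFunctions.
Arguments bfun_pred {R} X.

Section DominatingMean.
Context {R : realType} (M : metricType R) (o : M).

Definition slope_le (f w : M -> R) := forall x y, `|f x - f y| <= w x * mdist x y.

Context (z : nat -> Lip0 o -> R) (C : R) (I : set nat).
Hypotheses (zl : forall k, scalar (z k)) (C0 : 0 <= C)
  (zC : forall k f, `|z k f| <= C * lip_norm f).
Hypothesis Iinf : forall n, exists2 l, (n <= l)%N & I l.

Let ev (w : M -> R) (r : R) := exists n, forall l, (n <= l)%N -> I l ->
  exists2 f : Lip0 o, slope_le f w & r <= z l f.

(** The infimum [Q] over this set is sublinear. For a linear functional below [Q], taking [w = 0]
    and [r = 0] gives the upper bound [C * c], and taking [u = - w] and [c = 0] gives the lower
    bound [r] at [w]. *)
Let S (u : bfun M) := [set s | exists c r (w : M -> R),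
  [/\ s = C * c - r, forall x, 0 <= w x, forall x, u x + w x <= c & ev w r]].

Let ev0 : ev (fun=> 0) 0.
Proof.
exists 0%N => l _ _; exists 0.
  by move=> x y; rewrite mul0r subrr normr0.
by rewrite -(scale0r (0 : Lip0 o)) (scalar_scale (zl l)) mul0r.
Qed.

(** Since [w <= c + B], a test function of slope at most [w] has Lipschitz constant at most [c + B],
    whence [r <= C * (c + B)]. Such a function exists because [I] is infinite. *)
Let lbS (u : bfun M) : exists B, lbound (S u) B.
Proof.
have /asboolP[B uB] := valP u; exists (- (C * B)) => _ [c [r [w [-> w0 uw [n wr]]]]].
have [l nl Il] := Iinf n; have [f fw rf] := wr l nl Il.
have kB x : w x <= c + B.
  have := uw x; have : `|u x| <= B := uB x; rewrite ler_norml => /andP[]; lra.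
have : lip_norm f <= c + B.
  apply: lip_norm_le; split=> [|x y]; first by rewrite (le_trans (w0 o)).
  by rewrite (le_trans (fw x y))// ler_wpM2r// mdist_ge0.
move=> /(ler_wpM2l C0); have := le_trans rf (le_trans (ler_norm _) (zC l f)).
by rewrite mulrDr; lra.
Qed.

Let Sc (u : bfun M) c : (forall x, u x <= c) -> S u (C * c).
Proof. by move=> uc; exists c, 0, (fun=> 0); split=> // [|x]; rewrite ?subr0 ?addr0. Qed.

Let Sne (u : bfun M) : S u !=set0.
Proof.
have /asboolP[B uB] := valP u; exists (C * B); apply: Sc => x.
exact: le_trans (ler_norm _) (uB x).
Qed.

Let Q (u : bfun M) := inf (S u).

Let Qle u s : S u s -> Q u <= s.
Proof. by move=> us; apply: ge_inf => //; exact: lbS. Qed.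

Let Qsub : sublinear Q.
Proof.
split=> [u v|a u a0].
  rewrite -lerBlDl; apply: lb_le_inf => // _ [d [t [y [-> y0 vy [m yt]]]]].
  rewrite lerBlDl -lerBlDr; apply: lb_le_inf => // _ [c [r [w [-> w0 uw [n wr]]]]].
  rewrite lerBlDr; apply: Qle; exists (c + d), (r + t), (fun x => w x + y x).
  split=> [||x|]; [by ring|by move=> x; rewrite addr_ge0| |].
    by rewrite [(u + v) x](_ : _ = u x + v x)// addrACA lerD.
  exists (maxn n m) => l; rewrite geq_max => /andP[nl ml] Il.
  have [f fw rf] := wr l nl Il; have [g gy tg] := yt l ml Il.
  exists (1 *: f + g); last by rewrite (zl l) mul1r lerD.
  move=> p q; rewrite scale1r [_ - _](_ : _ = (f p - f q) + (g p - g q)).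
    by rewrite (le_trans (ler_normD _ _))// mulrDl lerD.
  by rewrite [(f + g) p](_ : _ = f p + g p)// [(f + g) q](_ : _ = f q + g q)//; ring.
rewrite -ler_pdivrMl//; apply: lb_le_inf => // _ [c [r [w [-> w0 uw [n wr]]]]].
rewrite ler_pdivrMl//; apply: Qle; exists (a * c), (a * r), (fun x => a * w x).
split=> [|x|x|]; [by ring|by rewrite mulr_ge0// ltW| |].
  by rewrite [(a *: u) x](_ : _ = a * u x)// -mulrDr ler_wpM2l// ltW.
exists n => l nl Il; have [f fw rf] := wr l nl Il; exists (a *: f).
  move=> p q; rewrite [_ - _](_ : _ = a * (f p - f q)); last by rewrite mulrBr.
  by rewrite normrM gtr0_norm// -mulrA ler_wpM2l// ltW.
by rewrite (scalar_scale (zl l)) ler_wpM2l// ltW.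
Qed.

(* The functional is a linear majorant of the superlinear functional
   [w |-> liminf_(l in I) sup {z l f | slope_le f w}]. *)
Lemma dominating_mean : exists nu : (M -> R) -> R,
  [/\ forall (a : R) u v, u \in bfun_pred M -> v \in bfun_pred M ->
        nu (a *: u + v) = a * nu u + nu v,
      forall u c, u \in bfun_pred M -> (forall x, u x <= c) -> nu u <= C * c &
      forall w r, w \in bfun_pred M -> (forall x, 0 <= w x) ->
        (exists n, forall l, (n <= l)%N -> I l ->
          exists2 f : Lip0 o, slope_le f w & r <= z l f) -> r <= nu w].
Proof.
have [phi phil phiQ] := hahn_banach_sublinear Qsub.
(* [insubd] sends unbounded functions to [0], which makes the mean defined on all functions. *)
exists (fun u => phi (insubd (0 : bfun M) u)).
have E (u : M -> R) (ub : u \in bfun_pred M) : insubd (0 : bfun M) u = Bfun ub.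
  by apply/val_inj; rewrite insubdK.
split=> [a u v ub vb|u c ub uc|w r wb w0 wr].
- have ab : a *: u + v \in bfun_pred M by exact: rpredD (rpredZ _ ub) vb.
  rewrite (E _ ub) (E _ vb) (E _ ab) -phil; congr phi; exact/val_inj.
- by rewrite (E _ ub) (le_trans (phiQ _))// Qle//; exact: Sc.
- rewrite (E _ wb); have := phiQ (- Bfun wb).
  rewrite -scaleN1r (scalar_scale phil) mulN1r => wQ.
  rewrite -lerN2 (le_trans wQ)// Qle//; exists 0, r, w; split=> // [|x].
    by rewrite mulr0 sub0r.
  by rewrite [(-1 *: Bfun wb) x](_ : _ = -1 * w x)// mulN1r addNr.
Qed.

End DominatingMean.

(** * The lifting of a nonexpansive map *)

Lemma subrACA (V : zmodType) : interchange (fun x y : V => x - y) (fun x y => x - y).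
Proof. by move=> x y z t; rewrite !opprB addrACA [- y - z]addrC addrACA. Qed.

Lemma exp2_half {R : realType} (m n : nat) : (m <= n)%N ->
  (2 ^ (n - m))%:R * 2^-1 ^+ n = 2^-1 ^+ m :> R.
Proof.
move=> mn.
by rewrite -{2}(subnK mn) exprD mulrA natrX -exprMn mulfV ?expr1n ?mul1r.
Qed.

Lemma ler_sum_uniq_sub {R : realType} (I : eqType) (s t : seq I) (F : I -> R) :
  uniq s -> uniq t -> {subset s <= t} -> (forall i, 0 <= F i) ->
  \sum_(i <- s) F i <= \sum_(i <- t) F i.
Proof.
move=> us ut st F0; rewrite [leRHS](bigID (mem s))/=.
rewrite (perm_big [seq i <- t | i \in s]) ?big_filter; last first.
  rewrite perm_sym; apply: uniq_perm; rewrite ?filter_uniq// => i; rewrite mem_filter.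
  by have [/st ->|//] := boolP (i \in s).
by rewrite lerDl sumr_ge0.
Qed.

Section Averages.
Context {R : realType} (X V : normedModType R).

Definition nonexpansive (f : X -> V) := forall x y, `|f x - f y| <= `|x - y|.

Definition avg (v : X) (n : nat) (f : X -> V) : X -> V :=
  fun x => n%:R^-1 *: \sum_(i < n) f (x + v *+ i).

Lemma avg_term (n : nat) (a b : nat -> V) (d : R) : 0 <= d ->
  (forall i, (i < n)%N -> `|a i - b i| <= d) ->
  `|n%:R^-1 *: \sum_(i < n) a i - n%:R^-1 *: \sum_(i < n) b i| <= d.
Proof.
move=> d0 abd; rewrite -scalerBr -sumrB normrZ normfV normr_nat.
case: n abd => [_|n abd]; first by rewrite invr0 mul0r.
rewrite ler_pdivrMl ?ltr0Sn// (le_trans (ler_norm_sum _ _ _))//.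
apply: (@le_trans _ _ (\sum_(i < n.+1) d)).
  by apply: ler_sum => i _; exact: abd.
by rewrite sumr_const card_ord mulr_natl.
Qed.

Lemma avg_comm (v w : X) (m n : nat) (f : X -> V) :
  avg v m (avg w n f) = avg w n (avg v m f).
Proof.
apply/funext => x; rewrite /avg /= -!scaler_sumr !scalerA mulrC; congr (_ *: _).
rewrite exchange_big; apply: eq_bigr => i _; apply: eq_bigr => j _.
by rewrite addrAC.
Qed.

Lemma avg_const (n : nat) (a : V) : (0 < n)%N -> n%:R^-1 *: \sum_(i < n) a = a.
Proof.
move=> n0; rewrite sumr_const card_ord -[a *+ n]scaler_nat scalerA mulVf ?scale1r//.
by rewrite pnatr_eq0 -lt0n.
Qed.

(** The two averages share all samples except one at each end. *)
Lemma avg_step (v : X) (n : nat) (f : X -> V) (x : X) : (0 < n)%N ->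
  avg v n f (x + v) - avg v n f x = n%:R^-1 *: (f (x + v *+ n) - f x).
Proof.
move=> n0; rewrite /avg -scalerBr; congr (_ *: _).
under eq_bigr do rewrite -addrA -mulrS.
have := @telescope_sumr V 0%N n (fun i => f (x + v *+ i)) isT.
rewrite mulr0n addr0 => <-.
by rewrite big_mkord sumrB.
Qed.

Lemma avg_nonexpansive (v : X) (n : nat) (f : X -> V) :
  nonexpansive f -> nonexpansive (avg v n f).
Proof.
move=> fl x y.
apply: (@avg_term n (fun i => f (x + v *+ i)) (fun i => f (y + v *+ i))) => // i _.
by rewrite (le_trans (fl _ _))// opprD addrACA subrr addr0.
Qed.

Lemma avg_dist (v : X) (n : nat) (f g : X -> V) (d : R) : 0 <= d ->
  (forall x, `|f x - g x| <= d) -> forall x, `|avg v n f x - avg v n g x| <= d.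
Proof.
move=> d0 fg x.
by apply: (@avg_term n (fun i => f (x + v *+ i)) (fun i => g (x + v *+ i))).
Qed.

Lemma avg_near (v : X) (n : nat) (f : X -> V) : (0 < n)%N -> nonexpansive f ->
  forall x, `|avg v n f x - f x| <= n%:R * `|v|.
Proof.
move=> n0 fl x; rewrite -{1}(avg_const (f x) n0).
apply: (@avg_term n (fun i => f (x + v *+ i)) (fun=> f x)) => [|i /ltnW ni].
  by rewrite mulr_ge0.
rewrite (le_trans (fl _ _))// addrAC subrr add0r normrMn mulr_natl.
by rewrite ler_wpMn2l.
Qed.

(** The fine average is a coarse average of averages over one coarse cell, and these differ from [f]
    by at most the cell length. *)
Lemma avg_refine (v : X) (n q : nat) (f : X -> V) : (0 < q)%N -> nonexpansive f ->
  forall x, `|avg v (n * q) f x - avg (v *+ q) n f x| <= q%:R * `|v|.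
Proof.
move=> q0 fl x.
have -> : avg v (n * q) f x = avg (v *+ q) n (avg v q f) x.
  rewrite /avg -scaler_sumr scalerA natrM invfM; congr (_ *: _).
  elim: n => [|n IH]; first by rewrite mul0n !big_ord0.
  rewrite big_ord_recr/= -IH mulSnr big_split_ord/=; congr (_ + _).
  by apply: eq_bigr => i _; rewrite mulrnDr mulnC mulrnA addrA.
by apply: avg_dist => [|y]; [rewrite mulr_ge0|exact: avg_near].
Qed.

Context (e : nat -> X) (e1 : forall j, `|e j| <= 1).

Local Notation half n := ((2^-1 : R) ^+ n).

(* The average over the coordinates [j] in [l], the j-th one ranging over the
   grid of mesh [2^-H] in [[0, 2^-(j^2)[]. *)
Definition avgs (H : nat) (l : seq nat) (f : X -> V) : X -> V :=
  foldr (fun j F => avg (half H *: e j) (2 ^ (H - j ^ 2)) F) f l.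

Let half_ge0 n : 0 <= half n. Proof. by rewrite exprn_ge0. Qed.

Lemma avgs_nonexpansive H l f : nonexpansive f -> nonexpansive (avgs H l f).
Proof. by move=> fl; elim: l => //= j l IH; exact: avg_nonexpansive. Qed.

Lemma avgs_avg H l f v n : avgs H l (avg v n f) = avg v n (avgs H l f).
Proof. by elim: l => //= j l ->; rewrite avg_comm. Qed.

Lemma avgs_dist H l (f g : X -> V) (d : R) : 0 <= d ->
  (forall x, `|f x - g x| <= d) -> forall x, `|avgs H l f x - avgs H l g x| <= d.
Proof. by move=> d0 fg; elim: l => //= j l IH; exact: avg_dist. Qed.

(** Averaging over coordinate [j] moves a value by at most the side [2^-(j^2)]; [j ^ 2 <= H] ensures
    that [2 ^ (H - j ^ 2)] steps of mesh [2^-H] cover exactly that side. *)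
Lemma avgs_near H l f : nonexpansive f -> (forall j, j \in l -> (j ^ 2 <= H)%N) ->
  forall x, `|avgs H l f x - f x| <= \sum_(j <- l) half (j ^ 2).
Proof.
move=> fl; elim: l => [|j l IH] lH x /=; first by rewrite big_nil subrr normr0.
rewrite big_cons -(subrKA (avgs H l f x)) (le_trans (ler_normD _ _))// lerD//.
  rewrite (le_trans (avg_near _ _ (avgs_nonexpansive _ _ fl) _)) ?expn_gt0//.
  rewrite normrZ ger0_norm// mulrA exp2_half ?lH ?mem_head//.
  by rewrite ler_piMr.
by apply: IH => i il; rewrite lH// inE il orbT.
Qed.

Lemma avgs_refine H H' l f : nonexpansive f -> (H <= H')%N ->
  (forall j, j \in l -> (j ^ 2 <= H)%N) ->
  forall x, `|avgs H' l f x - avgs H l f x| <= (size l)%:R * half H.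
Proof.
move=> fl HH; elim: l => [|j l IH] lH x /=; first by rewrite subrr normr0 mul0r.
pose F := avgs H l f.
rewrite -(subrKA (avg (half H' *: e j) (2 ^ (H' - j ^ 2)) F x)).
rewrite (le_trans (ler_normD _ _))// -[(size l).+1%:R]natr1 mulrDl lerD//.
  apply: avg_dist => [|y]; first by rewrite mulr_ge0.
  by apply: IH => i il; rewrite lH// inE il orbT.
have jH := lH j (mem_head _ _); rewrite mul1r.
have -> : (2 ^ (H' - j ^ 2) = 2 ^ (H - j ^ 2) * 2 ^ (H' - H))%N.
  by rewrite -expnD addnC addnBA// subnK.
have -> : half H *: e j = (half H' *: e j) *+ 2 ^ (H' - H).
  by rewrite -(exp2_half HH) -scaler_nat scalerA.
rewrite (le_trans (avg_refine _ _ _ (avgs_nonexpansive _ _ fl) _)) ?expn_gt0//.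
by rewrite normrZ ger0_norm// mulrA exp2_half// ler_piMr.
Qed.

End Averages.

(** * The lifted vectors and the norms of their sums *)

Section Lift.
Context {R : realType} (X V : normedModType R).
Context (e : nat -> X) (e1 : forall j, `|e j| <= 1).
Context (f : X -> V) (fl : nonexpansive f).

Local Notation half n := ((2^-1 : R) ^+ n).

(* A discrete average of the slope of [f] in the direction [e k].  The sides
   [2^-(k^2)] of the cube decrease so fast that the coordinates after [k] can be
   ignored, and the mesh [2^-(k^2 + 2k)] is fine enough that replacing it by any
   finer one changes [lift_vec k] by at most a constant times [2^-k]. *)
Definition lift_vec (k : nat) : V :=
  let G := avgs e (k ^ 2 + 2 * k) (iota 0 k) f in
  (half (k ^ 2))^-1 *: (G (half (k ^ 2) *: e k) - G 0).

Let half_ge0 n : 0 <= half n. Proof. by rewrite exprn_ge0. Qed.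
Let half_gt0 n : 0 < half n. Proof. by rewrite exprn_gt0. Qed.
Let half_neq0 n : half n != 0. Proof. by rewrite gt_eqF. Qed.
Let le_half m n : (m <= n)%N -> half n <= half m.
Proof. by move=> mn; rewrite ler_wiXn2l// invf_le1// ler1n. Qed.

Let sum_half n : \sum_(k <- iota 0 n) half k <= 2.
Proof.
suff -> : \sum_(k <- iota 0 n) half k = 2 - 2 * half n.
  by rewrite lerBlDr lerDl mulr_ge0.
have -> : iota 0 n = index_iota 0 n by rewrite /index_iota subn0.
rewrite big_mkord; elim: n => [|n IH]; first by rewrite big_ord0 expr0 mulr1 subrr.
by rewrite big_ord_recr/= IH exprSr; field.
Qed.

Let bernoulli_half n : n.+1%:R * half n <= 1.
Proof.
rewrite exprVn ler_pdivrMr ?exprn_gt0// mul1r -natrX ler_nat.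
exact: ltn_expl.
Qed.

(** Since [(k + 1 + j)^2 >= k^2 + 2k + 1 + j], all sides after [k] together are at most one mesh of
    [lift_vec k]. *)
Let sum_half_sq k m : \sum_(j <- iota k.+1 m) half (j ^ 2) <= half (k ^ 2 + 2 * k).
Proof.
rewrite -[k.+1]addn0 iotaDl big_map.
apply: (@le_trans _ _ (half (k ^ 2 + 2 * k).+1 * \sum_(j <- iota 0 m) half j)).
  rewrite mulr_sumr; apply: ler_sum => j _; rewrite -exprD le_half//.
  by rewrite !expnS !expn0 !muln1; nia.
rewrite (le_trans (ler_wpM2l (half_ge0 _) (sum_half m)))//.
by rewrite exprSr -mulrA mulVf ?mulr1.
Qed.

(** * Comparison of all [lift_vec k] with [k < K] at one common mesh *)

Section Level.
Context (K : nat).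
Let H := (K ^ 2 + 2 * K)%N.
Let F := avgs e H (iota 0 K) f.
Let Fk k := avgs e H (iota 0 k) (avgs e H (iota k.+1 (K - k.+1)) f).

Let Fk_nonexpansive k : nonexpansive (Fk k).
Proof. by do 2!apply: avgs_nonexpansive. Qed.

Let sqH k : (k <= K)%N -> (k ^ 2 <= H)%N.
Proof. by move=> kK; rewrite /H !expnS !expn0 !muln1; nia. Qed.

(** Averages commute, so coordinate [k] can be taken outermost, over the average [Fk k] in the other
    coordinates; then [avg_step] turns one mesh step of [F] into an increment of [Fk k] over the
    whole side. *)
Let F_step k x : (k < K)%N -> F (x + half H *: e k) - F x =
  (half H / half (k ^ 2)) *: (Fk k (x + half (k ^ 2) *: e k) - Fk k x).
Proof.
move=> kK; have kH := sqH (ltnW kK).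
have kk := @exp2_half R _ _ kH.
have N0 : (2 ^ (H - k ^ 2))%:R != 0 :> R by rewrite pnatr_eq0 expn_eq0.
have -> : half H / half (k ^ 2) = (2 ^ (H - k ^ 2))%:R^-1.
  by rewrite -kk invfM mulrCA mulfV// mulr1.
have <- : (half H *: e k) *+ 2 ^ (H - k ^ 2) = half (k ^ 2) *: e k.
  by rewrite -kk -scaler_nat scalerA.
have -> : F = avg (half H *: e k) (2 ^ (H - k ^ 2)) (Fk k).
  rewrite /F -[K in iota 0 K](subnKC kK) iotaD /avgs foldr_cat.
  have -> : iota 0 k.+1 = iota 0 k ++ [:: k] by rewrite -addn1 iotaD.
  by rewrite foldr_cat /= -!/(avgs _ _ _ _) avgs_avg.
by rewrite avg_step ?expn_gt0.
Qed.

Let err k := k.+1%:R * half (k ^ 2 + 2 * k).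

(** Refining the mesh in the [k] coordinates before [k] costs [k] cells; dropping those after [k]
    costs one more. *)
Let Fk_G k x : (k < K)%N ->
  `|Fk k x - avgs e (k ^ 2 + 2 * k) (iota 0 k) f x| <= err k.
Proof.
move=> kK; rewrite -(subrKA (avgs e H (iota 0 k) f x)) (le_trans (ler_normD _ _))//.
rewrite /err -natr1 mulrDl mul1r addrC lerD//.
  rewrite -[X in X%:R * _](size_iota 0 k).
  apply: (avgs_refine e1 fl).
    by rewrite /H !expnS !expn0 !muln1; nia.
  by move=> j; rewrite mem_iota add0n !expnS !expn0 !muln1 => /andP[_]; nia.
apply: avgs_dist => // y; apply: le_trans (sum_half_sq k (K - k.+1)).
apply: (avgs_near e1 fl) => j; rewrite mem_iota => /andP[_ jK]; apply: sqH.
by rewrite -ltnS (leq_trans jK)// addnC subnK// leqW.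
Qed.

Let lift_vec_step k : (k < K)%N ->
  `|lift_vec k - (half H)^-1 *: (F (half H *: e k) - F 0)| <= 2 * half k.
Proof.
move=> kK; rewrite -[half H *: e k]add0r F_step// scalerA mulrA mulVf// mul1r add0r.
rewrite /lift_vec -scalerBr normrZ ger0_norm ?invr_ge0//.
rewrite ler_pdivrMl//.
apply: (@le_trans _ _ (err k + err k)).
  rewrite subrACA (le_trans (ler_normB _ _))//.
  by rewrite lerD// distrC Fk_G.
rewrite /err exprD mul2n -addnn exprD.
rewrite (_ : _ + _ = half (k ^ 2) * (2 * half k) * (k.+1%:R * half k)); last by ring.
by rewrite ler_piMr// !mulr_ge0.
Qed.

(** At the scale of a mesh [F] is almost additive: add the vectors one at a time. By [F_step], the
    increments at [x] and at [0] are mesh over side times increments of a nonexpansive map, which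
    differ by at most [2 * |x|], and [|x|] is at most [m] meshes. *)
Let F_telescope (m : nat) (s : seq nat) : (size s <= m)%N ->
  (forall k, k \in s -> (k < K)%N) ->
  `|F (half H *: \sum_(k <- s) e k) - F 0 - \sum_(k <- s) (F (half H *: e k) - F 0)|
  <= (size s)%:R * (2 * (half H / half (K ^ 2)) * (m%:R * half H)).
Proof.
elim: s => [|k s IH] sm sK.
  by rewrite !big_nil scaler0 subrr subr0 normr0 mul0r.
have {}IH := IH (ltnW sm) (fun j js => sK j (mem_behead (s := k :: s) js)).
have kK := sK k (mem_head _ _).
rewrite !big_cons; move: IH; set x := half H *: \sum_(j <- s) e j => IH.
have xm : `|x| <= m%:R * half H.
  rewrite /x normrZ ger0_norm// mulrC ler_wpM2r// (le_trans (ler_norm_sum _ _ _))//.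
  rewrite (le_trans (ler_sum _ (fun j _ => e1 j)))//.
  by rewrite big_const_seq count_predT iter_addr_0 ler_nat ltnW.
rewrite scalerDr -/x [_ + x]addrC.
rewrite (_ : _ - _ = (F (x + half H *: e k) - F x - (F (0 + half H *: e k) - F 0))
   + (F x - F 0 - \sum_(j <- s) (F (half H *: e j) - F 0))); last first.
  rewrite add0r; move: (F (x + _)) (F x) (F (half H *: e k)) (F 0) => a b c d.
  move: (\sum_(_ <- _) _) => t.
  by rewrite [RHS]addrACA subrKA -opprD.
rewrite (le_trans (ler_normD _ _))//= -[(size s).+1%:R]natr1 mulrDl mul1r.
rewrite [leRHS]addrC lerD//.
rewrite !F_step// -scalerBr normrZ ger0_norm ?divr_ge0// -mulrA mulrCA.
apply: ler_pM => //.
  by rewrite ler_wpM2l// lef_pV2 ?posrE// le_half// leq_exp2r// ltnW.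
apply: (@le_trans _ _ (`|x| + `|x|)); last by lra.
rewrite subrACA (le_trans (ler_normB _ _))// lerD//.
  by rewrite (le_trans (Fk_nonexpansive _ _ _))// opprD addrACA subrr addr0 subr0.
by rewrite (le_trans (Fk_nonexpansive _ _ _))// subr0.
Qed.

Lemma lift_vec_sum_le (s : seq nat) : uniq s -> (forall k, k \in s -> (k < K)%N) ->
  `|\sum_(k <- s) lift_vec k| <= `|\sum_(k <- s) e k| + 6.
Proof.
move=> us sK.
have sI : {subset s <= iota 0 K} by move=> k /sK kK; rewrite mem_iota.
have sm : (size s <= K)%N by rewrite -(size_iota 0 K) uniq_leq_size.
rewrite -(subrK (\sum_(k <- s) (half H)^-1 *: (F (half H *: e k) - F 0))
  (\sum_(k <- s) _)) (le_trans (ler_normD _ _))//.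
(* The errors [2 * 2^-k] of [lift_vec_step] sum to at most 4, and [F_telescope] contributes at most
   2. *)
rewrite [leRHS](_ : _ = 4 + (`|\sum_(k <- s) e k| + 2)); last by ring.
rewrite lerD//.
  rewrite -sumrB (le_trans (ler_norm_sum _ _ _))//.
  apply: (@le_trans _ _ (\sum_(k <- s) 2 * half k)).
    rewrite big_seq [leRHS]big_seq; apply: ler_sum => k ks.
    exact: lift_vec_step (sK k ks).
  rewrite -mulr_sumr (_ : 4 = 2 * 2 :> R); last by ring.
  by rewrite ler_pM2l// (le_trans _ (sum_half K))// ler_sum_uniq_sub// iota_uniq.
rewrite -scaler_sumr normrZ ger0_norm ?invr_ge0// ler_pdivrMl//.
have T := F_telescope sm sK.
rewrite -[\sum_(k <- s) _](subKr (F (half H *: \sum_(k <- s) e k) - F 0)).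
rewrite (le_trans (ler_normB _ _))// mulrDr lerD//.
  rewrite (le_trans (avgs_nonexpansive _ _ _ _ _ _))// subr0 normrZ ger0_norm//.
rewrite (le_trans T)//.
have -> : half H / half (K ^ 2) = half K * half K.
  by rewrite /H exprD mulrAC mulfV// mul1r mul2n -addnn exprD.
have := bernoulli_half K.
have sR : (size s)%:R <= K%:R :> R by rewrite ler_nat.
have s0 : 0 <= (size s)%:R :> R by [].
rewrite -natr1; have := half_ge0 K; have := half_gt0 H.
move: (half K) (half H) (K%:R : R) ((size s)%:R : R) sR s0 => a h k q qk q0 h0 a0 ka.
have k0 : 0 <= k by exact: le_trans qk.
have k1 : k * a <= 1 by nra.
have q1 : q * a <= 1 by nra.
have ka0 : 0 <= k * a by nra.
have qa0 : 0 <= q * a by nra.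
rewrite (_ : q * _ = h * 2 * ((q * a) * (k * a))); last by ring.
have qk1 : q * a * (k * a) <= 1 by rewrite mulr_ile1.
by nra.
Qed.
End Level.

Lemma lift_vec_sum (s : seq nat) : uniq s ->
  `|\sum_(k <- s) lift_vec k| <= `|\sum_(k <- s) e k| + 6.
Proof.
move=> us; apply: (lift_vec_sum_le (K := (\max_(k <- s) k).+1)) => // k ks.
by rewrite ltnS (bigD1_seq k)//= leq_maxl.
Qed.

(** Along [f] the functional [L] is the linear [c], and the averages shift only in directions [e j]
    with [j < k], where [c] vanishes. *)
Lemma lift_vec_coord (L : V -> R) (c : X -> R) (k : nat) : scalar L -> scalar c ->
  (forall x, L (f x) = c x) -> c (e k) = 1 ->
  (forall j, (j < k)%N -> c (e j) = 0) -> L (lift_vec k) = 1.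
Proof.
move=> Ll cl Lf ck cj.
have Lavgs x H l : (forall j, j \in l -> (j < k)%N) -> L (avgs e H l f x) = c x.
  elim: l x => [|j l IH] x lk /=; first exact: Lf.
  have jk := lk j (mem_head _ _).
  rewrite /avg (scalar_scale Ll) (scalar_sum Ll).
  rewrite (eq_bigr (fun=> c x)) => [|i _].
    by rewrite sumr_const card_ord -[c x *+ _]mulr_natl mulKf// pnatr_eq0 expn_eq0.
  rewrite IH; last by move=> h hl; apply: lk; rewrite inE hl orbT.
  by rewrite -scaler_nat scalerA addrC cl cj// mulr0 add0r.
have jk j : j \in iota 0 k -> (j < k)%N by rewrite mem_iota.
rewrite /lift_vec (scalar_scale Ll) -scaleN1r addrC Ll !Lavgs// mulN1r.
rewrite (scalar_scale cl) ck mulr1.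
have -> : c 0 = 0 by rewrite -(scale0r (e k)) (scalar_scale cl) mul0r.
by rewrite oppr0 add0r mulVf.
Qed.

End Lift.

(** * Interpolation on grids *)

Section Tent.
Context {R : realType}.
Implicit Types t s : R.

Definition clamp t : R := Num.min 1 (Num.max 0 t).

Lemma clamp_ge0 t : 0 <= clamp t.
Proof. by rewrite /clamp le_min ler01 le_max lexx. Qed.

Lemma clamp_le1 t : clamp t <= 1.
Proof. by rewrite /clamp ge_min lexx. Qed.

Lemma clamp_eq0 t : t <= 0 -> clamp t = 0.
Proof. by move=> t0; rewrite /clamp max_l// min_r. Qed.

Lemma clamp_eq1 t : 1 <= t -> clamp t = 1.
Proof. by move=> t1; rewrite /clamp max_r ?min_l// (le_trans ler01). Qed.

Lemma clamp_id t : 0 <= t <= 1 -> clamp t = t.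
Proof. by move=> /andP[t0 t1]; rewrite /clamp max_r// min_r. Qed.

Lemma clamp_mono t s : t <= s -> clamp t <= clamp s.
Proof.
move=> ts; rewrite /clamp le_min ge_min lexx/= ge_min; apply/orP; right.
by rewrite ge_max !le_max lexx ts orbT.
Qed.

Lemma clamp_lip t s : `|clamp t - clamp s| <= `|t - s|.
Proof.
wlog ts : t s / t <= s.
  by move=> H; have [/H|/ltW/H] := leP t s => //; rewrite distrC [leRHS]distrC.
rewrite distrC [leRHS]distrC !ger0_norm ?subr_ge0//; last exact: clamp_mono.
have [s0|s0] := leP s 0; first by rewrite !clamp_eq0 ?subrr ?subr_ge0// (le_trans ts).
have [t1|t1] := leP 1 t; first by rewrite !clamp_eq1 ?subrr ?subr_ge0// (le_trans t1).
have -> : clamp t = Num.max 0 t by rewrite /clamp min_r// ge_max ler01 ltW.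
have -> : clamp s = Num.min 1 s by rewrite /clamp max_r// ltW.
by rewrite lerB// ?ge_min ?le_max lexx ?orbT.
Qed.

(** The piecewise linear hat on [[-1, 1]], written as a difference so that sums of integer
    translates telescope. *)
Definition tent t := clamp (t + 1) - clamp t.

Lemma tent_ge0 t : 0 <= tent t.
Proof. by rewrite subr_ge0 clamp_mono// lerDl. Qed.

Lemma tent_sum t n : \sum_(b < n) tent (t - b%:R) = clamp (t + 1) - clamp (t + 1 - n%:R).
Proof.
elim: n => [|n IH]; first by rewrite big_ord0 subr0 subrr.
rewrite big_ord_recr/= IH /tent.
have -> : t - n%:R + 1 = t + 1 - n%:R by ring.
have -> : t + 1 - n.+1%:R = t - n%:R by rewrite -natr1; ring.
by ring.
Qed.

Lemma tent_sum_le1 t n : \sum_(b < n) tent (t - b%:R) <= 1.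
Proof. by rewrite tent_sum lerBlDr ler_wpDr ?clamp_ge0 ?clamp_le1. Qed.

Lemma tent_le1 t : tent t <= 1.
Proof. by rewrite lerBlDr ler_wpDr ?clamp_ge0 ?clamp_le1. Qed.

Lemma tent_eq0 t : 1 <= `|t| -> tent t = 0.
Proof.
rewrite /tent ler_normr => /orP[t1|t1].
  by rewrite !clamp_eq1 ?subrr//; lra.
by rewrite !clamp_eq0 ?subrr//; lra.
Qed.

Lemma tent_lip t s : `|tent t - tent s| <= 2 * `|t - s|.
Proof.
rewrite /tent subrACA (le_trans (ler_normB _ _))// mulr_natl mulr2n lerD ?clamp_lip//.
by rewrite (le_trans (clamp_lip _ _))// opprD addrACA subrr addr0.
Qed.

(** A trapezoid equal to 1 on [[-2, 2]] and to 0 outside [[-3, 3]]. *)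
Definition wide t := clamp (t + 3) - clamp (t - 2).

Lemma wide_tent t : wide t = \sum_(d < 5) tent (t + 2 - d%:R).
Proof. by rewrite tent_sum /wide; congr (clamp _ - clamp _); ring. Qed.

Lemma wide_ge0 t : 0 <= wide t.
Proof. by rewrite wide_tent sumr_ge0// => d _; exact: tent_ge0. Qed.

Lemma wide_le1 t : wide t <= 1.
Proof. by rewrite wide_tent tent_sum_le1. Qed.

Lemma wide_eq1 t : `|t| <= 2 -> wide t = 1.
Proof.
rewrite ler_norml => /andP[t1 t2]; rewrite /wide clamp_eq1 ?clamp_eq0 ?subr0//; lra.
Qed.

Lemma wide_eq0 t : 3 <= `|t| -> wide t = 0.
Proof.
rewrite /wide ler_normr => /orP[t1|t1].
  by rewrite !clamp_eq1 ?subrr//; lra.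
by rewrite !clamp_eq0 ?subrr//; lra.
Qed.

Lemma wide_lip t s : `|wide t - wide s| <= 2 * `|t - s|.
Proof.
rewrite /wide subrACA (le_trans (ler_normB _ _))// mulr_natl mulr2n.
have E c : t + c - (s + c) = t - s by ring.
by apply: lerD; rewrite (le_trans (clamp_lip _ _))// E.
Qed.

Lemma wide_sum t n : \sum_(b < n) wide (t - b%:R) <= 5.
Proof.
under eq_bigr do rewrite wide_tent.
rewrite exchange_big/= -[leRHS](_ : \sum_(d < 5) 1 = _); last first.
  by rewrite sumr_const card_ord.
apply: ler_sum => d _.
rewrite (eq_bigr (fun b : 'I_n => tent (t + 2 - d%:R - b%:R))) ?tent_sum_le1// => b _.
by congr tent; ring.
Qed.

Lemma prod01_lip (I : finType) (a b : I -> R) :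
  (forall i, 0 <= a i <= 1) -> (forall i, 0 <= b i <= 1) ->
  `|\prod_i a i - \prod_i b i| <= \sum_i `|a i - b i|.
Proof.
move=> a01 b01.
suff [] : [/\ 0 <= \prod_i a i <= 1, 0 <= \prod_i b i <= 1 &
  `|\prod_i a i - \prod_i b i| <= \sum_i `|a i - b i|] by [].
elim/big_rec3: _ => [|i x y z _ [/andP[y0 y1] /andP[x0 x1] xyz]].
  by rewrite subrr normr0 ler01 !lexx.
have /andP[ai0 ai1] := a01 i; have /andP[bi0 bi1] := b01 i.
split; [by rewrite mulr_ge0// mulr_ile1|by rewrite mulr_ge0// mulr_ile1|].
rewrite (_ : _ - _ = (a i - b i) * z + b i * (z - y)); last by ring.
rewrite (le_trans (ler_normD _ _))// lerD// normrM.
  by rewrite ler_piMr// ger0_norm.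
by rewrite ger0_norm// (le_trans _ xyz)// ler_piMl.
Qed.

End Tent.

(** * Bounded Lipschitz functions and local estimates of Lipschitz constants *)

Section BoundedLipschitz.
Context {R : realType} (X : normedModType R).

Definition blip (f : X -> R) := exists K : R,
  (forall x, `|f x| <= K) /\ (forall x y, `|f x - f y| <= K * `|x - y|).

Lemma blip_cst (c : R) : blip (fun=> c).
Proof.
by exists `|c|; split=> // x y; rewrite subrr normr0 mulr_ge0.
Qed.

Lemma blipD f g : blip f -> blip g -> blip (fun x => f x + g x).
Proof.
move=> [K [fK fl]] [L [gL gl]]; exists (K + L); split=> [x|x y].
  by rewrite (le_trans (ler_normD _ _))// lerD.
by rewrite opprD addrACA (le_trans (ler_normD _ _))// mulrDl lerD.
Qed.

Lemma blipM f g : blip f -> blip g -> blip (fun x => f x * g x).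
Proof.
move=> [K [fK fl]] [L [gL gl]].
have K0 : 0 <= K by rewrite (le_trans _ (fK 0)).
have L0 : 0 <= L by rewrite (le_trans _ (gL 0)).
exists (K * L + K * L + K * L); split=> [x|x y].
  rewrite normrM (le_trans (ler_pM _ _ (fK x) (gL x)))//.
  by rewrite lerDr addr_ge0 ?mulr_ge0.
rewrite (_ : _ - _ = (f x - f y) * g x + f y * (g x - g y)); last by ring.
rewrite (le_trans (ler_normD _ _))// 2!normrM.
have := ler_pM (normr_ge0 _) (normr_ge0 _) (fl x y) (gL x).
have := ler_pM (normr_ge0 _) (normr_ge0 _) (fK y) (gl x y).
have : 0 <= K * L * `|x - y| by rewrite !mulr_ge0.
have -> : K * `|x - y| * L = K * L * `|x - y| by ring.
have -> : K * (L * `|x - y|) = K * L * `|x - y| by ring.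
move=> h0 h1 h2; rewrite 2!mulrDl -addrA ler_wpDl// addrC lerD//.
Qed.

Lemma blip_norm f : blip f -> blip (fun x => `|f x|).
Proof.
move=> [K [fK fl]]; exists K; split=> [x|x y]; first by rewrite normr_id.
by rewrite (le_trans (ler_dist_dist _ _)).
Qed.

Lemma blip_sum (I : Type) (r : seq I) (F : I -> X -> R) : (forall i, blip (F i)) ->
  blip (fun x => \sum_(i <- r) F i x).
Proof.
move=> bF; elim: r => [|i r IH].
  by under eq_fun do rewrite big_nil; exact: blip_cst.
by under eq_fun do rewrite big_cons; exact: blipD.
Qed.

Lemma blip_prod (I : Type) (r : seq I) (F : I -> X -> R) : (forall i, blip (F i)) ->
  blip (fun x => \prod_(i <- r) F i x).
Proof.
move=> bF; elim: r => [|i r IH].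
  by under eq_fun do rewrite big_nil; exact: blip_cst.
by under eq_fun do rewrite big_cons; exact: blipM.
Qed.

Lemma blip_clamp f : blip f -> blip (fun x => clamp (f x)).
Proof.
move=> [K [fK fl]]; exists (1 + K); split=> [x|x y].
  rewrite ger0_norm ?clamp_ge0// (le_trans (clamp_le1 _))// lerDl.
  by rewrite (le_trans _ (fK x)).
rewrite (le_trans (clamp_lip _ _))// (le_trans (fl x y))// ler_wpM2r//.
by rewrite lerDr.
Qed.

(* Subdivide the segment from [x] to [y]. *)
Lemma local_lipschitz (f : X -> R) (C K r : R) : 0 <= K -> 0 < r ->
  (forall x y, `|x - y| <= r -> `|f x - f y| <= (C + K * `|x - y|) * `|x - y|) ->
  forall x y, `|f x - f y| <= C * `|x - y|.
Proof.
move=> K0 r0 H x y; set d := `|x - y|.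
have d0 : 0 <= d by rewrite normr_ge0.
suff step n : (0 < n)%N -> d <= r * n%:R -> `|f x - f y| <= C * d + K * d ^+ 2 / n%:R.
  apply/ler_addgt0Pr => eps eps0.
  pose n := (maxn (Num.bound (d / r)) (Num.bound (K * d ^+ 2 / eps))).+1.
  have n0 : 0 < n%:R :> R by [].
  have b1 : d <= r * n%:R.
    rewrite mulrC -ler_pdivrMr//.
    apply/ltW/(lt_le_trans (archi_boundP (divr_ge0 d0 (ltW r0)))).
    by rewrite ler_nat leqW// leq_maxl.
  rewrite (le_trans (step n isT b1))// lerD2l ler_pdivrMr// [eps * _]mulrC -ler_pdivrMr//.
  have Kd0 : 0 <= K * d ^+ 2 / eps by rewrite divr_ge0 ?mulr_ge0 ?exprn_ge0// ltW.
  apply/ltW/(lt_le_trans (archi_boundP Kd0)).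
  by rewrite ler_nat leqW// leq_maxr.
move=> n0 dn; have nR : 0 < n%:R :> R by rewrite ltr0n.
pose pt i := x + (i%:R / n%:R) *: (y - x).
have ptS i : `|pt i.+1 - pt i| = d / n%:R.
  rewrite /pt opprD addrACA subrr add0r -scalerBl normrZ distrC -/d.
  rewrite -mulrBl -[i.+1%:R]natr1 opprD addrA subrr add0r mulN1r normrN.
  by rewrite ger0_norm ?invr_ge0 1?ltW// mulrC distrC.
have dn_le : d / n%:R <= r by rewrite ler_pdivrMr.
have -> : f x - f y = - \sum_(0 <= i < n) (f (pt i.+1) - f (pt i)).
  rewrite telescope_sumr// /pt mulfV ?gt_eqF// mul0r scale0r scale1r addr0.
  by rewrite [x + (y - x)]addrC subrK opprB.
rewrite normrN big_mkord (le_trans (ler_norm_sum _ _ _))//.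
apply: (@le_trans _ _ (\sum_(i < n) (C + K * (d / n%:R)) * (d / n%:R))).
  by apply: ler_sum => i _; rewrite -(ptS i) H// ptS.
rewrite sumr_const card_ord -[_ *+ n]mulr_natl le_eqVlt; apply/orP; left; apply/eqP.
by field; rewrite gt_eqF.
Qed.

End BoundedLipschitz.

Section EllpnNorm.
Context {R : realType} (p : R) (p1 : 1 <= p) (m : nat).
Local Notation X := (ellpn p1 m).

Lemma ellpn_mdist (x y : X) : mdist x y = `|x - y|.
Proof. by []. Qed.

Lemma ellpnBE (x y : X) i : (x - y) 0 i = x 0 i - y 0 i.
Proof. by rewrite ellpnDE; congr (_ + _); exact: mxE. Qed.

Lemma ellpn_coord_le (x : X) i : `|x 0 i| <= `|x|.
Proof.
rewrite -[leLHS](powRVK p1 (normr_ge0 _)); apply: le_powRV => //.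
by rewrite (bigD1 i)//= lerDl sumr_ge0// => *; exact: powR_ge0.
Qed.

Lemma ellpn_le_sum (x : X) : `|x| <= \sum_i `|x 0 i|.
Proof.
have p0 : 0 < p by rewrite (lt_le_trans ltr01).
have unit_norm i : `|(delta_mx 0 i : X)| = 1.
  rewrite [LHS](_ : _ = (\sum_(j < m) `|(delta_mx 0 i : X) 0 j| `^ p) `^ p^-1)//.
  rewrite (bigD1 i)//= big1 => [|j ji]; rewrite mxE eqxx ?eqxx ?(negPf ji)/=.
    by rewrite addr0 normr1 !powR1.
  by rewrite normr0 powR0// gt_eqF.
have E : x = \sum_i x 0 i *: (delta_mx 0 i : X).
  by rewrite {1}[x](row_sum_delta (x : 'rV_m)).
rewrite {1}E (le_trans (ler_norm_sum _ _ _))// ler_sum// => i _.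
by rewrite normrZ unit_norm mulr1.
Qed.

Lemma ellpn_rowE (a : 'I_m -> R) i : ((\row_i a i : 'rV_m) : X) 0 i = a i.
Proof. exact: mxE. Qed.

End EllpnNorm.

(** * Radial cutoffs *)

Section Cutoff.
Context {R : realType} (X : normedModType R).

Definition cutoff (r : R) (g : X -> R) (x : X) : R := clamp (2 - `|x| / r) * g x.

Lemma cutoff_eq (r : R) (g : X -> R) x : 0 < r -> `|x| <= r -> cutoff r g x = g x.
Proof.
move=> r0 xr; have : `|x| / r <= 1 by rewrite ler_pdivrMr// mul1r.
by move=> xr1; rewrite /cutoff clamp_eq1 ?mul1r//; lra.
Qed.

Lemma cutoff_eq0 (r : R) (g : X -> R) x : 0 < r -> 2 * r <= `|x| -> cutoff r g x = 0.
Proof.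
move=> r0 xr; have : 2 <= `|x| / r by rewrite ler_pdivlMr.
by move=> xr1; rewrite /cutoff clamp_eq0 ?mul0r//; lra.
Qed.

Lemma cutoff_le (r : R) (g : X -> R) x : `|cutoff r g x| <= `|g x|.
Proof. by rewrite normrM ler_piMl// ger0_norm ?clamp_ge0 ?clamp_le1. Qed.

(** In the factor 3, one unit comes from the slopes of the [g k]. The other two come from the slope
    [1 / r] of the cutoff, since the values sum to at most [G * |y| <= 2 * r * G] on its support. *)
Lemma cutoff_sum (r : R) (s : seq nat) (g : nat -> X -> R) (G : R) :
  0 < r -> 0 <= G -> (forall k, g k 0 = 0) ->
  (forall x y, \sum_(k <- s) `|g k x - g k y| <= G * `|x - y|) ->
  forall x y, \sum_(k <- s) `|cutoff r (g k) x - cutoff r (g k) y| <= 3 * G * `|x - y|.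
Proof.
move=> r0 G0 g0 gG.
suff near x y : `|y| <= 2 * r ->
    \sum_(k <- s) `|cutoff r (g k) x - cutoff r (g k) y| <= 3 * G * `|x - y|.
  move=> x y; have [/near//|yr] := leP `|y| (2 * r).
  have [xr|xr] := leP `|x| (2 * r).
    by rewrite distrC; under eq_bigr do rewrite distrC; exact: near.
  rewrite big1 => [|k _].
    by apply: mulr_ge0 => //; apply: mulr_ge0.
  by rewrite (cutoff_eq0 (g k) r0 (ltW xr)) (cutoff_eq0 (g k) r0 (ltW yr)) subrr normr0.
move=> yr.
apply: (@le_trans _ _ (\sum_(k <- s) (`|g k x - g k y| +
    `|x - y| / r * `|g k y|))).
  apply: ler_sum => k _; rewrite /cutoff.
  rewrite (_ : _ - _ = clamp (2 - `|x| / r) * (g k x - g k y) +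
    (clamp (2 - `|x| / r) - clamp (2 - `|y| / r)) * g k y); last by ring.
  rewrite (le_trans (ler_normD _ _))// lerD//.
    by rewrite normrM ler_piMl// ger0_norm ?clamp_ge0 ?clamp_le1.
  rewrite normrM ler_wpM2r// (le_trans (clamp_lip _ _))//.
  rewrite opprB addrC subrKA -mulrBl normrM normfV (gtr0_norm r0).
  apply: ler_wpM2r; first by rewrite invr_ge0 ltW.
  by rewrite distrC ler_dist_dist.
rewrite big_split/= -mulr_sumr.
have yG : \sum_(k <- s) `|g k y| <= G * `|y|.
  by have := gG y 0; under eq_bigr do rewrite g0 subr0; rewrite subr0.
have xy0 : 0 <= `|x - y| / r by rewrite divr_ge0// ltW.
have := ler_wpM2l xy0 yG.
have : `|x - y| / r * (G * `|y|) <= 2 * G * `|x - y|.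
  rewrite [leLHS](_ : _ = G * `|x - y| * (`|y| / r)); last by ring.
  rewrite [leRHS](_ : _ = G * `|x - y| * 2); last by ring.
  by rewrite ler_wpM2l ?mulr_ge0// ler_pdivrMr.
have := gG x y; lra.
Qed.

End Cutoff.

(** * Grid interpolation when the norm lies between the maximum and the sum of the coordinates *)

Section Coordinates.
Context {R : realType} (X : normedModType R) (m : nat).
Context (co : X -> 'I_m -> R) (mk : ('I_m -> R) -> X).
Hypotheses (coB : forall x y i, co (x - y) i = co x i - co y i)
  (coK : forall a i, co (mk a) i = a i)
  (co_le : forall x i, `|co x i| <= `|x|)
  (le_co : forall x, `|x| <= \sum_i `|co x i|).

Section Grid.
Context (eta : R) (eta0 : 0 < eta) (B : nat).
Local Notation Z := {ffun 'I_m -> 'I_(2 * B).+1}.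

Definition grid_coord (x : X) (i : 'I_m) : R := co x i / eta + B%:R.

Definition grid_point (z : Z) : X := mk (fun i => eta * ((z i)%:R - B%:R)).

Definition hat (z : Z) (x : X) : R := \prod_i tent (grid_coord x i - (z i)%:R).

(* Equal to 1 at every point within distance [eta] of the support of [hat z]. *)
Definition wide_hat (z : Z) (x : X) : R := \prod_i wide (grid_coord x i - (z i)%:R).

Definition interpolate (g : X -> R) (x : X) : R := \sum_z hat z x * g (grid_point z).

(** Here [2 * m / eta] bounds the slope of a hat, and each hat is paired with the oscillation of [g]
    between [x] and its node. The bound stays a function of [x] so that those of many functions can
    be added pointwise. *)
Definition interpolate_slope (g : X -> R) (x : X) : R :=
  2 * m%:R / eta * \sum_z wide_hat z x * `|g (grid_point z) - g x|.

Let hat_ge0 z x : 0 <= hat z x.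
Proof. by apply: prodr_ge0 => i _; exact: tent_ge0. Qed.

Let wide_hat_ge0 z x : 0 <= wide_hat z x.
Proof. by apply: prodr_ge0 => i _; exact: wide_ge0. Qed.

Let hat_sum_le1 x : \sum_z hat z x <= 1.
Proof.
rewrite -(bigA_distr_bigA (fun i (b : 'I_(2 * B).+1) => tent (grid_coord x i - b%:R))).
rewrite prodr_ile1// => i _; rewrite tent_sum_le1 andbT sumr_ge0// => b _.
exact: tent_ge0.
Qed.

Let hat_sum (x : X) : (forall i, `|co x i| <= eta * B%:R) -> \sum_z hat z x = 1.
Proof.
move=> xB.
rewrite -(bigA_distr_bigA (fun i (b : 'I_(2 * B).+1) => tent (grid_coord x i - b%:R))).
rewrite big1// => i _; rewrite tent_sum /grid_coord.
have : `|co x i / eta| <= B%:R.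
  by rewrite normrM normfV (gtr0_norm eta0) ler_pdivrMr// mulrC.
rewrite ler_norml => /andP[h1 h2].
rewrite clamp_eq1 ?clamp_eq0 ?subr0//; last by lra.
by rewrite -natr1 natrM; lra.
Qed.

Let wide_hat_sum x : \sum_z wide_hat z x <= 5 ^+ m.
Proof.
rewrite -(bigA_distr_bigA (fun i (b : 'I_(2 * B).+1) => wide (grid_coord x i - b%:R))).
rewrite -[m in leRHS]card_ord -prodr_const; apply: ler_prod => i _.
by rewrite wide_sum andbT sumr_ge0// => b _; exact: wide_ge0.
Qed.

Let coordE (x : X) (z : Z) i : grid_coord x i - (z i)%:R = (co x i - co (grid_point z) i) / eta.
Proof. by rewrite /grid_coord coK; field; rewrite gt_eqF. Qed.

Let near_point (x : X) (z : Z) (c : R) : (forall i, `|grid_coord x i - (z i)%:R| <= c) ->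
  `|x - grid_point z| <= m%:R * (c * eta).
Proof.
move=> H; rewrite (le_trans (le_co _))//.
apply: (@le_trans _ _ (\sum_(i < m) c * eta)); last first.
  by rewrite sumr_const card_ord mulr_natl.
apply: ler_sum => i _; have := H i; rewrite coordE normrM normfV (gtr0_norm eta0).
by rewrite ler_pdivrMr// => xz; rewrite coB.
Qed.

Let hat_near (x : X) z : hat z x != 0 -> `|x - grid_point z| <= m%:R * eta.
Proof.
move=> zx; rewrite -[eta]mul1r; apply: near_point => i; apply: ltW.
rewrite ltNge; apply: contra zx => /tent_eq0 zx.
by rewrite /hat (bigD1 i)//= zx mul0r.
Qed.

Let wide_hat_near (x : X) z : wide_hat z x != 0 -> `|x - grid_point z| <= m%:R * (3 * eta).
Proof.
move=> zx; apply: near_point => i; apply: ltW.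
rewrite ltNge; apply: contra zx => /wide_eq0 zx.
by rewrite /wide_hat (bigD1 i)//= zx mul0r.
Qed.

Let grid_coord_dist (x y : X) i : `|grid_coord x i - grid_coord y i| <= `|x - y| / eta.
Proof.
rewrite /grid_coord opprD addrACA subrr addr0 -mulrBl normrM normfV (gtr0_norm eta0).
apply: ler_wpM2r; first by rewrite invr_ge0 ltW.
by rewrite -coB co_le.
Qed.

(** If some coordinate of [x] is more than 2 cells from the node, the hat vanishes at both points,
    whose coordinates differ by at most one cell; otherwise [wide_hat z x = 1]. *)
Let hat_slope (x y : X) z : `|x - y| <= eta ->
  `|hat z x - hat z y| <= wide_hat z x * (2 * m%:R / eta * `|x - y|).
Proof.
move=> xy.
have xy1 i : `|grid_coord x i - grid_coord y i| <= 1.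
  by rewrite (le_trans (grid_coord_dist _ _ _))// ler_pdivrMr// mul1r.
have [i far|near] := pickP (fun i => 2 < `|grid_coord x i - (z i)%:R|).
  have hat0 w : 1 <= `|grid_coord w i - (z i)%:R| -> hat z w = 0.
    by move=> wi; rewrite /hat (bigD1 i)//= tent_eq0// mul0r.
  have yi : 1 <= `|grid_coord y i - (z i)%:R|.
    have := ler_distD (grid_coord y i) (grid_coord x i) (z i)%:R.
    by have := xy1 i; lra.
  rewrite (hat0 x) ?(hat0 y)// ?subrr ?normr0; last by lra.
  by apply: mulr_ge0 => //; rewrite mulr_ge0// divr_ge0 ?mulr_ge0// ltW.
rewrite /wide_hat big1 ?mul1r; last first.
  by move=> i _; apply: wide_eq1; have := near i; rewrite leNgt => ->.
rewrite (le_trans (prod01_lip _ _))//.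
- by move=> i; rewrite tent_ge0 tent_le1.
- by move=> i; rewrite tent_ge0 tent_le1.
apply: (@le_trans _ _ (\sum_(i < m) 2 * (`|x - y| / eta))); last first.
  by rewrite sumr_const card_ord -mulr_natl le_eqVlt; apply/orP; left; apply/eqP; ring.
apply: ler_sum => i _; rewrite (le_trans (tent_lip _ _))// ler_pM2l//.
by rewrite opprD addrACA subrr addr0.
Qed.

Lemma interpolate_slope_ge0 g x : 0 <= interpolate_slope g x.
Proof.
rewrite mulr_ge0 ?divr_ge0 ?mulr_ge0 ?(ltW eta0)// sumr_ge0// => z _.
by rewrite mulr_ge0.
Qed.

Lemma interpolate_slopeP (g : X -> R) :
  (forall (x : X) i, eta * (B%:R - 1) < `|co x i| -> g x = 0) ->
  forall x y, `|x - y| <= eta ->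
    `|interpolate g x - interpolate g y| <= interpolate_slope g x * `|x - y|.
Proof.
move=> gB x y xy.
(* When the hats sum to 1 at both points, [g x] can be subtracted from every node value. If [g x] is
   nonzero, [x] lies one cell inside the box, hence [y] lies in the box too. *)
have E : interpolate g x - interpolate g y =
    \sum_z (hat z x - hat z y) * (g (grid_point z) - g x).
  rewrite /interpolate -sumrB.
  under [RHS]eq_bigr do rewrite mulrBr mulrBl.
  rewrite [RHS]sumrB -mulr_suml [\sum_z (hat z x - hat z y)]sumrB.
  have [->|gx0] := eqVneq (g x) 0; first by rewrite mulr0 subr0.
  have xB i : `|co x i| <= eta * (B%:R - 1).
    by rewrite leNgt; apply: contra gx0 => /gB ->.
  rewrite !hat_sum ?subrr ?mul0r ?subr0// => i.
    have := co_le (x - y) i; rewrite coB => xyi.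
    have := xB i; have := ler_distD (co x i) (co y i) 0; rewrite !subr0 distrC.
    by rewrite mulrBr mulr1; lra.
  by rewrite (le_trans (xB i))// ler_pM2l// gerBl.
rewrite E (le_trans (ler_norm_sum _ _ _))//.
rewrite /interpolate_slope mulrAC mulr_sumr; apply: ler_sum => z _.
rewrite normrM (le_trans (ler_wpM2r _ (hat_slope z xy)))//.
by rewrite le_eqVlt; apply/orP; left; apply/eqP; ring.
Qed.

(** Only nodes within [3 * m * eta] of [x] count, and there the oscillations sum to at most
    [3 * m * eta * G]; the factor [1 / eta] cancels, so the bound is independent of the mesh. *)
Lemma interpolate_slope_sum (s : seq nat) (g : nat -> X -> R) (G : R) (x : X) : 0 <= G ->
  (forall x y, \sum_(k <- s) `|g k x - g k y| <= G * `|x - y|) ->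
  \sum_(k <- s) interpolate_slope (g k) x <= 6 * m%:R ^+ 2 * 5 ^+ m * G.
Proof.
move=> G0 gG; rewrite -mulr_sumr exchange_big/=.
apply: (@le_trans _ _ (2 * m%:R / eta * \sum_z wide_hat z x * (G * (m%:R * (3 * eta))))).
  rewrite ler_wpM2l ?divr_ge0 ?mulr_ge0 ?(ltW eta0)//; apply: ler_sum => z _.
  rewrite -mulr_sumr; have [->|zx] := eqVneq (wide_hat z x) 0; first by rewrite !mul0r.
  rewrite ler_wpM2l//; under eq_bigr do rewrite distrC.
  by rewrite (le_trans (gG x _))// ler_wpM2l// wide_hat_near.
rewrite -mulr_suml; have := wide_hat_sum x; move: (\sum_z _) => S S5.
rewrite [leLHS](_ : _ = 6 * m%:R ^+ 2 * G * S); last first.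
  by field; rewrite gt_eqF.
by rewrite [leRHS]mulrAC ler_wpM2l// !mulr_ge0// exprn_ge0.
Qed.

Lemma interpolate_le (g : X -> R) (x : X) (c : R) :
  (forall y, `|x - y| <= m%:R * eta -> `|g y| <= c) -> `|interpolate g x| <= c.
Proof.
move=> gc; have c0 : 0 <= c.
  by rewrite (le_trans _ (gc x _))// subrr normr0 mulr_ge0// ltW.
rewrite (le_trans (ler_norm_sum _ _ _))//.
apply: (@le_trans _ _ (\sum_z hat z x * c)).
  apply: ler_sum => z _; rewrite normrM ger0_norm//.
  have [->|zx] := eqVneq (hat z x) 0; first by rewrite !mul0r.
  by rewrite ler_wpM2l// gc// hat_near.
by rewrite -mulr_suml ler_piMl.
Qed.

Lemma interpolate_near (g : X -> R) (x : X) (c : R) :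
  (forall i, `|co x i| <= eta * B%:R) ->
  (forall y, `|x - y| <= m%:R * eta -> `|g y - g x| <= c) ->
  `|interpolate g x - g x| <= c.
Proof.
move=> xB gc; rewrite -[X in _ - X]mul1r -(hat_sum xB) mulr_suml -sumrB.
under eq_bigr do rewrite -mulrBr.
exact: (interpolate_le (g := fun y => g y - g x)).
Qed.

Lemma grid_point_near (x : X) : (forall i, `|co x i| <= eta * B%:R) ->
  exists z, `|x - grid_point z| <= m%:R * eta.
Proof.
move=> /hat_sum x1; have [z zx|H] := pickP (fun z => hat z x != 0).
  by exists z; exact: hat_near.
move: x1; rewrite big1 => [/eqP|z _]; first by rewrite eq_sym oner_eq0.
by apply/eqP; have := H z => /negbFE.
Qed.

Lemma interpolate_slope_blip (g : X -> R) : blip g -> blip (interpolate_slope g).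
Proof.
move=> bg; apply: blipM; first exact: blip_cst.
apply: blip_sum => z; apply: blipM; last first.
  by apply: blip_norm; apply: blipD; [exact: blip_cst|rewrite -[X in blip X]/(fun x => - g x)];
     under eq_fun do rewrite -mulN1r; apply: blipM => //; exact: blip_cst.
apply: blip_prod => i; exists (1 + 2 / eta); split=> [x|x y].
  by rewrite ger0_norm ?wide_ge0// (le_trans (wide_le1 _))// lerDl divr_ge0// ltW.
rewrite (le_trans (wide_lip _ _))// opprD addrACA subrr addr0.
apply: (@le_trans _ _ (2 * (`|x - y| / eta))); first by rewrite ler_pM2l.
by rewrite [leRHS]mulrDl mul1r ler_wpDl// mulrA mulrAC.
Qed.

Lemma interpolate_slope_supp (g : X -> R) (x : X) i :
  eta * (B%:R + 3) <= `|co x i| -> interpolate_slope g x = 0.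
Proof.
move=> xB; rewrite /interpolate_slope big1 ?mulr0// => z _.
rewrite [wide_hat z x](_ : _ = 0) ?mul0r//.
rewrite /wide_hat (bigD1 i)//= wide_eq0 ?mul0r//.
have zB : `|(z i)%:R - B%:R| <= B%:R :> R.
  have : (z i)%:R <= (2 * B)%:R :> R by rewrite ler_nat -ltnS ltn_ord.
  by rewrite natrM ler_norml => zi; rewrite lerBrDr; apply/andP; split; 
     [have : 0 <= (z i)%:R :> R by []; lra|lra].
have : B%:R + 3 <= `|co x i / eta|.
  by rewrite normrM normfV (gtr0_norm eta0) ler_pdivlMr// mulrC.
have := ler_distD (B%:R - (z i)%:R) (co x i / eta) 0 .
rewrite /grid_coord !subr0 => h1 h2.
have := ler_normB (co x i / eta + B%:R - (z i)%:R) (B%:R - (z i)%:R).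
rewrite (_ : _ - (_ - _) = co x i / eta); last by ring.
by rewrite [`|B%:R - _|]distrC; lra.
Qed.

End Grid.

Let mesh (j : nat) : R := j.+1%:R^-1.
(** Chosen so that [mesh j] times [B j - 1] is [2 * (j + 1)], the radius beyond which the cutoff
    vanishes. *)
Let B (j : nat) := (2 * j.+1 ^ 2).+1.

Let mesh_gt0 j : 0 < mesh j. Proof. by rewrite invr_gt0. Qed.

Let mesh_le1 j : mesh j <= 1. Proof. by rewrite invf_le1// ler1n. Qed.

(** As [j] grows, the mesh tends to 0 and the cutoff radius to infinity. The subtracted constant
    keeps the value 0 at the origin. *)
Definition mollify (j : nat) (g : X -> R) (x : X) : R :=
  interpolate (mesh j) (B j) (cutoff j.+1%:R g) x -
  interpolate (mesh j) (B j) (cutoff j.+1%:R g) 0.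

Definition weight (j : nat) (g : X -> R) : X -> R :=
  interpolate_slope (mesh j) (B j) (cutoff j.+1%:R g).

(* The factor 3 comes from the cutoff, and [5 ^ m] bounds the sum of the wide
   hats at a point. *)
Definition slope_cst : R := 18 * m%:R ^+ 2 * 5 ^+ m.

Lemma slope_cst_ge0 : 0 <= slope_cst.
Proof. by rewrite !mulr_ge0// exprn_ge0. Qed.

Lemma weight_ge0 j g x : 0 <= weight j g x.
Proof. exact: interpolate_slope_ge0. Qed.

Lemma weight_sum j (s : seq nat) (g : nat -> X -> R) (G : R) x :
  0 <= G -> (forall k, g k 0 = 0) ->
  (forall x y, \sum_(k <- s) `|g k x - g k y| <= G * `|x - y|) ->
  \sum_(k <- s) weight j (g k) x <= slope_cst * G.
Proof.
move=> G0 g0 gG.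
have G3 : 0 <= 3 * G by rewrite mulr_ge0.
have := interpolate_slope_sum (mesh_gt0 j) (B j) x G3
  (cutoff_sum (ltr0Sn R j) G0 g0 gG).
by rewrite (_ : _ * (3 * G) = slope_cst * G)// /slope_cst; ring.
Qed.

Lemma mollify0 j g : mollify j g 0 = 0.
Proof. by rewrite /mollify subrr. Qed.

Lemma mollify_slope j g (x y : X) : `|x - y| <= j.+1%:R^-1 ->
  `|mollify j g x - mollify j g y| <= weight j g x * `|x - y|.
Proof.
rewrite /mollify opprB addrA subrK.
apply: interpolate_slopeP; first exact: mesh_gt0.
move=> z i zi; apply: cutoff_eq0 => //.
rewrite (le_trans _ (co_le z i))// (le_trans _ (ltW zi))//.
rewrite /B -[(2 * _).+1%:R]natr1 addrK natrM natrX /mesh expr2.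
by rewrite mulrCA mulKf// pnatr_eq0.
Qed.

Section Lipschitz.
Context (g : X -> R) (L : R) (L0 : 0 <= L) (g0 : g 0 = 0)
  (gL : forall x y, `|g x - g y| <= L * `|x - y|).

Lemma cutoff_lip (r : R) x y : 0 < r ->
  `|cutoff r g x - cutoff r g y| <= 3 * L * `|x - y|.
Proof.
move=> r0; have := @cutoff_sum _ _ r [:: 0%N] (fun=> g) L r0 L0 (fun=> g0).
move=> /(_ _ x y); rewrite big_seq1; apply => v w.
by rewrite big_seq1.
Qed.

Lemma weight_le j x : weight j g x <= slope_cst * L.
Proof.
have := @weight_sum j [:: 0%N] (fun=> g) L x L0 (fun=> g0).
by rewrite big_seq1; apply => y z; rewrite big_seq1.
Qed.

Lemma mollify_lip j x y : `|mollify j g x - mollify j g y| <= slope_cst * L * `|x - y|.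
Proof.
apply: (local_lipschitz (lexx 0) (mesh_gt0 j)) => {}x {}y xy.
by rewrite mul0r addr0 (le_trans (mollify_slope _ xy))// ler_wpM2r// weight_le.
Qed.

Lemma mollify_small j (r e : R) (x : X) :
  (forall y, `|y| <= r + m%:R -> `|g y| <= e) -> `|x| <= r -> `|mollify j g x| <= 2 * e.
Proof.
move=> ge xr.
have near y : `|y| <= r ->
    `|interpolate (mesh j) (B j) (cutoff j.+1%:R g) y| <= e.
  move=> yr; apply: interpolate_le => // w yw.
  rewrite (le_trans (cutoff_le _ _ _))// ge//.
  rewrite -[w](subKr y) (le_trans (ler_normB _ _))// lerD//.
  by rewrite (le_trans yw)// ler_piMr.
rewrite /mollify (le_trans (ler_normB _ _))// mulr_natl mulr2n lerD// near//.
by rewrite normr0 (le_trans _ xr).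
Qed.

Lemma mollify_near j x : `|x| <= j.+1%:R ->
  `|mollify j g x - g x| <= 6 * L * m%:R / j.+1%:R.
Proof.
move=> xj.
have near y : `|y| <= j.+1%:R ->
    `|interpolate (mesh j) (B j) (cutoff j.+1%:R g) y - g y| <= 3 * L * m%:R / j.+1%:R.
  move=> yj; rewrite -{1}(cutoff_eq (r := j.+1%:R) g _ yj)//.
  apply: interpolate_near => // [i|w yw].
    rewrite (le_trans (co_le _ _))// (le_trans yj)//.
    rewrite /mesh ler_pdivlMl// -natrM ler_nat /B; nia.
  rewrite (le_trans (cutoff_lip _ _ _))// distrC -[leRHS]mulrA ler_wpM2l//.
  by rewrite mulr_ge0.
have -> : mollify j g x - g x =
    (interpolate (mesh j) (B j) (cutoff j.+1%:R g) x - g x) -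
    (interpolate (mesh j) (B j) (cutoff j.+1%:R g) 0 - g 0).
  by rewrite g0 /mollify; ring.
rewrite (le_trans (ler_normB _ _))//.
rewrite (_ : 6 * _ * _ / _ = 3 * L * m%:R / j.+1%:R + 3 * L * m%:R / j.+1%:R).
  by rewrite lerD// near// normr0.
by ring.
Qed.

Lemma weight_blip j : blip (weight j g).
Proof.
apply: interpolate_slope_blip => //.
exists (3 * L + L * (2 * j.+1%:R)); split=> [x|x y].
  have [xj|/ltW xj] := leP (2 * j.+1%:R) `|x|.
    by rewrite cutoff_eq0// normr0 addr_ge0 ?mulr_ge0.
  rewrite (le_trans (cutoff_le _ _ _))// ler_wpDl ?mulr_ge0//.
  by rewrite -[g x]subr0 -g0 (le_trans (gL _ _))// subr0 ler_wpM2l.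
rewrite (le_trans (cutoff_lip _ _ _))// ler_wpM2r// lerDl !mulr_ge0//.
Qed.

Lemma weight_supp j : exists r : R, forall x, r <= `|x| -> weight j g x = 0.
Proof.
exists (m%:R * (mesh j * ((B j)%:R + 3)) + 1) => x xr.
have [i xi|H] := pickP (fun i => mesh j * ((B j)%:R + 3) <= `|co x i|).
  exact: interpolate_slope_supp xi.
have : `|x| <= m%:R * (mesh j * ((B j)%:R + 3)).
  rewrite (le_trans (le_co _))//.
  apply: (@le_trans _ _ (\sum_(i < m) mesh j * ((B j)%:R + 3))); last first.
    by rewrite sumr_const card_ord mulr_natl.
  by apply: ler_sum => i _; have := H i; rewrite leNgt => /negbFE/ltW.
by move=> /(le_trans xr); rewrite gerDl ler10.
Qed.

End Lipschitz.

(** Smallness at the finitely many nodes of a fine grid extends to the ball through the common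
    Lipschitz constant. *)
Lemma uniform_small (g : nat -> X -> R) (L : R) :
  (forall k x y, `|g k x - g k y| <= L * `|x - y|) ->
  (forall x (e : R), 0 < e -> exists K, forall k, (K <= k)%N -> `|g k x| <= e) ->
  forall (r e : R), 0 < e ->
    exists K, forall k, (K <= k)%N -> forall x, `|x| <= r -> `|g k x| <= e.
Proof.
move=> gL gpt r e e0; pose d := 2 * (`|L| + 1) * (m%:R + 1).
have d0 : 0 < d by rewrite mulr_gt0 ?mulr_gt0// ltr_wpDl.
pose eta := e / d; have eta0 : 0 < eta by rewrite divr_gt0.
pose N := Num.bound (`|r| / eta).
have Nr : r <= eta * N%:R.
  have re0 : 0 <= `|r| / eta by rewrite divr_ge0// ltW.
  rewrite mulrC -ler_pdivrMr//; apply: le_trans (ltW (archi_boundP re0)).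
  by rewrite ler_pM2r ?invr_gt0// ler_norm.
have [K HK] := choice (fun z : {ffun 'I_m -> 'I_(2 * N).+1} =>
  gpt (grid_point eta z) (e / 2) (divr_gt0 e0 (ltr0Sn R 1))).
exists (\max_z K z) => k Kk x xr.
have [|z xz] := @grid_point_near eta eta0 N x.
  by move=> i; rewrite (le_trans (co_le x i))// (le_trans xr).
have h1 : `|g k (grid_point eta z)| <= e / 2.
  by apply: HK; rewrite (leq_trans _ Kk)// (leq_bigmax z).
have h2 : `|g k x - g k (grid_point eta z)| <= e / 2.
  rewrite (le_trans (gL k _ _))//.
  apply: (@le_trans _ _ ((`|L| + 1) * ((m%:R + 1) * eta))).
    rewrite (le_trans (ler_wpM2r _ (ler_norm L)))// ler_pM// ?lerDl//.
    by rewrite (le_trans xz)// ler_wpM2r ?lerDl// ltW.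
  rewrite le_eqVlt; apply/orP; left; apply/eqP; rewrite /eta /d; field.
  by rewrite !gt_eqF// ltr_wpDl.
have := ler_normD (g k x - g k (grid_point eta z)) (g k (grid_point eta z)).
by rewrite subrK; lra.
Qed.

End Coordinates.

(** * The gluing argument *)

Section Selection.
Implicit Types P : nat -> Prop.

Lemma uniq_seq_of_infinite P : (forall K, exists2 k, (K <= k)%N & P k) ->
  forall n, exists s : seq nat, [/\ uniq s, size s = n & forall k, k \in s -> P k].
Proof.
move=> Pinf; elim=> [|n [s [us sn sP]]]; first by exists [::].
have [k ks Pk] := Pinf (\max_(k <- s) k).+1.
exists (k :: s); split; rewrite /= ?sn ?us ?andbT//.
  by apply: contraL ks => ks; rewrite -ltnNge ltnS (bigD1_seq k)//= leq_maxl.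
by move=> j; rewrite inE => /predU1P[->//|/sP].
Qed.

Lemma uniform_bound (Q : nat -> nat -> Prop) (s : seq nat) :
  (forall k, k \in s -> exists J, forall j, (J <= j)%N -> Q k j) ->
  exists J, forall j, (J <= j)%N -> forall k, k \in s -> Q k j.
Proof.
elim: s => [|k s IH] sQ; first by exists 0%N.
have [J HJ] := IH (fun i is_ => sQ i (mem_behead (s := k :: s) is_)).
have [J' HJ'] := sQ k (mem_head _ _).
exists (maxn J J') => j; rewrite geq_max => /andP[Jj J'j] i.
by rewrite inE => /predU1P[->|]; [exact: HJ'|exact: HJ].
Qed.

Lemma ler_size_sum {R : realType} (e : R) (s : seq nat) (F : nat -> R) :
  (forall k, k \in s -> e <= F k) -> e * (size s)%:R <= \sum_(k <- s) F k.
Proof.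
elim: s => [|k s IH] sF; first by rewrite big_nil mulr0.
rewrite big_cons/= -[(size s).+1%:R]natr1 mulrDr mulr1 addrC lerD//.
  exact: sF (mem_head _ _).
by apply: IH => j js; apply: sF; rewrite inE js orbT.
Qed.

(** If [P] held infinitely often, there would be sets of every size [n] satisfying it, and
    [e = c / 2] would give [c * n <= 2 * K] for all [n]. *)
Lemma eventually_not {R : realType} P (c : R) : 0 < c ->
  (forall e : R, 0 < e -> exists K : R, forall s, uniq s -> (forall k, k \in s -> P k) ->
    c * (size s)%:R <= e * (size s)%:R + K) ->
  exists K, forall k, (K <= k)%N -> ~ P k.
Proof.
move=> c0 Pc; apply: contrapT => H.
have inf K : exists2 k, (K <= k)%N & P k.
  apply: contrapT => HK; apply: H; exists K => k Kk Pk.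
  by apply: HK; exists k.
have [K HK] := Pc _ (divr_gt0 c0 (ltr0Sn R 1)).
pose n := Num.bound `|2 * K / c|.
have [s [us sn sP]] := uniq_seq_of_infinite inf n.
have := HK s us sP; rewrite sn.
have : 2 * K / c < n%:R by rewrite (le_lt_trans (ler_norm _))// archi_boundP.
by rewrite ltr_pdivrMr//; lra.
Qed.

End Selection.

(** * Lipschitz functions and pointwise slopes *)

Section Slopes.
Context {R : realType} (X : normedModType R).
Implicit Types (f g w v : X -> R).

Definition lipz f := f 0 = 0 /\
  exists2 k : R, 0 <= k & forall x y, `|f x - f y| <= k * `|x - y|.

Lemma lipzD f g : lipz f -> lipz g -> lipz (f + g).
Proof.
move=> [f0 [k k0 fk]] [g0 [l l0 gl]]; split.
  by rewrite [LHS](_ : _ = f 0 + g 0)// f0 g0 addr0.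
exists (k + l) => [|x y]; first exact: addr_ge0.
rewrite (_ : _ - _ = (f x - f y) + (g x - g y)); last first.
  by rewrite [(f + g) x](_ : _ = f x + g x)// [(f + g) y](_ : _ = f y + g y)//; ring.
by rewrite (le_trans (ler_normD _ _))// mulrDl lerD.
Qed.

Lemma lipzZ (a : R) f : lipz f -> lipz (a *: f).
Proof.
move=> [f0 [k k0 fk]]; split; first by rewrite [LHS](_ : _ = a * f 0)// f0 mulr0.
exists (`|a| * k) => [|x y]; first exact: mulr_ge0.
rewrite (_ : _ - _ = a * (f x - f y)); last by rewrite mulrBr.
by rewrite normrM -mulrA ler_wpM2l.
Qed.

(* [w x] bounds the slope of [f] at [x]; the tolerance [K * `|x - y|] makes the
   notion stable under sums without assuming any regularity of [w]. *)
Definition loc_slope f w := exists K r : R, [/\ 0 <= K, 0 < r &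
  forall x y, `|x - y| <= r -> `|f x - f y| <= (w x + K * `|x - y|) * `|x - y|].

Lemma loc_slopeD f g w v : loc_slope f w -> loc_slope g v -> loc_slope (f + g) (w + v).
Proof.
move=> [K [r [K0 r0 fw]]] [L [s [L0 s0 gv]]].
exists (K + L), (Num.min r s); split; [exact: addr_ge0|by rewrite lt_min r0|].
move=> x y; rewrite le_min => /andP[xr xs].
rewrite (_ : _ - _ = (f x - f y) + (g x - g y)); last first.
  by rewrite [(f + g) x](_ : _ = f x + g x)// [(f + g) y](_ : _ = f y + g y)//; ring.
rewrite (le_trans (ler_normD _ _))// [(w + v) x](_ : _ = w x + v x)//.
rewrite [leRHS](_ : _ = (w x + K * `|x - y|) * `|x - y| +
  (v x + L * `|x - y|) * `|x - y|); last by ring.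
by rewrite lerD ?fw ?gv.
Qed.

Lemma loc_slope_sign (b : bool) f w : loc_slope f w -> loc_slope ((-1) ^+ b *: f) w.
Proof.
move=> [K [r [K0 r0 fw]]]; exists K, r; split=> // x y xy.
rewrite (_ : _ - _ = (-1) ^+ b * (f x - f y)); last by rewrite mulrBr.
by rewrite normrM normr_sign mul1r fw.
Qed.

End Slopes.

(** * Gluing perturbations with cut-offs *)

Section Core.
Context {R : realType} (X : normedModType R) (m : nat).
Context (co : X -> 'I_m -> R) (mk : ('I_m -> R) -> X).
Hypotheses (coB : forall x y i, co (x - y) i = co x i - co y i)
  (coK : forall a i, co (mk a) i = a i)
  (co_le : forall x i, `|co x i| <= `|x|)
  (le_co : forall x, `|x| <= \sum_i `|co x i|).

(* [ev k f] stands for the value at [f] of the [k]-th vector of a sequence in the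
   free space. *)
Context (ev : nat -> (X -> R) -> R).
Hypothesis evB : forall k f g, lipz f -> lipz g -> ev k (f - g) = ev k f - ev k g.
Hypothesis ev_cvg : forall k (f : nat -> X -> R) g (M : R), lipz g ->
  (forall j, f j 0 = 0) -> (forall j x y, `|f j x - f j y| <= M * `|x - y|) ->
  (forall x (e : R), 0 < e -> exists J, forall j, (J <= j)%N -> `|f j x - g x| <= e) ->
  forall e : R, 0 < e -> exists J, forall j, (J <= j)%N -> `|ev k (f j) - ev k g| <= e.
Hypothesis ev_no_dual : forall B c : R, 0 <= B -> 0 < c ->
  (forall n : nat, exists l : seq (nat * (X -> R)),
    [/\ size l = n, uniq (map fst l),
        forall q, List.In q l -> lipz q.2 /\ c <= ev q.1 q.2 &
        forall (sg : nat -> bool) x y,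
          `|\sum_(q <- l) (-1) ^+ sg q.1 * q.2 x - \sum_(q <- l) (-1) ^+ sg q.1 * q.2 y|
          <= B * `|x - y|]) -> False.
Hypothesis ev_mean : forall I : set nat, (forall n, exists2 l, (n <= l)%N & I l) ->
  exists (nu : (X -> R) -> R) (C : R),
  [/\ 0 <= C,
      forall (a : R) u v, u \in bfun_pred X -> v \in bfun_pred X ->
        nu (a *: u + v) = a * nu u + nu v,
      forall u c, u \in bfun_pred X -> (forall x, u x <= c) -> nu u <= C * c &
      forall w r, w \in bfun_pred X -> (forall x, 0 <= w x) ->
        (exists n, forall l, (n <= l)%N -> I l ->
          exists f : X -> R, [/\ lipz f, forall x y, `|f x - f y| <= w x * `|x - y| &
            r <= ev l f]) -> r <= nu w].

Context (g : nat -> X -> R) (L : R).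
Hypotheses (L0 : 0 <= L) (g0 : forall k, g k 0 = 0)
  (gL : forall k x y, `|g k x - g k y| <= L * `|x - y|).
Hypothesis gflat : forall e : R, 0 < e -> exists2 K : R, 0 <= K & forall s, uniq s ->
  forall x y, \sum_(k <- s) `|g k x - g k y| <= (e * (size s)%:R + K) * `|x - y|.

Let glip k : lipz (g k).
Proof. by split=> //; exists L. Qed.

(** Infinitely many [k] with [|g k x| > e] would make the sums of [|g k x - g k 0|] grow linearly,
    against [gflat]. *)
Let gpt x (e : R) : 0 < e -> exists K, forall k, (K <= k)%N -> `|g k x| <= e.
Proof.
move=> e0; have [|K HK] := @eventually_not R (fun k => e < `|g k x|) e e0.
  move=> d d0; have x1 : 0 < `|x| + 1 by rewrite ltr_wpDl.
  have [K K0 HK] := gflat (divr_gt0 d0 x1); exists (K * `|x|) => s us sP.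
  rewrite (le_trans (ler_size_sum (fun k ks => ltW (sP k ks))))//.
  have := HK s us x 0; under eq_bigr do rewrite g0 subr0; rewrite subr0.
  move=> /le_trans; apply; rewrite mulrDl lerD2r mulrAC ler_wpM2r//.
  by rewrite mulrAC ler_pdivrMr// ler_wpM2l ?(ltW d0)// lerDl.
by exists K => k /HK/negP; rewrite -leNgt.
Qed.

Let small := uniform_small coB coK co_le le_co gL gpt.

Let W j k := weight co mk j (g k).
Let F j k := mollify co mk j (g k).
Let c1 : R := slope_cst m * L.

Let c1_ge0 : 0 <= c1. Proof. by rewrite mulr_ge0// slope_cst_ge0. Qed.

Let W_bfun j k : W j k \in bfun_pred X.
Proof.
have [K [HK _]] := weight_blip mk coB co_le L0 (g0 k) (gL k) j.
by apply/asboolP; exists K.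
Qed.

Let blip_bfun (f : X -> R) : blip f -> f \in bfun_pred X.
Proof. by move=> [K [fK _]]; apply/asboolP; exists K. Qed.

Let F_lipz j k : lipz (F j k).
Proof.
split; first exact: (mollify0 co mk).
by exists c1 => // x y; exact: (mollify_lip coB coK co_le le_co L0 (g0 k) (gL k)).
Qed.

Section Contradiction.
Context (delta : R) (delta0 : 0 < delta).
Let I := [set k | delta <= ev k (g k)].
Context (nu : (X -> R) -> R) (C : R).
Hypotheses (C0 : 0 <= C)
  (nuD : forall (a : R) u v, u \in bfun_pred X -> v \in bfun_pred X ->
        nu (a *: u + v) = a * nu u + nu v)
  (nuC : forall u c, u \in bfun_pred X -> (forall x, u x <= c) -> nu u <= C * c)
  (nu_ge : forall w r, w \in bfun_pred X -> (forall x, 0 <= w x) ->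
        (exists n, forall l, (n <= l)%N -> I l ->
          exists f : X -> R, [/\ lipz f, forall x y, `|f x - f y| <= w x * `|x - y| &
            r <= ev l f]) -> r <= nu w).

Let nu0 : nu 0 = 0.
Proof.
have b0 : (0 : X -> R) \in bfun_pred X by exact: rpred0.
by have := nuD 1 b0 b0; rewrite scaler0 addr0 mul1r; lra.
Qed.

Let nu_sum (s : seq nat) j : nu (\sum_(k <- s) W j k) = \sum_(k <- s) nu (W j k).
Proof.
elim: s => [|k s IH]; first by rewrite !big_nil.
rewrite !big_cons -[W j k]scale1r nuD ?mul1r ?scale1r ?IH//.
by apply: rpred_sum => i _; exact: W_bfun.
Qed.

Let sum_fctE (s : seq nat) (f : nat -> X -> R) x :
  (\sum_(k <- s) f k) x = \sum_(k <- s) f k x.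
Proof. by elim: s => [|k s IH]; rewrite ?big_nil// !big_cons -IH. Qed.

(* For a fixed mesh the weights of finitely many [g k] add up to little, hence
   by Fatou so do the lower limits of their means as the mesh tends to 0. *)
Let nu_W_small (c : R) : 0 < c -> exists K, forall k, (K <= k)%N ->
  forall J, exists2 j, (J <= j)%N & nu (W j k) < c.
Proof.
move=> c0.
pose bad k := exists J, forall j, (J <= j)%N -> c <= nu (W j k).
have [|K HK] := @eventually_not R bad c c0; last first.
  exists K => k /HK kbad J; apply: contrapT => H; apply: kbad; exists J => j Jj.
  by rewrite leNgt; apply/negP => nuc; apply: H; exists j.
move=> e e0; pose D : R := C * slope_cst m + 1.
have D0 : 0 < D by rewrite ltr_wpDl// mulr_ge0// slope_cst_ge0.
have [K K0 HK] := gflat (divr_gt0 e0 D0); exists (D * K) => s us sbad.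
have [J HJ] := uniform_bound sbad.
rewrite (le_trans (ler_size_sum (HJ J (leqnn _))))// -nu_sum.
have eK : 0 <= e / D * (size s)%:R + K.
  by apply: addr_ge0 => //; apply: mulr_ge0 => //; exact: divr_ge0 (ltW e0) (ltW D0).
rewrite (le_trans (nuC (c := slope_cst m * (e / D * (size s)%:R + K)) _ _))//.
- by apply: rpred_sum => i _; exact: W_bfun.
- move=> x; rewrite sum_fctE.
  exact: (weight_sum coB coK le_co J x eK g0 (HK s us)).
rewrite mulrA (_ : e * _ + _ = D * (e / D * (size s)%:R + K)).
  by rewrite ler_wpM2r// lerDl.
by field; rewrite gt_eqF.
Qed.

(** Data after [n] steps: [l] lists the glued functions with their indices, [V] is the total weight
    used, and [T] is the part kept by the cut-offs, bounded independently of [n]. The bounded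
    support and small mean of [V] leave room for the next function. *)
Let state (e c : R) (n : nat) (l : seq (nat * (X -> R))) (V T : X -> R) :=
  [/\ size l = n, uniq (map fst l) &
      forall q, List.In q l -> lipz q.2 /\ delta / 4 <= ev q.1 q.2] /\
  [/\ blip V, forall x, 0 <= V x, exists r, forall x, r <= `|x| -> V x = 0 &
      nu V <= n%:R * c] /\
  [/\ forall x, T x <= V x, forall x, T x <= 1 + c1 &
      forall sg : nat -> bool,
        loc_slope (\sum_(q <- l) (-1) ^+ sg q.1 *: q.2) (fun x => T x + n%:R * e)].

Let state0 e c : state e c 0 [::] (fun=> 0) (fun=> 0).
Proof.
split; [by split|split].
  split; [exact: blip_cst|by []|by exists 0|].
  by rewrite [nu _]nu0 mul0r.
split; [by []|by move=> x; rewrite addr_ge0|move=> sg].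
rewrite big_nil; exists 0, 1; split; [by []|by []|move=> x y _].
rewrite [leLHS](_ : _ = `|0 - 0 : R|)// subrr normr0.
by rewrite !mul0r !addr0 mul0r.
Qed.

(* Multiplying [F j k] by [1 - clamp V] removes its slope from the region where
   the slopes already used add up to 1; the error made on [ev k] is controlled
   by [nu V]. *)
Let state_step (e c : R) n l V T : 0 < e -> 0 < c ->
  c1 * (n%:R * c) + C * e < delta / 4 -> state e c n l V T ->
  exists k H V' T', state e c n.+1 ((k, H) :: l) V' T'.
Proof.
move=> e0 c0 small_nce [[ln ul lP] [[Vb V0 [r Vr] nuV] [TV T1 Tsl]]].
have [K [_ chil]] := blip_clamp Vb.
pose r' := Num.max r 0.
have Vr' x : r' <= `|x| -> V x = 0.
  by rewrite /r' ge_max => /andP[/Vr].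
(* Near the support of [chi] the new function will be at most [2 * e']; times the Lipschitz constant
   [K] of [chi] this is at most [e]. *)
pose e' := e / (2 * (`|K| + 1)).
have K1 : 0 < `|K| + 1 by rewrite ltr_wpDl.
have e'0 : 0 < e' by rewrite divr_gt0 ?mulr_gt0.
have e'K t : 0 <= t -> 2 * e' * (K * t) <= e * t.
  move=> t0; rewrite mulrA ler_wpM2r// (_ : e = 2 * e' * (`|K| + 1)); last first.
    by rewrite /e'; field; rewrite gt_eqF.
  apply: ler_wpM2l; first by apply: mulr_ge0 => //; exact: ltW.
  by rewrite (le_trans (ler_norm K))// lerDl.
have [Ks HKs] := small (r' + 1 + m%:R) e'0.
have [Kc HKc] := nu_W_small c0.
pose chi x := clamp (V x).
have chi01 x : 0 <= chi x <= 1 by rewrite clamp_ge0 clamp_le1.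
have chi_le x : chi x <= V x.
  rewrite /chi; have [V1|V1] := leP (V x) 1; first by rewrite clamp_id// V0.
  by rewrite (le_trans (clamp_le1 _))// ltW.
have chi0 x : r' <= `|x| -> chi x = 0 by move=> /Vr' Vx; rewrite /chi Vx clamp_eq0.
(* [w] dominates the slope of the removed part [Fk * chi]: [c1 * chi <= c1 * V] comes from [Fk], and
   [e] from the cut-off. *)
pose w x := c1 * V x + e.
have w0 x : 0 <= w x by apply: addr_ge0; [exact: mulr_ge0|exact: ltW].
have wb : blip w by apply: blipD; [apply: blipM => //|]; exact: blip_cst.
have nuw : nu w < delta / 4.
  have -> : w = c1 *: V + (fun=> e) by [].
  have eb : (fun=> e : R) \in bfun_pred X by apply: blip_bfun; exact: blip_cst.
  rewrite (nuD _ (blip_bfun Vb) eb); apply: le_lt_trans small_nce.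
  by rewrite lerD ?ler_wpM2l// nuC.
(* As [nu w < delta / 4], [nu_ge] yields arbitrarily large [k] in [I] for which every function of
   slope at most [w] has pairing below [delta / 4]. *)
have [k [kK Ik kw]] : exists k, [/\ (maxn (maxn Ks Kc) (\max_(q <- l) q.1).+1 <= k)%N,
    I k & forall f : X -> R, lipz f ->
      (forall x y, `|f x - f y| <= w x * `|x - y|) -> ev k f < delta / 4].
  apply: contrapT => H; move: nuw; rewrite ltNge => /negP; apply.
  apply: nu_ge; [exact: blip_bfun|exact: w0|].
  exists (maxn (maxn Ks Kc) (\max_(q <- l) q.1).+1) => k kK Ik.
  apply: contrapT => Hk; apply: H; exists k; split=> // f fl fw.
  by rewrite ltNge; apply/negP => fd; apply: Hk; exists f.
move: kK; rewrite !geq_max => /andP[/andP[Ksk Kck] lk].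
have kl : k \notin map fst l.
  apply: contraL lk => /mapP[q ql ->]; rewrite -ltnNge ltnS.
  by rewrite (big_rem q)//= leq_maxl.
have [J HJ] : exists J, forall j, (J <= j)%N -> `|ev k (F j k) - ev k (g k)| <= delta / 2.
  apply: (@ev_cvg k (fun j => F j k) (g k) c1) => //.
  - by move=> j; exact: (mollify0 co mk).
  - by move=> j x y; exact: (mollify_lip coB coK co_le le_co L0 (g0 k) (gL k)).
  - move=> x d d0.
    have M0 : 0 <= (6 * L * m%:R) / d by rewrite divr_ge0 ?(ltW d0)// mulr_ge0// mulr_ge0.
    exists (maxn (Num.bound `|x|) (Num.bound (6 * L * m%:R / d))) => j.
    rewrite geq_max => /andP[j1 j2].
    apply: le_trans (mollify_near coB coK co_le le_co L0 (g0 k) (gL k) _) _.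
      rewrite (le_trans (ltW (archi_boundP (normr_ge0 x))))// ler_nat.
      exact: leq_trans j1 _.
    rewrite ler_pdivrMr// [d * _]mulrC -ler_pdivrMr//.
    rewrite (le_trans (ltW (archi_boundP M0)))// ler_nat.
    exact: leq_trans j2 _.
  - by rewrite divr_gt0.
(* The mesh is chosen after [k]: fine enough to keep the pairing at least [delta / 2], with a weight
   of mean less than [c]. *)
have [j Jj nuW] := HKc k Kck J.
have {HJ Jj} evF : delta / 2 <= ev k (F j k).
  have : delta <= ev k (g k) := Ik.
  by have := HJ j Jj; rewrite ler_norml => /andP[h _]; lra.
pose Fk := F j k.
have Fl x y : `|Fk x - Fk y| <= c1 * `|x - y|.
  exact: (mollify_lip coB coK co_le le_co L0 (g0 k) (gL k)).
have Fsmall x : `|x| <= r' + 1 -> `|Fk x| <= 2 * e'.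
  by apply: (mollify_small coB coK le_co) => y; exact: HKs.
have chiF x y : `|y| <= r' + 1 -> `|Fk y * (chi x - chi y)| <= e * `|x - y|.
  move=> yr; apply: le_trans (e'K _ (normr_ge0 _)).
  by rewrite normrM; apply: ler_pM => //; [exact: Fsmall|exact: chil].
pose Fchi x := Fk x * chi x.
have Fchi_w x y : `|Fchi x - Fchi y| <= w x * `|x - y|.
  have [yr|yr] := leP `|y| r'.
    rewrite (_ : _ - _ = (Fk x - Fk y) * chi x + Fk y * (chi x - chi y)); last first.
      by rewrite /Fchi; ring.
    rewrite (le_trans (ler_normD _ _))// [leRHS]mulrDl lerD//; last first.
      by rewrite chiF// (le_trans yr)// lerDl.
    have /andP[cx0 _] := chi01 x.
    by rewrite normrM (ger0_norm cx0) mulrAC ler_pM.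
  rewrite /Fchi (chi0 y (ltW yr)) mulr0 subr0.
  have [xr|xr] := leP `|x| r'.
    apply: (@le_trans _ _ (e * `|x - y|)).
      have := @chiF y x; rewrite (chi0 y (ltW yr)) sub0r mulrN normrN distrC; apply.
      by rewrite (le_trans xr)// lerDl.
    by rewrite ler_wpM2r// /w lerDr mulr_ge0.
  by rewrite (chi0 x (ltW xr)) mulr0 normr0 mulr_ge0.
have Fk_lipz : lipz Fk by exact: F_lipz.
have Fchi_lipz : lipz Fchi.
  split; first by rewrite /Fchi Fk_lipz.1 mul0r.
  have [M [wM _]] := wb; exists `|M| => // x y.
  rewrite (le_trans (Fchi_w x y))// ler_wpM2r//.
  by rewrite (le_trans (ler_norm _))// (le_trans (wM x))// ler_norm.
(* Removing [Fchi] costs less than [delta / 4] of the pairing [delta / 2]. *)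
pose H := Fk - Fchi.
have Hl : lipz H.
  by rewrite /H -scaleN1r; apply: lipzD => //; exact: lipzZ.
have evH : delta / 4 <= ev k H.
  rewrite evB//; have := kw _ Fchi_lipz Fchi_w; lra.
exists k, H, (V + W j k), (fun x => T x + W j k x * (1 - chi x)).
have W0 x : 0 <= W j k x by exact: weight_ge0.
have Wc x : W j k x <= c1.
  exact: (weight_le coB coK le_co L0 (g0 k) (gL k)).
have cc x : 0 <= 1 - chi x <= 1.
  by have /andP[? ?] := chi01 x; rewrite subr_ge0 lerBlDr lerDl; apply/andP.
split; [split|split].
- by rewrite /= ln.
- by rewrite /= kl.
- by move=> q [<-//|/lP].
- split.
  + apply: blipD => //; exact: (weight_blip mk coB co_le L0 (g0 k) (gL k)).
  + by move=> x; rewrite addr_ge0.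
  + have [rW HrW] := weight_supp mk le_co (g k) j.
    exists (Num.max r rW) => x; rewrite ge_max => /andP[rx rWx].
    by rewrite [LHS](_ : _ = V x + W j k x)// Vr// add0r; exact: HrW.
  + rewrite -[V]scale1r (nuD _ (blip_bfun Vb) (W_bfun _ _)) mul1r -[n.+1%:R]natr1 mulrDl mul1r.
    by rewrite lerD// ltW.
split.
- move=> x; rewrite [leRHS](_ : _ = V x + W j k x)// lerD//.
  by rewrite ler_piMr//; have /andP[] := cc x.
(* Where [V >= 1] the cut-off kills the new weight; elsewhere [T <= V <= 1] and the new weight is at
   most [c1]. *)
- move=> x; have [V1|/ltW V1] := leP 1 (V x).
    by rewrite /chi clamp_eq1// subrr mulr0 addr0.
  have /andP[h1 h2] := cc x.
  rewrite lerD//; first exact: le_trans (TV x) _.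
  by rewrite (le_trans _ (Wc x))// ler_piMr.
move=> sg; rewrite big_cons /=.
have Hs : loc_slope H (fun x => W j k x * (1 - chi x) + e).
  (* Within distance 1 of a point of norm above [r' + 1], [chi] vanishes; within one mesh,
     [mollify_slope] applies. *)
  exists 0, (Num.min 1 j.+1%:R^-1).
  split; [by []|by rewrite lt_min ltr01 invr_gt0 ltr0Sn|move=> x y].
  rewrite le_min => /andP[xy1 xyj].
  rewrite mul0r addr0 (_ : _ - _ = (Fk x - Fk y) * (1 - chi x) - Fk y * (chi x - chi y)).
    rewrite (le_trans (ler_normB _ _))// [leRHS]mulrDl lerD//.
      have /andP[h1 _] := cc x.
      rewrite normrM (ger0_norm h1) mulrAC ler_wpM2r//.
      exact: (mollify_slope mk coB co_le).
    have [yr|yr] := leP `|y| (r' + 1); first exact: chiF.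
    have xr : r' <= `|x|.
      have := ler_normB x (x - y); rewrite subKr; lra.
    have yr2 : r' <= `|y| by rewrite (le_trans _ (ltW yr))// lerDl.
    by rewrite (chi0 x xr) (chi0 y yr2) subrr mulr0 normr0 mulr_ge0// ltW.
  by rewrite [H x](_ : _ = Fk x - Fchi x)// [H y](_ : _ = Fk y - Fchi y)// /Fchi; ring.
have := loc_slopeD (loc_slope_sign (sg k) Hs) (Tsl sg).
congr (loc_slope _ _); apply/funext => x.
rewrite [LHS](_ : _ = (W j k x * (1 - chi x) + e) + (T x + n%:R * e))//.
by rewrite -[n.+1%:R]natr1; ring.
Qed.

(** [C * e] and [c1 * (n * c)] are each at most [delta / 16], so [state_step] applies [N] times;
    [e <= 1 / (N + 1)] keeps the accumulated error [N * e] below 1. *)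
Let states (N : nat) : exists l V T, state (Num.min N.+1%:R^-1 (delta / (16 * (C + 1))))
  (delta / (16 * (c1 + 1) * N.+1%:R)) N l V T.
Proof.
set e := Num.min _ _; set c := delta / _.
have C1 : 0 < C + 1 by rewrite ltr_wpDl.
have d1 : 0 < c1 + 1 by rewrite ltr_wpDl.
have N1 : 0 < N.+1%:R :> R by rewrite ltr0Sn.
have e0 : 0 < e.
  by rewrite lt_min invr_gt0 N1 divr_gt0// mulr_gt0.
have cc : 0 < c by rewrite divr_gt0// mulr_gt0// mulr_gt0.
have Ce : C * e <= delta / 16.
  apply: (@le_trans _ _ ((C + 1) * (delta / (16 * (C + 1))))).
    by apply: ler_pM => //; [exact: ltW|rewrite lerDl|rewrite ge_min lexx orbT].
  by rewrite le_eqVlt; apply/orP; left; apply/eqP; field; rewrite gt_eqF.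
have c1c n : (n <= N)%N -> c1 * (n%:R * c) <= delta / 16.
  move=> nN; apply: (@le_trans _ _ ((c1 + 1) * (N.+1%:R * c))).
    apply: ler_pM => //; first by rewrite mulr_ge0// ltW.
      by rewrite lerDl.
    by rewrite ler_wpM2r ?(ltW cc)// ler_nat leqW.
  rewrite le_eqVlt; apply/orP; left; apply/eqP; rewrite /c; field.
  by rewrite !gt_eqF.
suff H n : (n <= N)%N -> exists l V T, state e c n l V T by exact: H.
elim: n => [|n IH] nN; first by exists [::], (fun=> 0), (fun=> 0); exact: state0.
have [l [V [T st]]] := IH (ltnW nN).
have [|k [H [V' [T' st']]]] := state_step e0 cc _ st.
  have d4 : delta / 16 + delta / 16 < delta / 4 by have := delta0; lra.
  by rewrite (le_lt_trans _ d4)// lerD// c1c// ltnW.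
by exists ((k, H) :: l), V', T'.
Qed.

Lemma mean_contradiction : False.
Proof.
(* [1 + c1] bounds [T] and 1 bounds the accumulated error, so this Lipschitz constant does not
   depend on [N]. *)
have B0 : 0 <= 2 + c1 by rewrite addr_ge0.
apply: (ev_no_dual B0 (divr_gt0 delta0 (ltr0Sn R 3))) => N.
have [l [V [T [[ln ul lP] [_ [_ T1 Tsl]]]]]] := states N.
exists l; split=> // sg.
have [K [r [K0 r0 Hr]]] := Tsl sg.
have E x : (\sum_(q <- l) (-1) ^+ sg q.1 *: q.2) x = \sum_(q <- l) (-1) ^+ sg q.1 * q.2 x.
  by elim: (l) => [|q s IH]; rewrite ?big_nil// !big_cons -IH.
apply: (local_lipschitz (f := fun x => \sum_(q <- l) (-1) ^+ sg q.1 * q.2 x) K0 r0).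
move=> x y xy; rewrite -!E (le_trans (Hr x y xy))// ler_wpM2r// lerD2r.
apply: (@le_trans _ _ ((1 + c1) + N%:R * N.+1%:R^-1)).
  by rewrite lerD// ler_wpM2l// ge_min lexx.
have : N%:R / N.+1%:R <= 1 :> R by rewrite ler_pdivrMr ?ltr0Sn// mul1r ler_nat.
by rewrite (_ : 2 + c1 = 1 + c1 + 1); [rewrite lerD2l|ring].
Qed.

End Contradiction.

Lemma weakly_null_pairing (delta : R) : 0 < delta ->
  exists K, forall k, (K <= k)%N -> ev k (g k) < delta.
Proof.
move=> delta0; apply: contrapT => H.
have Iinf n : exists2 l, (n <= l)%N & [set k | delta <= ev k (g k)] l.
  apply: contrapT => Hn; apply: H; exists n => k nk.
  by rewrite ltNge; apply/negP => kd; apply: Hn; exists k.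
have [nu [C [C0 nuD nuC nu_ge]]] := ev_mean Iinf.
exact: (mean_contradiction delta0 C0 nuD nuC nu_ge).
Qed.

End Core.

(** * Lipschitz-free spaces *)

Section FreeSpace.
Context {R : realType}.

Lemma dual_apply_le (V : normedModType R) (phi : dual V) (v : V) :
  `|phi v| <= `|phi| * `|v|.
Proof.
have [->|v0] := eqVneq v 0; first by rewrite linear0 !normr0 mulr0.
have nv : 0 < `|v| by rewrite normr_gt0.
rewrite -ler_pdivrMr// mulrC -[`|v|^-1]ger0_norm ?invr_ge0// -normrM.
rewrite -[_ * phi v](scalar_scale (dual_scalar phi)).
by apply: dual_norm_ub; rewrite normrZ normfV normr_id mulVf ?gt_eqF.
Qed.

Context (M : metricType R) (o : M).
Local Notation F := (lipschitz_free o).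

Lemma lip0_dist_le (f : Lip0 o) x y : `|f x - f y| <= `|f| * mdist x y.
Proof. exact: (lip_normP f).2. Qed.

Lemma lip0_norm_le (f : Lip0 o) (k : R) : 0 <= k ->
  (forall x y, `|f x - f y| <= k * mdist x y) -> `|f| <= k.
Proof. by move=> k0 fk; exact: lip_norm_le. Qed.

Lemma free_apply_le (m : F) (f : Lip0 o) : `|free_val m f| <= `|m| * `|f|.
Proof. exact: dual_apply_le. Qed.

Lemma free_delta_subproof x : @delta R M o x \in @free_pred R M o.
Proof.
apply/mem_set/subset_closure; exists 1%N, (fun=> 1), (fun=> x).
by rewrite big_ord1 scale1r.
Qed.

Definition free_delta (x : M) : F := LipschitzFree (free_delta_subproof x).

Lemma free_delta_dist x y : `|free_delta x - free_delta y| <= mdist x y.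
Proof.
apply: dual_norm_le => f f1.
rewrite [leLHS](_ : _ = `|f x - f y|)// (le_trans (lip0_dist_le _ _ _))//.
by rewrite ler_piMl// mdist_ge0.
Qed.

Lemma free_val_sum n (a : 'I_n -> R) (x : 'I_n -> M) :
  free_val (\sum_i a i *: free_delta (x i)) = \sum_i a i *: @delta R M o (x i).
Proof. by rewrite -[LHS]/(val _) raddf_sum; apply: eq_bigr => i _. Qed.

Lemma free_approx (m : F) (e : R) : 0 < e ->
  exists n (a : 'I_n -> R) (x : 'I_n -> M), `|m - \sum_i a i *: free_delta (x i)| <= e.
Proof.
move=> e0; have /set_mem mc : free_val m \in @free_pred R M o := valP m.
have [phi [[n [a [x ->]]] B]] := mc _ (nbhsx_ballx (free_val m) e e0).
exists n, a, x; move: B; rewrite -ball_normE /= => /ltW; apply: le_trans.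
by rewrite -free_val_sum.
Qed.

(** Approximate [m] by a finite combination of evaluations, which sees only finitely many points;
    the uniform bound [K] controls the rest. *)
Lemma free_apply_cvg (m : F) (f : nat -> Lip0 o) (g : Lip0 o) (K : R) :
  (forall j, `|f j| <= K) ->
  (forall x (e : R), 0 < e -> exists J, forall j, (J <= j)%N -> `|f j x - g x| <= e) ->
  forall e : R, 0 < e ->
    exists J, forall j, (J <= j)%N -> `|free_val m (f j) - free_val m g| <= e.
Proof.
move=> fK fg e e0.
have K0 : 0 <= K by rewrite (le_trans _ (fK 0%N)).
pose D := K + `|g| + 1.
have D0 : 0 < D by rewrite ltr_wpDl// addr_ge0.
have [n [a [x mx]]] := free_approx m (divr_gt0 e0 (mulr_gt0 (ltr0Sn R 1) D0)).
pose s := \sum_i a i *: free_delta (x i).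
pose A := \sum_i `|a i| + 1.
have A0 : 0 < A by rewrite ltr_wpDl// sumr_ge0.
have sE h : free_val s h = \sum_i a i * h (x i).
  rewrite free_val_sum.
  elim/big_rec2: _ => [//|i u v _ <-].
  by rewrite [LHS](_ : _ = a i * h (x i) + v h).
have [J HJ] := choice (fun i => fg (x i) _ (divr_gt0 e0 (mulr_gt0 (ltr0Sn R 1) A0))).
exists (\max_i J i) => j Jj.
have fgj i : `|f j (x i) - g (x i)| <= e / (2 * A).
  by apply: HJ; rewrite (leq_trans _ Jj)// leq_bigmax.
rewrite -raddfB -(subrK s m) [X in `|X|](_ : _ = free_val (m - s) (f j - g) + free_val s (f j - g))//.
rewrite (le_trans (ler_normD _ _))// [leRHS](_ : e = e / 2 + e / 2); last by field.
apply: lerD.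
  rewrite (le_trans (free_apply_le _ _))//.
  apply: (@le_trans _ _ (e / (2 * D) * D)).
    apply: ler_pM => //; rewrite (le_trans (ler_normB _ _))//.
    by rewrite (le_trans (lerD (fK j) (lexx _)))// lerDl.
  by rewrite le_eqVlt; apply/orP; left; apply/eqP; field; rewrite gt_eqF.
rewrite sE (le_trans (ler_norm_sum _ _ _))//.
apply: (@le_trans _ _ (\sum_i `|a i| * (e / (2 * A)))).
  by apply: ler_sum => i _; rewrite normrM ler_wpM2l//; exact: fgj.
rewrite -mulr_suml; apply: (@le_trans _ _ (A * (e / (2 * A)))).
  rewrite ler_wpM2r ?lerDl// divr_ge0 ?(ltW e0)// mulr_ge0// ltW//.
by rewrite le_eqVlt; apply/orP; left; apply/eqP; field; rewrite gt_eqF.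
Qed.

(** Both sides are linear and continuous and agree on evaluations, whose span is dense. *)
Lemma free_functionalE (phi : F -> R) (C : R) (g : Lip0 o) : scalar phi ->
  (forall m, `|phi m| <= C * `|m|) -> (forall x, g x = phi (free_delta x)) ->
  forall m, phi m = free_val m g.
Proof.
move=> phil phiC gphi m; apply/eqP; rewrite -subr_eq0 -normr_le0.
apply/ler_addgt0Pr => e e0; rewrite add0r.
pose D := `|C| + `|g| + 1.
have D0 : 0 < D by rewrite ltr_wpDl// addr_ge0.
have [n [a [x]]] := free_approx m (divr_gt0 e0 D0).
set s := \sum_i _ => ms.
have sE : phi s = free_val s g.
  rewrite free_val_sum (scalar_sum phil).
  elim/big_rec2: _ => [//|i u v _ ->].
  by rewrite (scalar_scale phil) -gphi.
have -> : phi m - free_val m g = phi (m - s) - free_val (m - s) g.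
  have -> : phi (m - s) = phi m - phi s.
    by rewrite -scaleN1r addrC phil mulN1r addrC.
  rewrite [free_val (m - s) g](_ : _ = free_val m g - free_val s g)// sE.
  by ring.
rewrite (le_trans (ler_normB _ _))//.
apply: (@le_trans _ _ (`|C| * (e / D) + e / D * `|g|)).
  apply: lerD.
    rewrite (le_trans (phiC _))// (le_trans (ler_wpM2r _ (ler_norm C)))//.
    by rewrite ler_wpM2l.
  by rewrite (le_trans (free_apply_le _ _))// ler_wpM2r.
rewrite (_ : _ + _ = e / D * (`|C| + `|g|)); last by ring.
rewrite mulrAC ler_pdivrMr// ler_wpM2l ?(ltW e0)// lerDl//.
Qed.

End FreeSpace.

(** * Pairings over a metric space isometric to a finite-dimensional normed space *)

Section FreePairing.
Context {R : realType} (X : normedModType R) (m : nat).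
Context (co : X -> 'I_m -> R) (mk : ('I_m -> R) -> X).
Hypotheses (coB : forall x y i, co (x - y) i = co x i - co y i)
  (coK : forall a i, co (mk a) i = a i)
  (co_le : forall x i, `|co x i| <= `|x|)
  (le_co : forall x, `|x| <= \sum_i `|co x i|).
Context (M : metricType R) (o : M) (io : X -> M) (oi : M -> X).
Hypotheses (ioK : cancel io oi) (oi0 : oi o = 0)
  (oi_dist : forall x y, mdist x y = `|oi x - oi y|).
Local Notation F := (lipschitz_free o).

(** Functions that do not define an element of [Lip0 o] are sent to [0], so that [ev] is defined on
    all functions. *)
Let lift (f : X -> R) : Lip0 o := insubd 0 (f \o oi).

Let liftE f x : lipz f -> lift f x = f (oi x).
Proof.
move=> [f0 [k k0 fk]]; rewrite /lift [lip0_fun _]insubdK//.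
apply/asboolP; split; first by rewrite /= oi0.
by exists k; split=> // y z; rewrite oi_dist fk.
Qed.

Let lift_norm f k : lipz f -> 0 <= k -> (forall x y, `|f x - f y| <= k * `|x - y|) ->
  `|lift f| <= k.
Proof.
by move=> fl k0 fk; apply: lip0_norm_le => // x y; rewrite !liftE// oi_dist.
Qed.

Let lift_sum (l : seq (nat * (X -> R))) (sg : nat -> bool) x :
  (forall q, List.In q l -> lipz q.2) ->
  (\sum_(q <- l) (-1) ^+ sg q.1 *: lift q.2) x =
  \sum_(q <- l) (-1) ^+ sg q.1 * q.2 (oi x).
Proof.
elim: l => [|q l IH] lP; first by rewrite !big_nil.
rewrite !big_cons -IH; last by move=> r rl; apply: lP; right.
by rewrite -(liftE x (lP q (or_introl erefl))).
Qed.

Let unlift (f : Lip0 o) : X -> R := f \o io.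

Let io_dist x y : mdist (io x) (io y) = `|x - y|.
Proof. by rewrite oi_dist !ioK. Qed.

Hypothesis oiK : cancel oi io.

Let unlift_lipz f : lipz (unlift f).
Proof.
split; first by rewrite /unlift /= -oi0 oiK lip0_base.
exists `|f| => // x y; rewrite -io_dist; exact: lip0_dist_le.
Qed.

Let liftK f : lift (unlift f) = f.
Proof.
apply/val_inj/funext => x; rewrite [LHS](liftE _ (unlift_lipz f)).
by rewrite /unlift /= oiK.
Qed.

Context (z : nat -> F) (g : nat -> Lip0 o).
Hypotheses (zs : banach_saks z) (gs : banach_saks g).

Let ev k (f : X -> R) := free_val (z k) (lift f).

Let evB k f h : lipz f -> lipz h -> ev k (f - h) = ev k f - ev k h.
Proof.
move=> fl hl; rewrite /ev -raddfB; congr (free_val _ _).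
apply/val_inj/funext => x.
rewrite [LHS]liftE; last by rewrite -scaleN1r; apply: lipzD => //; exact: lipzZ.
by rewrite [RHS](_ : _ = lift f x - lift h x)// !liftE.
Qed.

Let ev_cvg k (f : nat -> X -> R) h (B : R) : lipz h ->
  (forall j, f j 0 = 0) -> (forall j x y, `|f j x - f j y| <= B * `|x - y|) ->
  (forall x (e : R), 0 < e -> exists J, forall j, (J <= j)%N -> `|f j x - h x| <= e) ->
  forall e : R, 0 < e -> exists J, forall j, (J <= j)%N -> `|ev k (f j) - ev k h| <= e.
Proof.
move=> hl f0 fB fh.
have fB' j x y : `|f j x - f j y| <= `|B| * `|x - y|.
  by rewrite (le_trans (fB _ _ _))// ler_wpM2r// ler_norm.
have fl j : lipz (f j) by split=> //; exists `|B|.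
apply: (@free_apply_cvg R M o (z k) (fun j => lift (f j)) (lift h) `|B|) => [j|x e e0]; first exact: lift_norm.
have [J HJ] := fh (oi x) e e0; exists J => j Jj; rewrite !liftE//; exact: HJ.
Qed.

Let ev_no_dual (B c : R) : 0 <= B -> 0 < c ->
  (forall n : nat, exists l : seq (nat * (X -> R)),
    [/\ size l = n, uniq (map fst l),
        forall q, List.In q l -> lipz q.2 /\ c <= ev q.1 q.2 &
        forall (sg : nat -> bool) x y,
          `|\sum_(q <- l) (-1) ^+ sg q.1 * q.2 x - \sum_(q <- l) (-1) ^+ sg q.1 * q.2 y|
          <= B * `|x - y|]) -> False.
Proof.
move=> B0 c0 H; apply: (banach_saks_no_dual_system zs B0 c0) => n.
have [l [ln ul lP lB]] := H n.
exists [seq (q.1, fun v : F => free_val v (lift q.2)) | q <- l]; split.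
- by rewrite size_map.
- by rewrite -map_comp.
- move=> q /List.in_map_iff[r [<- /lP[rl rc]]]; split=> //=.
- move=> sg v; rewrite big_map /=.
  have -> : \sum_(q <- l) (-1) ^+ sg q.1 * free_val v (lift q.2) =
      free_val v (\sum_(q <- l) (-1) ^+ sg q.1 *: lift q.2).
    rewrite (scalar_sum (dual_scalar (free_val v))); apply: eq_bigr => q _.
    by rewrite (scalar_scale (dual_scalar (free_val v))).
  rewrite (le_trans (free_apply_le _ _))// mulrC ler_wpM2r//.
  have lz q : List.In q l -> lipz q.2 by move=> /lP[].
  apply: lip0_norm_le => // x y; rewrite !lift_sum// oi_dist; exact: lB.
Qed.

Let ev_mean (I : set nat) : (forall n, exists2 l, (n <= l)%N & I l) ->
  exists (nu : (X -> R) -> R) (C : R),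
  [/\ 0 <= C,
      forall (a : R) u v, u \in bfun_pred X -> v \in bfun_pred X ->
        nu (a *: u + v) = a * nu u + nu v,
      forall u c, u \in bfun_pred X -> (forall x, u x <= c) -> nu u <= C * c &
      forall w r, w \in bfun_pred X -> (forall x, 0 <= w x) ->
        (exists n, forall l, (n <= l)%N -> I l ->
          exists f : X -> R, [/\ lipz f, forall x y, `|f x - f y| <= w x * `|x - y| &
            r <= ev l f]) -> r <= nu w].
Proof.
move=> Iinf; have [C C0 zC] := banach_saks_bounded zs.
have [|nu [nuD nuC nu_ge]] := @dominating_mean R M o (fun k f => free_val (z k) f) C I
  (fun k => dual_scalar (free_val (z k))) (ltW C0) _ Iinf.
  by move=> k f; rewrite (le_trans (free_apply_le _ _))// ler_wpM2r.
have toM (u : X -> R) : u \in bfun_pred X -> u \o oi \in bfun_pred M.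
  by move=> /asboolP[K uK]; apply/asboolP; exists K => x /=.
exists (fun u => nu (u \o oi)), C; split=> [|a u v ub vb|u c ub uc|w r wb w0 [n wr]].
- exact: ltW.
- by rewrite -nuD ?toM.
- by rewrite nuC ?toM// => x /=.
- apply: nu_ge; [exact: toM|by move=> x /=|exists n => l nl Il].
  have [f [fl fw rf]] := wr l nl Il; exists (lift f) => // x y.
  by rewrite !liftE// oi_dist; exact: fw.
Qed.

Lemma free_pairing_null (delta : R) : 0 < delta ->
  exists K, forall k, (K <= k)%N -> free_val (z k) (g k) < delta.
Proof.
move=> delta0; have [L L0 gL] := banach_saks_bounded gs.
have [|||K HK] := weakly_null_pairing coB coK co_le le_co evB ev_cvg ev_no_dual ev_mean
  (g := fun k => unlift (g k)) (ltW L0) _ _ _ delta0.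
- by move=> k; have [] := unlift_lipz (g k).
- move=> k x y; rewrite -io_dist (le_trans (lip0_dist_le _ _ _))//.
  by rewrite ler_wpM2r// mdist_ge0.
- move=> e e0; have [K HK] := banach_saks_signed gs e0.
  exists `|K| => // s us x y.
  (* With these signs every increment is nonnegative, so the sum of absolute values is one increment
     of a signed sum of the [g k]. *)
  pose sg k := g k (io x) - g k (io y) < 0.
  apply: (@le_trans _ _ (`|\sum_(k <- s) (-1) ^+ sg k *: g k| * `|x - y|)); last first.
    by rewrite ler_wpM2r// (le_trans (HK s sg us))// lerD2l ler_norm.
  rewrite -io_dist (le_trans _ (lip0_dist_le _ _ _))//.
  have E w : (\sum_(k <- s) (-1) ^+ sg k *: g k) w = \sum_(k <- s) (-1) ^+ sg k * g k w.
    by elim: (s) => [|k t IH]; rewrite ?big_nil// !big_cons -IH.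
  rewrite !E -sumrB (le_trans _ (ler_norm _))//; apply: ler_sum => k _.
  rewrite -mulrBr /sg; set d := g k (io x) - _.
  case: (ltrP d 0) => [d0|d0] /=; rewrite ?mul1r ?mulN1r.
    by rewrite ltr0_norm.
  by rewrite ger0_norm.
exists K => k Kk; have := HK k Kk; by rewrite /ev liftK.
Qed.

End FreePairing.

(** * Tails in l1-sums *)

Section L1Tail.
Context {R : realType} (X : nat -> normedModType R).
Local Notation Z := (l1sum X).

Definition l1part (y : Z) (N : nat) : R := \sum_(k < N) `|y k|.

Lemma l1part_le y N : l1part y N <= `|y|.
Proof. exact: l1_le (@l1sumP _ _ y). Qed.

Lemma l1part_mono y N N' : (N <= N')%N -> l1part y N <= l1part y N'.
Proof.
move=> NN; rewrite -(subnKC NN) /l1part big_split_ord/= lerDl.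
exact: sumr_ge0.
Qed.

Lemma l1part_near y (e : R) : 0 < e -> exists N, `|y| - l1part y N <= e.
Proof.
move=> e0; have yc : series (fun n => `|y n|) @ \oo --> `|y| by exact: (@l1sumP _ _ y).
have /cvgrPdist_le/(_ e e0)[N _ /(_ N (leqnn N))] := yc.
by rewrite /series/= big_mkord => h; exists N; rewrite (le_trans (ler_norm _)).
Qed.

Lemma l1norm_le (y : Z) (B : R) : (forall N, \sum_(k < N) `|y k| <= B) -> `|y| <= B.
Proof. by move=> yB; exact: (l1_bounded yB).2. Qed.

Definition band_fun (a b : nat) (y : Z) : forall n, X n :=
  fun n => if (a <= n < b)%N then y n else 0.

Lemma band_sum a b y N : (a <= b)%N ->
  \sum_(k < N) `|band_fun a b y k| <= l1part y b - l1part y a.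
Proof.
move=> ab; rewrite /l1part -!(big_mkord xpredT (fun k => `|y k|)).
rewrite (big_cat_nat (n := a))//= addrAC subrr add0r.
rewrite -(big_mkord xpredT (fun k => `|band_fun a b y k|)).
rewrite (eq_bigr (fun k => if (a <= k < b)%N then `|y k| else 0)); last first.
  by move=> k _; rewrite /band_fun; case: ifP; rewrite ?normr0.
rewrite -big_mkcond -big_filter [leRHS]big_seq -[leRHS]big_filter.
apply: ler_sum_uniq_sub => [||k|k] //.
- by rewrite filter_uniq// iota_uniq.
- by rewrite filter_uniq// iota_uniq.
- by rewrite !mem_filter !mem_index_iota => /andP[-> _].
Qed.

Lemma band_summable a b y : norm_summable (band_fun a b y).
Proof.
apply: (l1_bounded (C := `|y|) _).1 => N.
apply: le_trans (l1part_le y N); apply: ler_sum => k _.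
by rewrite /band_fun; case: ifP => // _; rewrite normr0.
Qed.

Definition band a b y : Z := L1Sum (@band_summable a b y).

Lemma band_norm a b y : (a <= b)%N -> `|band a b y| <= l1part y b - l1part y a.
Proof. by move=> ab; apply: l1norm_le => N; exact: band_sum. Qed.

Lemma band_linear a b (c : R) x y : band a b (c *: x + y) = c *: band a b x + band a b y.
Proof.
apply: l1sum_eq => n /=; rewrite /band_fun.
by case: ifP => _ //; rewrite scaler0 addr0.
Qed.

Lemma band_tail_norm a y : `|y - band 0 a y| <= `|y| - l1part y a.
Proof.
apply: l1norm_le => N; rewrite lerBrDr; set t := y - _.
apply: le_trans (l1part_le y (a + N)).
have : \sum_(k < N) `|t k| <= l1part t (a + N).
  by apply: (l1part_mono t (leq_addl a N)).
rewrite /l1part !big_split_ord/= [X in _ <= X + _ -> _]big1 => [|k _]; last first.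
  by rewrite /band_fun /= ltn_ord subrr normr0.
rewrite add0r => h; rewrite [leLHS]addrC lerD2l (le_trans h)//.
apply: ler_sum => k _.
by rewrite /band_fun /= ltnNge leq_addr subr0.
Qed.

Definition l1inj_fun (n : nat) (x : X n) : forall k, X k := dfwith (fun k => 0 : X k) n x.

Lemma l1inj_sum n (x : X n) N : \sum_(k < N) `|l1inj_fun x k| <= `|x|.
Proof.
have E (k : 'I_N) : k != n :> nat -> `|l1inj_fun x k| = 0.
  by move=> kn; rewrite /l1inj_fun dfwithout ?normr0// eq_sym.
have [nN|nN] := ltnP n N.
  rewrite (bigD1 (Ordinal nN))//= big1 => [|k kn]; first by rewrite addr0 /l1inj_fun dfwithin.
  by rewrite E// -val_eqE.
rewrite big1 => [//|k _]; apply: E.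
by rewrite neq_ltn (leq_trans (ltn_ord k)).
Qed.

Definition l1inj (n : nat) (x : X n) : Z := L1Sum (l1_bounded (l1inj_sum x)).1.

Lemma l1inj_norm n (x : X n) : `|l1inj x| <= `|x|.
Proof. by apply: l1norm_le => N; exact: l1inj_sum. Qed.

Lemma l1inj_linear n (c : R) (x y : X n) : l1inj (c *: x + y) = c *: l1inj x + l1inj y.
Proof.
apply: l1sum_eq => k /=; rewrite /l1inj_fun.
have [kn|kn] := eqVneq n k; first by subst k; rewrite !dfwithin.
by rewrite !dfwithout// scaler0 addr0.
Qed.

Lemma band_recr (N : nat) (y : Z) : band 0 N.+1 y = band 0 N y + l1inj (y N).
Proof.
apply: l1sum_eq => k /=; rewrite /band_fun /l1inj_fun /= ltnS leq_eqVlt.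
have [->|kN] := eqVneq k N; first by rewrite dfwithin ltnn add0r.
by rewrite dfwithout 1?eq_sym//= addr0.
Qed.

Lemma band0 y : band 0 0 y = 0.
Proof. by apply: l1sum_eq => k. Qed.

Lemma scalar_band (phi : Z -> R) (N : nat) y : scalar phi ->
  phi (band 0 N y) = \sum_(n < N) phi (l1inj (y n)).
Proof.
move=> phil; elim: N => [|N IH].
  by rewrite big_ord0 band0 -(scale0r 0) (scalar_scale phil) mul0r.
by rewrite big_ord_recr/= -IH band_recr -[band 0 N y]scale1r phil mul1r scale1r.
Qed.

(** * Uniform tails by a gliding hump *)

Section Tail.
Context (z : nat -> Z) (zs : banach_saks z) (G : nat -> Z -> R) (C : R).
Hypotheses (Gl : forall k, scalar (G k)) (C0 : 0 < C)
  (GC : forall k y, `|G k y| <= C * `|y|).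

Let GB k x y : G k (x - y) = G k x - G k y.
Proof. by rewrite -scaleN1r addrC Gl mulN1r addrC. Qed.

(** The functionals in [l] live on successive bands of coordinates below [N], which bounds their
    signed sums by [C]. The vectors used so far are small beyond [N]. *)
Let state (e : R) n (l : seq (nat * (Z -> R))) N :=
  [/\ size l = n /\ uniq (map fst l),
      forall q, List.In q l -> scalar q.2 /\ e / 2 <= q.2 (z q.1),
      forall k, k \in map fst l -> C * (`|z k| - l1part (z k) N) <= e / 2 &
      forall (sg : nat -> bool) y,
        `|\sum_(q <- l) (-1) ^+ sg q.1 * q.2 y| <= C * l1part y N].

Let state_step e n l N : 0 < e -> state e n l N ->
  (exists k, e < `|G k (z k - band 0 N (z k))|) ->
  exists q N', state e n.+1 (q :: l) N'.
Proof.
move=> e0 [[ln ul] lP lN lB] [k Hk].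
have e2 : 0 < e / 2 by rewrite divr_gt0.
(* Used vectors are too small beyond [N] to satisfy [Hk], so [k] is new. *)
have kl : k \notin map fst l.
  apply: contraTN Hk => /lN kN; rewrite -leNgt (le_trans (GC _ _))//.
  rewrite (le_trans (ler_wpM2l (ltW C0) (band_tail_norm _ _)))// (le_trans kN)//.
  by lra.
have [N1 HN1] := l1part_near (z k) (divr_gt0 e2 C0).
pose N' := maxn N N1.
have NN' : (N <= N')%N by exact: leq_maxl.
have zN' : C * (`|z k| - l1part (z k) N') <= e / 2.
  rewrite mulrC -ler_pdivlMr// (le_trans _ HN1)// lerD2l lerN2.
  by rewrite l1part_mono// leq_maxr.
(* Beyond [N'] the vector [z k] contributes at most [e / 2], so [G k] on the band from [N] to [N']
   keeps at least [e / 2], up to the sign [b]. *)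
pose b := G k (z k - band 0 N (z k)) < 0.
pose H y := (-1) ^+ b * G k (band N N' y).
have bandE y : band N N' y = band 0 N' y - band 0 N y.
  apply: l1sum_eq => i /=.
  rewrite /band_fun /=.
  case: (leqP N i) => Ni /=; first by rewrite subr0.
  by rewrite (leq_trans Ni NN') subrr.
exists (k, H), N'; split.
- by rewrite /= ln kl.
- move=> q [<-|/lP//] /=; split.
    by move=> a x y; rewrite /H band_linear Gl; ring.
  rewrite /H; have -> : band N N' (z k) = (z k - band 0 N (z k)) - (z k - band 0 N' (z k)).
    by rewrite bandE opprB [RHS]addrC subrKA.
  rewrite GB mulrBr.
  have := GC k (z k - band 0 N' (z k)).
  move=> /le_trans/(_ (ler_wpM2l (ltW C0) (band_tail_norm _ _)))/le_trans/(_ zN').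
  move: Hk; rewrite /b.
  set u := G k _; set v := G k _; rewrite ler_norml => eu /andP[v1 v2].
  case: (ltrP u 0) eu => u0 /=.
    by rewrite ltr0_norm// !mulN1r; lra.
  by rewrite ger0_norm// !mul1r; lra.
- move=> j; rewrite inE => /predU1P[->//|/lN jN].
  rewrite (le_trans _ jN)// ler_wpM2l ?(ltW C0)// lerD2l lerN2.
  exact: l1part_mono.
- move=> sg y; rewrite big_cons (le_trans (ler_normD _ _))//=.
  rewrite -(subrK (l1part y N) (l1part y N')) mulrDr lerD//.
  rewrite /H mulrA !normrM !normr_sign mul1r mul1r (le_trans (GC _ _))//.
  by rewrite ler_wpM2l ?(ltW C0)// band_norm.
Qed.

(** If no [N] worked, humps could be chosen [n] times for every [n], contrary to
    [banach_saks_no_dual_system]. *)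
Lemma banach_saks_tail (e : R) : 0 < e ->
  exists N, forall k, `|G k (z k - band 0 N (z k))| <= e.
Proof.
move=> e0; apply: contrapT => H.
have {}H N : exists k, e < `|G k (z k - band 0 N (z k))|.
  apply: contrapT => HN; apply: H; exists N => k.
  by rewrite leNgt; apply/negP => ke; apply: HN; exists k.
have st n : exists l N, state e n l N.
  elim: n => [|n [l [N st]]].
    exists [::], 0%N; split=> // sg y.
    by rewrite big_nil normr0 mulr_ge0 ?(ltW C0)// sumr_ge0.
  by have [q [N' st']] := state_step e0 st (H N); exists (q :: l), N'.
apply: (banach_saks_no_dual_system zs (ltW C0) (divr_gt0 e0 (ltr0Sn R 1))) => n.
have [l [N [[ln ul] lP _ lB]]] := st n; exists l; split=> // sg y.
by rewrite (le_trans (lB sg y))// ler_wpM2l ?(ltW C0)// l1part_le.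
Qed.

End Tail.

End L1Tail.

(** * The sequence space and the conclusion *)

Section Powers.
Context {R : realType} (p : R).

(** For [t >= e] use [t / e <= (t / e)^p]. Summed over [n] coordinates, this gives [e * n] plus a
    multiple of the sum of [p]-th powers. *)
Lemma le_add_powR (e : R) : 1 <= p -> 0 < e ->
  forall t, 0 <= t -> t <= e + e * (e^-1 `^ p) * t `^ p.
Proof.
move=> p1 e0 t t0; have [te|/ltW et] := leP t e.
  by rewrite (le_trans te)// lerDl !mulr_ge0 ?powR_ge0// ltW.
have q1 : 1 <= t / e by rewrite ler_pdivlMr// mul1r.
have : t / e <= (t / e) `^ p by rewrite -{1}[t / e]powRr1 ?(le_trans ler01)// ler_powR.
rewrite powRM ?invr_ge0 ?(ltW e0)// ler_pdivrMr// => h.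
rewrite (le_trans h)// mulrAC mulrC mulrA ler_wpDl ?(ltW e0)//.
by rewrite mulrC mulrA mulrAC.
Qed.

(** Past [A], the factor [t^(p - 1)] is at least [1 / e]. Applied to [t = n^(1/p)], it shows that
    [n^(1/p)] is [o(n)]. *)
Lemma le_powR_add (e : R) : 1 < p -> 0 < e ->
  exists K : R, forall t, 0 <= t -> t <= e * t `^ p + K.
Proof.
move=> p1 e0; pose A := (e^-1) `^ (p - 1)^-1.
have p10 : 0 < p - 1 by rewrite subr_gt0.
exists A => t t0; have [tA|At] := leP t A.
  by rewrite (le_trans tA)// lerDr mulr_ge0 ?powR_ge0// ltW.
rewrite ler_wpDr ?powR_ge0//.
have tp : 0 < t by rewrite (le_lt_trans _ At)// powR_ge0.
have -> : t `^ p = t * t `^ (p - 1).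
  rewrite -{2}[t]powRr1// -powRD; last by rewrite (gt_eqF tp) implybT.
  by congr (_ `^ _); ring.
rewrite mulrCA ler_peMr// -ler_pdivrMl// mulr1.
have -> : e^-1 = A `^ (p - 1).
  by rewrite /A -powRrM mulVf ?gt_eqF// powRr1// invr_ge0 ltW.
by rewrite ge0_ler_powR ?nnegrE ?powR_ge0 ?(ltW tp) ?(ltW p10) ?(ltW At).
Qed.

End Powers.

(** * Unit vectors and coordinate functionals of [ellp] *)

Section Ellp.
Context {R : realType} (p : R) (p1 : 1 <= p).
Local Notation E := (ellp p1).

Let p0 : 0 < p. Proof. exact: lt_le_trans ltr01 p1. Qed.

Lemma ellp_partial_le (u : E) N : \sum_(k < N) `|u k| `^ p <= `|u| `^ p.
Proof.
rewrite -[leLHS](powRKV p1); last by rewrite sumr_ge0// => *; exact: powR_ge0.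
apply: (le_powR p1); first exact: powR_ge0.
exact: psum_le (@ellp_summable _ _ _ u).
Qed.

Lemma ellp_norm_le (u : E) (C : R) : 0 <= C ->
  (forall N, (\sum_(k < N) `|u k| `^ p) `^ p^-1 <= C) -> `|u| <= C.
Proof. by move=> C0 uC; exact: (psum_bounded p1 C0 uC).2. Qed.

Lemma ellp_coord_le (u : E) k : `|u k| <= `|u|.
Proof.
rewrite -[leLHS](powRVK p1)// -[leRHS](powRVK p1)//.
apply: le_powRV => //.
apply: le_trans (ellp_partial_le u k.+1).
by rewrite big_ord_recr/= lerDr sumr_ge0// => *; exact: powR_ge0.
Qed.

Let indic (s : seq nat) : nat -> R := fun k => (k \in s)%:R.

Let indic_partial (s : seq nat) N : uniq s ->
  (\sum_(k < N) `|indic s k| `^ p) `^ p^-1 <= (size s)%:R `^ p^-1.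
Proof.
move=> us; apply: le_powRV => //; first by rewrite sumr_ge0// => *; exact: powR_ge0.
rewrite -(big_mkord xpredT (fun k => `|indic s k| `^ p)).
rewrite (eq_bigr (fun k => if k \in s then 1 else 0)); last first.
  move=> k _; rewrite /indic; case: (k \in s); first by rewrite normr1 powR1.
  by rewrite normr0 powR0// gt_eqF.
rewrite -big_mkcond -big_filter.
have -> : (size s)%:R = \sum_(k <- s) (1 : R).
  by rewrite big_const_seq count_predT iter_addr_0.
apply: ler_sum_uniq_sub => //; first by rewrite filter_uniq// iota_uniq.
by move=> k; rewrite mem_filter => /andP[].
Qed.

Let indic_ellp s : indic (undup s) \in ellp_pred p.
Proof.
apply/asboolP.
exact: (psum_bounded p1 (powR_ge0 _ _) (fun N => indic_partial N (undup_uniq s))).1.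
Qed.

Definition ellp_unit (k : nat) : E := Ellp p1 (indic_ellp [:: k]).

Lemma ellp_unitE k j : ellp_unit k j = (j == k)%:R.
Proof. by rewrite [LHS](_ : _ = (j \in [:: k])%:R)// inE. Qed.

Lemma ellp_sum_unitE (s : seq nat) j :
  (\sum_(k <- s) ellp_unit k) j = \sum_(k <- s) (j == k)%:R.
Proof.
elim: s => [|k s IH]; first by rewrite !big_nil.
by rewrite !big_cons -IH -ellp_unitE.
Qed.

Lemma ellp_sum_unit_norm (s : seq nat) : uniq s ->
  `|\sum_(k <- s) ellp_unit k| <= (size s)%:R `^ p^-1.
Proof.
move=> us; apply: ellp_norm_le => [|N]; first exact: powR_ge0.
rewrite (eq_bigr (fun k : 'I_N => `|indic s k| `^ p)) ?indic_partial// => k _.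
congr (`|_| `^ _); rewrite ellp_sum_unitE /indic.
have [ks|ks] := boolP ((k : nat) \in s).
  rewrite (bigD1_seq (k : nat))//= eqxx big1 ?addr0// => j jk.
  by rewrite eq_sym (negPf jk).
rewrite big_seq big1// => j js; case: eqP => // kj.
by move: ks; rewrite kj js.
Qed.

Lemma ellp_unit_norm k : `|ellp_unit k| <= 1.
Proof.
have := @ellp_sum_unit_norm [:: k] isT.
by rewrite big_seq1 powR1.
Qed.

Lemma ellp_coord_subproof k : (fun u : E => u k) \in lip0_pred (0 : E).
Proof.
apply/asboolP; split=> //; exists 1; split=> // x y.
by rewrite mul1r; exact: ellp_coord_le (x - y) k.
Qed.

Definition ellp_coord (k : nat) : Lip0 (0 : E) := MkLip0 (ellp_coord_subproof k).

Lemma ellp_coord_norm k : `|ellp_coord k| <= 1.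
Proof.
apply: lip0_norm_le => // x y.
by rewrite mul1r; exact: ellp_coord_le (x - y) k.
Qed.

(** Apply [le_add_powR] to the normalized coordinates [|u k| / |u|], whose [p]-th powers sum to at
    most 1; this weak Hoelder inequality avoids the conjugate exponent. *)
Lemma ellp_coord_sum (e : R) (s : seq nat) (u : E) : 0 < e -> uniq s ->
  \sum_(k <- s) `|u k| <= (e * (size s)%:R + e * (e^-1 `^ p)) * `|u|.
Proof.
move=> e0 us; have [->|u0] := eqVneq u 0.
  rewrite [leLHS]big1 => [|k _]; last exact: (normr0 R).
  by rewrite [X in _ * X]normr0 mulr0.
have n0 : 0 < `|u| by rewrite normr_gt0.
rewrite -ler_pdivrMr// mulr_suml.
apply: (@le_trans _ _ (\sum_(k <- s) (e + e * (e^-1 `^ p) * (`|u k| / `|u|) `^ p))).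
  by apply: ler_sum => k _; rewrite le_add_powR// divr_ge0.
rewrite big_split/= -mulr_sumr lerD//.
  by rewrite big_const_seq count_predT iter_addr_0 mulr_natr.
rewrite ler_piMr ?mulr_ge0 ?powR_ge0 ?(ltW e0)//.
apply: (@le_trans _ _ (\sum_(k <- s) (`|u| `^ p)^-1 * `|u k| `^ p)).
  apply: ler_sum => k _; rewrite powRM ?invr_ge0// mulrC.
  by rewrite -(powR_inv1 (normr_ge0 u)) -powRrM mulN1r powRN.
have up : 0 < `|u| `^ p by exact: powR_gt0.
rewrite -mulr_sumr mulrC (ler_pdivrMr _ _ up) mul1r.
apply: le_trans (ellp_partial_le u (\max_(k <- s) k).+1).
rewrite -(big_mkord xpredT (fun k => `|u k| `^ p)).
apply: ler_sum_uniq_sub; [exact: us|exact: iota_uniq|move=> k ks|move=> k; exact: powR_ge0].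
by rewrite mem_index_iota ltnS (bigD1_seq k)//= leq_maxl.
Qed.

Lemma ellp_coord_banach_saks : banach_saks ellp_coord.
Proof.
move=> e e0; exists (e * (e^-1 `^ p)) => s us.
apply: lip0_norm_le => [|x y].
  by rewrite addr_ge0 ?mulr_ge0 ?powR_ge0 ?(ltW e0).
have coordE w : (\sum_(k <- s) ellp_coord k) w = \sum_(k <- s) w k.
  by elim: (s) => [|k t IH]; rewrite ?big_nil// !big_cons -IH.
rewrite !coordE -sumrB (le_trans (ler_norm_sum _ _ _))//.
exact: ellp_coord_sum (x - y) e0 us.
Qed.

End Ellp.

(** * Adjoints of operators between free spaces *)

Section Pullback.
Context {R : realType} (M N : metricType R) (o : M) (q : N).
Context (T : lipschitz_free o -> lipschitz_free q) (C : R).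
Hypotheses (Tl : linear T) (TC : forall m, `|T m| <= C * `|m|).

Let TB x y : T (x - y) = T x - T y.
Proof. by rewrite -scaleN1r addrC Tl scaleN1r addrC. Qed.

Let pull (h : Lip0 q) : M -> R := fun x => free_val (T (free_delta o x)) h.

Let pull_dist h x y : `|pull h x - pull h y| <= `|C| * `|h| * mdist x y.
Proof.
rewrite [pull h x - _](_ : _ = free_val (T (free_delta o x - free_delta o y)) h); last first.
  by rewrite TB.
rewrite (le_trans (free_apply_le _ _))// mulrAC ler_wpM2r//.
rewrite (le_trans (TC _))// (le_trans (ler_wpM2r _ (ler_norm C)))//.
by rewrite ler_wpM2l// free_delta_dist.
Qed.

Let pull_lip0 h : pull h \in @lip0_pred R M o.
Proof.
apply/asboolP; split; last first.
  exists (`|C| * `|h|); split=> [|x y]; first exact: mulr_ge0.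
  exact: pull_dist.
have d0 : free_delta o o = 0 by apply/val_inj/val_inj/funext => f; exact: lip0_base.
have T0 : T 0 = 0 by rewrite -(subrr 0) TB subrr.
by rewrite /pull d0 T0.
Qed.

(** The adjoint of [T], with Lipschitz functions viewed as functionals on the free spaces. *)
Definition pullback (h : Lip0 q) : Lip0 o := MkLip0 (pull_lip0 h).

Lemma pullback_linear : linear pullback.
Proof.
move=> a x y; apply/val_inj/funext => w.
by rewrite [LHS](_ : _ = free_val (T (free_delta o w)) (a *: x + y))// linearP.
Qed.

Lemma pullback_bounded : bounded_op pullback.
Proof.
exists `|C| => h; apply: lip0_norm_le => [|x y]; first exact: mulr_ge0.
exact: pull_dist.
Qed.

Lemma pullbackE m h : free_val (T m) h = free_val m (pullback h).
Proof.
apply: (@free_functionalE R M o (fun m => free_val (T m) h) (`|C| * `|h|)) => //.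
  by move=> a x y; rewrite Tl.
move=> w; rewrite (le_trans (free_apply_le _ _))// mulrAC ler_wpM2r//.
by rewrite (le_trans (TC _))// (le_trans (ler_wpM2r _ (ler_norm C))).
Qed.

End Pullback.

(** * The lifted unit vectors in the free space of [ellp] *)

Section Lift0.
Context {R : realType} (p : R) (p1 : 1 < p).
Local Notation E := (ellp (ltW p1)).
Local Notation F := (lipschitz_free (0 : E)).

Definition ellp_lift (k : nat) : F :=
  lift_vec (@ellp_unit R p (ltW p1)) (@free_delta R E 0) k.

Let delta_nonexpansive : nonexpansive (@free_delta R E 0).
Proof. by move=> x y; exact: free_delta_dist. Qed.

Lemma ellp_lift_banach_saks : banach_saks ellp_lift.
Proof.
move=> e e0; have [K HK] := le_powR_add p1 e0.
exists (K + 6) => s us.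
apply: le_trans (lift_vec_sum (@ellp_unit_norm R p (ltW p1)) delta_nonexpansive us) _.
rewrite [leRHS]addrA lerD2r (le_trans (ellp_sum_unit_norm _ us))//.
apply: le_trans (HK _ (powR_ge0 _ _)) _.
by rewrite powRKV// ltW.
Qed.

Lemma ellp_lift_coord k : free_val (ellp_lift k) (ellp_coord (ltW p1) k) = 1.
Proof.
apply: (@lift_vec_coord R E F _ _ (fun v : F => free_val v (ellp_coord (ltW p1) k))
  (fun x : E => x k)) => //.
- by rewrite ellp_unitE eqxx.
- by move=> j jk; rewrite ellp_unitE gtn_eqF.
Qed.

End Lift0.

(** Indices start at 0, so the summand of index [n] is the free space over dimension [n.+1]. *)
Theorem corollary4 (R : realType) (p : R) (p1 : 1 < p) :
  ~ isomorphic
      (lipschitz_free (0 : ellp (ltW p1)))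
      (l1sum (fun n => lipschitz_free (0 : ellpn (ltW p1) n.+1))).
Proof.
move=> [f [g [fK _ [Cf fC] [Cg gC]]]].
set V := lipschitz_free _ in f g fK fC gC *.
set W := l1sum _ in f g fK fC gC *.
pose z k : W := f (ellp_lift p1 k).
have zs : banach_saks z.
  apply: (banach_saks_image (f := f)) (ellp_lift_banach_saks p1); last by exists Cf.
  exact: linearP.
(* The [k]-th coordinate functional read through the inverse isomorphism; it takes the value 1 at
   [z k]. *)
pose G k (y : W) : R := free_val (g y) (ellp_coord (ltW p1) k).
have Gl k : scalar (G k).
  by move=> a x y; rewrite /G linearP.
pose C := `|Cg| + 1.
have C0 : 0 < C by rewrite ltr_wpDl.
have gC' y : `|g y| <= C * `|y|.
  by rewrite (le_trans (gC y))// ler_wpM2r// (le_trans (ler_norm _))// lerDl.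
have GC k y : `|G k y| <= C * `|y|.
  rewrite (le_trans (free_apply_le _ _))// (le_trans _ (gC' y))//.
  by rewrite ler_piMr// ellp_coord_norm.
have Gz k : G k (z k) = 1 by rewrite /G /z fK ellp_lift_coord.
(* One [N] serves all [k]: the part of [z k] beyond the first [N] summands contributes at most
   [1 / 2]. *)
have [N HN] := banach_saks_tail zs Gl C0 GC (divr_gt0 (ltr01 : 0 < 1 :> R) (ltr0Sn R 1)).
pose X n := lipschitz_free (0 : ellpn (ltW p1) n.+1).
pose T n (m : X n) : V := g (l1inj (X := X) m).
have Tl n : linear (@T n).
  by move=> a x y; rewrite /T l1inj_linear linearP.
have TC n m : `|@T n m| <= C * `|m|.
  by rewrite (le_trans (gC' _))// ler_wpM2l ?(ltW C0)// l1inj_norm.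
(* In each single summand the pairing is eventually below [1 / (4 * (N + 1))], so that [N] summands
   contribute at most [1 / 4]. *)
have null n : exists K, forall k, (K <= k)%N ->
    G k (l1inj (X := X) (z k n)) < (4 * N.+1%:R)^-1.
  have d0 : 0 < (4 * N.+1%:R)^-1 :> R by rewrite invr_gt0 mulr_gt0.
  have zn : banach_saks (fun k => z k n).
    apply: (@banach_saks_image R W (X n) (fun y : W => y n) z) zs; first by [].
    exists 1 => y; rewrite mul1r; apply: le_trans (l1part_le y n.+1).
    by rewrite /l1part big_ord_recr/= lerDr sumr_ge0.
  have gn := banach_saks_image (pullback_linear (Tl n) (TC n))
    (pullback_bounded (Tl n) (TC n)) (ellp_coord_banach_saks (ltW p1)).
  have [K HK] := @free_pairing_null R (ellpn (ltW p1) n.+1) n.+1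
    (fun x i => x 0 i) (fun a => \row_i a i)
    (@ellpnBE R p (ltW p1) n.+1) (@ellpn_rowE R p (ltW p1) n.+1)
    (@ellpn_coord_le R p (ltW p1) n.+1) (@ellpn_le_sum R p (ltW p1) n.+1)
    (ellpn (ltW p1) n.+1) 0 id id (fun=> erefl) erefl
    (@ellpn_mdist R p (ltW p1) n.+1) (fun=> erefl) _ _ zn gn _ d0.
  exists K => k Kk; apply: le_lt_trans (HK k Kk).
  by rewrite /G -[g _]/(T n (z k n)) (pullbackE (Tl n) (TC n)).
have [K HK] := choice null.
pose k := \max_(n < N) K n.
have : G k (band 0 N (z k)) <= N%:R * (4 * N.+1%:R)^-1.
  rewrite (scalar_band N (z k) (Gl k)).
  apply: (@le_trans _ _ (\sum_(n < N) (4 * N.+1%:R)^-1)); last first.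
    by rewrite sumr_const card_ord -[leLHS]mulr_natl.
  apply: ler_sum => n _; apply/ltW/HK.
  exact: (leq_bigmax (F := fun n : 'I_N => K n)).
have : N%:R * (4 * N.+1%:R)^-1 <= 1 / 4 :> R.
  rewrite ler_pdivrMr ?mulr_gt0//.
  have -> : 1 / 4 * (4 * N.+1%:R) = N.+1%:R :> R by field.
  by rewrite ler_nat leqW.
(* Head and tail now give [1 <= 1 / 4 + 1 / 2]. *)
have := HN k; have -> : G k (z k - band 0 N (z k)) = 1 - G k (band 0 N (z k)).
  by rewrite -[- band 0 N _]scaleN1r addrC (Gl k) mulN1r addrC Gz.
rewrite ler_norml => /andP[_ tail_le] coef_le head_le.
have := le_trans head_le coef_le; move: tail_le; move: (G k _) => a; clear; lra.
Qed.
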